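(* Suppose that $\mathcal{A}=(A_0,\ldots,A_{M-1})$ is a collection of real invertible $d\times d$ matrices which is proximal and strongly irreducible. Then for any $t\ge 0$ there exists a unique Gibbs state $\mu_{\mathcal{A},t}$ for $(\mathcal{A},t)$. Moreover: 1. $\mu_{\mathcal{A},t}$ is weak Bernoulli. 2. $\mu_{\mathcal{A},t}$ has exponential decay of correlations for Hölder continuous functions: for each fixed $\theta\in(0,1)$ there are constants $D$ and $\gamma\in(0,1)$ such that $$\left|\int f\cdot g\circ\sigma^n\,d\mu_{\mathcal{A},t}-\int f\,d\mu_{\mathcal{A},t}\int g\,d\mu_{\mathcal{A},t}\right|\le D\,\|f\|_\theta\,\|g\|_\theta\,\gamma^n$$ for all $f,g\in\mathcal{H}_\theta$ and $n\ge 0$.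
   Context: Let $\Sigma=\{0,\ldots,M-1\}$ and let $\sigma$ be the left shift on the two-sided full shift $\Sigma^{\mathbb{Z}}$. The cylinder is $[x_0\cdots x_{n-1}]=\{y\in\Sigma^{\mathbb{Z}}:y_i=x_i,\ 0\le i\le n-1\}$. A collection of invertible $d\times d$ matrices $(A_0,\ldots,A_{M-1})$ is strongly irreducible if the matrices do not preserve a (non-empty) finite union of proper and non-trivial subspaces of $\mathbb{R}^d$. A matrix $B\in M_d(\mathbb{R})$ is proximal if $B$ has a simple eigenvalue of modulus $\rho(B)$ (the spectral radius) and every other eigenvalue has modulus strictly smaller than $\rho(B)$. The collection is proximal if some product $B=A_{x_0}\cdots A_{x_n}$ is proximal. Matrix Gibbs state: a shift-invariant Borel probability measure $\mu$ on $\Sigma^{\mathbb{Z}}$ is a Gibbs state for $(\mathcal{A},t)$ if there exist constants $C>0$ and $P\in\mathbb{R}$ with $$C^{-1}\mu([x_0\cdots x_{n-1}])\le e^{-nP}\|A_{x_0}\cdots A_{x_{n-1}}\|^t\le C\,\mu([x_0\cdots x_{n-1}])$$ for all $x\in\Sigma^{\mathbb{Z}}$, $n>0$. Weak Bernoulli: for finite measurable partitions $\mathcal{Q},\mathcal{R}$ and $\varepsilon>0$, write $\mathcal{Q}\perp^{\varepsilon}\mathcal{R}$ if $\sum_{q\in\mathcal{Q},r\in\mathcal{R}}|\mu(q\cap r)-\mu(q)\mu(r)|<\varepsilon$. A partition $\mathcal{P}$ is weak Bernoulli if for every $\varepsilon>0$ there is $N'$ such that $\bigvee_{i=0}^{s-1}\sigma^{-i}\mathcal{P}\perp^{\varepsilon}\bigvee_{i=m}^{m+r-1}\sigma^{-i}\mathcal{P}$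 for all $r,s\ge 0$ and $m\ge s+N'$. The measure $\mu$ is weak Bernoulli if the standard partition $\mathcal{P}=\{[i]:0\le i\le M-1\}$ is weak Bernoulli. Hölder functions: $\mathrm{var}_n f=\sup\{|f(x)-f(y)|:x_i=y_i\text{ for all }|i|\le n-1\}$. For $\theta\in(0,1)$, $\mathcal{H}_\theta$ is the set of $f\in C(\Sigma^{\mathbb{Z}})$ for which there is a constant $c>0$ with $\mathrm{var}_n f\le c\,\theta^n$ for all $n\ge 0$; the least such constant is denoted $|f|_\theta$, and $\|f\|_\theta=\|f\|_\infty+|f|_\theta$. *)

(* Defs.v *)
From HB Require Import structures.
From mathcomp Require Import all_boot all_order all_algebra.
From mathcomp.real_closed Require Import complex.
From mathcomp Require Import all_classical all_reals all_analysis.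

Set Implicit Arguments.
Unset Strict Implicit.
Unset Printing Implicit Defensive.

Import Order.TTheory GRing.Theory Num.Theory.
Import numFieldNormedType.Exports.

Local Open Scope classical_set_scope.
Local Open Scope ring_scope.

(* The library requires measurable spaces to be inhabited, so the alphabet has
   [M.+1] letters: every nonempty alphabet {0, ..., M - 1} is of this form. *)
Definition alphabet (M : nat) : Type := 'I_M.+1.

HB.instance Definition _ M := Finite.on (alphabet M).
HB.instance Definition _ M := isPointed.Build (alphabet M) ord0.
HB.instance Definition _ M := hasNbhs.Build (alphabet M) principal_filter.
HB.instance Definition _ M := Discrete_ofNbhs.Build (alphabet M) erefl.

Definition fullshift (M : nat) : Type := {ptws int -> alphabet M}.

HB.instance Definition _ M := Topological.on (fullshift M).
HB.instance Definition _ M := Pointed.on (fullshift M).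

Notation borel T := (g_sigma_algebraType (@open T)).

Definition left_shift (M : nat) (x : fullshift M) : fullshift M := fun i => x (i + 1).

Definition cylinder (M : nat) (x : fullshift M) (n : nat) : set (fullshift M) :=
  [set y | forall i : nat, (i < n)%N -> y i%:Z = x i%:Z].

Section Matrices.
Variables (R : realType) (d : nat).
Implicit Types (B : 'M[R]_d) (v : 'cV[R]_d).

Definition enorm v : R := Num.sqrt (\sum_i v i 0 ^+ 2).

Definition opnorm B : R := sup [set enorm (B *m v) | v in [set v | enorm v <= 1]].

Definition complexify B : 'M[R[i]]_d := map_mx (real_complex R) B.

Definition cmod (z : R[i]) : R := complex.Re `|z|.

Definition spectral_radius B : R :=
  sup [set cmod z | z in [set z | eigenvalue (complexify B) z]].

(* Simplicity of the dominant eigenvalue is in the sense of algebraic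
   multiplicity. *)
Definition proximal_mx B : Prop :=
  exists l : R[i],
    [/\ eigenvalue (complexify B) l,
        mup l (char_poly (complexify B)) = 1%N,
        cmod l = spectral_radius B &
        forall z, eigenvalue (complexify B) z -> z != l ->
          cmod z < spectral_radius B].

Definition mxword (I : Type) (A : I -> 'M[R]_d) (n : nat) (w : nat -> I) :
    'M[R]_d := \big[mulmx/1%:M]_(i < n) A (w i).

Definition proximal (I : Type) (A : I -> 'M[R]_d) : Prop :=
  exists (n : nat) (w : nat -> I), proximal_mx (mxword A n.+1 w).

Definition subspace_union (Vs : seq {vspace 'cV[R]_d}) : set 'cV[R]_d :=
  [set v | exists2 V, V \in Vs & v \in V].

Definition strongly_irreducible (I : Type) (A : I -> 'M[R]_d) : Prop :=
  ~ exists Vs : seq {vspace 'cV[R]_d},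
    [/\ Vs != [::],
        forall V, V \in Vs -> V != 0%VS /\ V != fullv &
        forall i, mulmx (A i) @` subspace_union Vs `<=` subspace_union Vs].

End Matrices.

Section ShiftMeasures.
Variables (R : realType) (M : nat).
Implicit Type mu : probability (borel (fullshift M)) R.

Definition shift_invariant mu : Prop :=
  forall B : set (borel (fullshift M)), measurable B ->
    mu (@left_shift M @^-1` B) = mu B.

Definition gibbs_state (d : nat) (A : 'I_M.+1 -> 'M[R]_d) (t : R) mu : Prop :=
  shift_invariant mu /\
  exists C P : R, 0 < C /\
    forall (x : fullshift M) (n : nat), (0 < n)%N ->
      let p := fine (mu (cylinder x n)) in
      let a := expR (- (n%:R * P)) *
               opnorm (mxword A n (fun i => x i%:Z)) `^ t in
      C^-1 * p <= a <= C * p.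

End ShiftMeasures.

(* Finite partitions are represented as families of sets indexed by a finite
   type; empty members contribute nothing to the sums below. *)
Section WeakBernoulli.
Context (R : realType) (dT : measure_display) (T : measurableType dT).
Variables (mu : probability T R) (S : T -> T).

Definition eps_independent (I J : finType) (Q : I -> set T) (Q' : J -> set T)
    (eps : R) : Prop :=
  \sum_(i : I) \sum_(j : J)
    `|fine (mu (Q i `&` Q' j)) - fine (mu (Q i)) * fine (mu (Q' j))| < eps.

(* The join of S^{-i} Q for m <= i < m + n; it is trivial when n = 0. *)
Definition join_partition (I : finType) (Q : I -> set T) (m n : nat)
    (w : {ffun 'I_n -> I}) : set T :=
  [set x | forall k : 'I_n, Q (w k) (iter (m + k)%N S x)].

Definition weak_bernoulli_partition (I : finType) (Q : I -> set T) : Prop :=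
  forall eps : R, 0 < eps -> exists N : nat, forall r s m : nat,
    (s + N <= m)%N ->
    eps_independent (@join_partition I Q 0 s) (@join_partition I Q m r) eps.

End WeakBernoulli.

Definition standard_partition (M : nat) (i : alphabet M) : set (fullshift M) :=
  [set x | x 0 = i].

Definition weak_bernoulli (R : realType) (M : nat)
    (mu : probability (borel (fullshift M)) R) : Prop :=
  weak_bernoulli_partition mu (@left_shift M) (@standard_partition M).

Section Hoelder.
Variables (R : realType) (M : nat).
Implicit Types (f : fullshift M -> R) (theta : R).

(* These suprema are only used for continuous [f], which are bounded since
   [fullshift M] is compact. *)
Definition var_n (n : nat) f : R :=
  sup [set r : R | exists x y : fullshift M,
    (forall i : int, (absz i < n)%N -> x i = y i) /\ r = `|f x - f y|].

Definition sup_norm f : R := sup [set `|f x| | x in setT].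

Definition hoelder_const theta f : set R :=
  [set c : R | 0 < c /\ forall n : nat, var_n n f <= c * theta ^+ n].

Definition hoelder_fun theta f : Prop :=
  continuous f /\ (hoelder_const theta f !=set0).

(* An infimum, since a constant [f] has no least positive constant. *)
Definition hoelder_seminorm theta f : R := inf (hoelder_const theta f).

Definition hoelder_norm theta f : R := sup_norm f + hoelder_seminorm theta f.

Definition exponential_decay (mu : probability (borel (fullshift M)) R) : Prop :=
  forall theta : R, 0 < theta < 1 ->
    exists D gamma : R, 0 < gamma < 1 /\
      forall f g : fullshift M -> R, hoelder_fun theta f -> hoelder_fun theta g ->
      forall n : nat,
        `| \int[mu]_x (f x * g (iter n (@left_shift M) x))
           - (\int[mu]_x f x) * (\int[mu]_x g x) |
        <= D * hoelder_norm theta f * hoelder_norm theta g * gamma ^+ n.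

End Hoelder.

(* Main.v *)
Require Import Defs.
From HB Require Import structures.
From mathcomp Require Import all_boot all_order all_algebra.
From mathcomp.real_closed Require Import complex.
From mathcomp Require Import all_classical all_reals all_analysis.
From mathcomp Require Import zify ring lra.

Set Implicit Arguments.
Unset Strict Implicit.
Unset Printing Implicit Defensive.

Import Order.TTheory GRing.Theory Num.Theory.
Import numFieldNormedType.Exports.
Local Open Scope classical_set_scope.
Local Open Scope ring_scope.

(** A Gibbs state, its mixing properties and its uniqueness only involve the
    masses [p w] that it gives to the cylinders of the words [w].  The proof
    builds such weights from the action of the matrices on projective space.

    Geometry.  The powers of a proximal matrix, divided by the powers of its
    dominant eigenvalue, converge to a projection of rank one
    ([proximal_rank1]).  Strong irreducibility moves the image and the kernel of
    this projection in all directions ([columns_span], [rows_span]).  Three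
    consequences are used, see [proximal_irreducible_words]: between any two
    products one can insert a word of fixed length at the cost of a constant
    factor in the norm ([connecting]); some product nearly kills all bivectors
    ([pinching]); from every direction some word leads close to one and the same
    direction ([attracting]).

    Transfer operator, for [t > 0].  By connection the sums over the words of
    length [n] of the powers [t] of the norms grow exactly exponentially, up to
    bounded factors ([pressure]), and the growth rate is scaled away.  A Banach
    limit of these sums is an exact positive eigenfunction [h], which gives a
    Markov operator: from [x] one moves to [A_i x] with probability
    [h (A_i x) / h x].  Pinching implies that words which do not contract the
    projective distance carry a small part of the mass ([ext_sum_small]), whence
    a Lasota-Yorke inequality ([lasota_yorke]); together with attraction it
    makes oscillations decay exponentially ([contraction]).  Hence the masses of
    cylinders exist as limits, have the Gibbs property and satisfy, for words
    [u] and [v] separated by a gap of length [n],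
<<
      | p(u, gap, v) - p(u) p(v) | <= D gamma^n p(u) p(v)
>>
    ([matrix_word_measure]).  For [t = 0] all words of a given length have the
    same mass.

    Measures.  Weights which are consistent on both sides are the masses of
    cylinders for a measure on two-sided sequences, obtained by coding the
    points of the unit interval ([exists_two_sided]).  Summing the mixing
    inequality over words gives the weak Bernoulli property; replacing Hoelder
    functions by functions of a central block gives the decay of correlations.
    Any other Gibbs state has weights [q <= C p] by comparison of the sums over
    words ([gibbs_comparable]); since [p] mixes, the density of [q] with respect
    to [p] on long words is asymptotically a function of the remote past only,
    which is independent of any given block, so that [q = p]
    ([absolutely_continuous_eq]). *)

(** * Matrix norms and bivectors *)

Section EntrySumNorm.
Variable R : realFieldType.

(** This norm is submultiplicative for rectangular matrices of all formats, and
    multiplicative for the product of a column by a row. *)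
Definition nrm m n (X : 'M[R]_(m, n)) : R := \sum_i \sum_j `|X i j|.

Lemma nrm_ge0 m n (X : 'M[R]_(m, n)) : 0 <= nrm X.
Proof. by apply: sumr_ge0 => i _; apply: sumr_ge0. Qed.

Lemma le_nrm m n (X : 'M[R]_(m, n)) i j : `|X i j| <= nrm X.
Proof.
rewrite /nrm (bigD1 i) //= (bigD1 j) //= -addrA lerDl addr_ge0 //.
  exact: sumr_ge0.
by apply: sumr_ge0 => k _; apply: sumr_ge0.
Qed.

Lemma nrm_eq0 m n (X : 'M[R]_(m, n)) : (nrm X == 0) = (X == 0).
Proof.
apply/eqP/eqP => [X0|->]; last first.
  by rewrite /nrm big1 // => i _; rewrite big1 // => j _; rewrite mxE normr0.
apply/matrixP => i j; rewrite mxE; apply/normr0_eq0/le_anti.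
by rewrite normr_ge0 -X0 le_nrm.
Qed.

Lemma nrm0 m n : nrm (0 : 'M[R]_(m, n)) = 0.
Proof. by apply/eqP; rewrite nrm_eq0. Qed.

Lemma nrm_gt0 m n (X : 'M[R]_(m, n)) : (0 < nrm X) = (X != 0).
Proof. by rewrite lt_def nrm_ge0 andbT nrm_eq0. Qed.

Lemma nrmD m n (X Y : 'M[R]_(m, n)) : nrm (X + Y) <= nrm X + nrm Y.
Proof.
rewrite /nrm -big_split; apply: ler_sum => i _; rewrite -big_split.
by apply: ler_sum => j _; rewrite mxE ler_normD.
Qed.

Lemma nrmZ m n a (X : 'M[R]_(m, n)) : nrm (a *: X) = `|a| * nrm X.
Proof.
rewrite /nrm mulr_sumr; apply: eq_bigr => i _; rewrite mulr_sumr.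
by apply: eq_bigr => j _; rewrite mxE normrM.
Qed.

Lemma nrmN m n (X : 'M[R]_(m, n)) : nrm (- X) = nrm X.
Proof. by rewrite -scaleN1r nrmZ normrN1 mul1r. Qed.

Lemma nrmB m n (X Y : 'M[R]_(m, n)) : nrm (X - Y) <= nrm X + nrm Y.
Proof. by rewrite -(nrmN Y) nrmD. Qed.

Lemma nrm_distC m n (X Y : 'M[R]_(m, n)) : nrm (X - Y) = nrm (Y - X).
Proof. by rewrite -nrmN opprB. Qed.

Lemma nrm_dist m n (X Y : 'M[R]_(m, n)) : `|nrm X - nrm Y| <= nrm (X - Y).
Proof.
have H (U V : 'M[R]_(m, n)) : nrm U - nrm V <= nrm (U - V).
  by rewrite lerBlDr -{1}(subrK V U) nrmD.
by rewrite ler_norml H andbT lerNl opprB nrm_distC H.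
Qed.

Lemma nrm_sum (I : Type) (r : seq I) (P : pred I) m n (F : I -> 'M[R]_(m, n)) :
  nrm (\sum_(i <- r | P i) F i) <= \sum_(i <- r | P i) nrm (F i).
Proof.
elim/big_rec2: _ => [|i x y _ le_xy]; first by rewrite nrm0.
by apply: le_trans (nrmD _ _) _; rewrite lerD2l.
Qed.

Lemma nrmM m n p (X : 'M[R]_(m, n)) (Y : 'M[R]_(n, p)) :
  nrm (X *m Y) <= nrm X * nrm Y.
Proof.
rewrite /nrm mulr_suml; apply: ler_sum => i _.
apply: (@le_trans _ _ (\sum_k \sum_j `|X i j| * `|Y j k|)).
  apply: ler_sum => k _; rewrite mxE; apply: le_trans (ler_norm_sum _ _ _) _.
  by apply: ler_sum => j _; rewrite normrM.
rewrite exchange_big mulr_suml; apply: ler_sum => j _ /=.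
rewrite -mulr_sumr ler_wpM2l //.
rewrite (bigD1 j) //= lerDl; apply: sumr_ge0 => k _; exact: sumr_ge0.
Qed.

Lemma nrm_tr m n (X : 'M[R]_(m, n)) : nrm X^T = nrm X.
Proof.
rewrite /nrm exchange_big; apply: eq_bigr => i _.
by apply: eq_bigr => j _; rewrite mxE.
Qed.

Lemma nrm_colrow m n (c : 'cV[R]_m) (r : 'rV[R]_n) :
  nrm (c *m r) = nrm c * nrm r.
Proof.
rewrite /nrm big_ord1 mulr_suml; apply: eq_bigr => i _.
rewrite big_ord1 mulr_sumr; apply: eq_bigr => j _.
by rewrite mxE big_ord1 normrM.
Qed.

Lemma nrm_id n : nrm (1%:M : 'M[R]_n) = n%:R.
Proof.
rewrite /nrm -[n in RHS]card_ord -sum1_card natr_sum; apply: eq_bigr => i _.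
rewrite (bigD1 i) //= mxE eqxx normr1 big1 ?addr0 // => j.
by rewrite mxE eq_sym => /negPf ->; rewrite normr0.
Qed.

Lemma nrm_delta m n i j : nrm (delta_mx i j : 'M[R]_(m, n)) = 1.
Proof.
rewrite /nrm (bigD1 i) //= (bigD1 j) //= mxE !eqxx normr1 !big1 ?addr0 //.
  move=> k /negPf ki; rewrite big1 // => l _; by rewrite mxE ki normr0.
by move=> l /negPf lj; rewrite mxE lj andbF normr0.
Qed.

End EntrySumNorm.

Section Exterior.
Variables (R : realFieldType) (d : nat).
Implicit Types (A B W : 'M[R]_d) (x y : 'cV[R]_d).

(** Bivectors are represented by antisymmetric matrices, on which [A] acts by
    [W |-> A W A^T]. *)
Definition wedge x y : 'M[R]_d := x *m y^T - y *m x^T.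

(** The action of [A] on bivectors is measured on the standard basis; this is
    comparable to the norm of its second exterior power. *)
Definition ext2 A : R :=
  \sum_i \sum_j nrm (A *m (delta_mx i j - delta_mx j i) *m A^T).

Lemma ext2_ge0 A : 0 <= ext2 A.
Proof. by do 2!apply: sumr_ge0 => ? _; exact: nrm_ge0. Qed.

Lemma wedge_mul A x y : wedge (A *m x) (A *m y) = A *m wedge x y *m A^T.
Proof. by rewrite /wedge !trmx_mul mulmxBr mulmxBl !mulmxA. Qed.

Lemma tr_wedge x y : (wedge x y)^T = - wedge x y.
Proof. by rewrite /wedge linearB /= !trmx_mul !trmxK opprB. Qed.

Lemma wedgeZl a x y : wedge (a *: x) y = a *: wedge x y.
Proof. by rewrite /wedge linearZ /= -scalemxAl -scalemxAr scalerBr. Qed.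

Lemma wedgeZr a x y : wedge x (a *: y) = a *: wedge x y.
Proof. by rewrite /wedge linearZ /= -scalemxAl -scalemxAr scalerBr. Qed.

Lemma wedge_subl x y c : wedge (x - c *: y) y = wedge x y.
Proof.
rewrite /wedge [(_ - _)^T]linearB /= [(_ *: _)^T]linearZ /= mulmxBl mulmxBr.
rewrite -scalemxAl -scalemxAr.
by rewrite opprB addrA subrK.
Qed.

Lemma nrm_wedge x y : nrm (wedge x y) <= 2 * nrm x * nrm y.
Proof.
rewrite /wedge; apply: le_trans (nrmB _ _) _.
have -> : 2 * nrm x * nrm y = nrm x * nrm y^T + nrm y * nrm x^T.
  by rewrite !nrm_tr; ring.
by rewrite lerD // nrmM.
Qed.

(** Twice an antisymmetric matrix is a combination of the elementary
    antisymmetric ones, with its own entries as coefficients. *)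
Lemma ext2_antisym A W : W^T = - W -> nrm (A *m W *m A^T) <= ext2 A * nrm W.
Proof.
move=> Wt.
have WE i j : W j i = - W i j by move/matrixP: Wt => /(_ i j); rewrite !mxE.
have decW : 2 *: W = \sum_i \sum_j W i j *: (delta_mx i j - delta_mx j i).
  rewrite {1}scaler_nat mulr2n {1}(matrix_sum_delta W).
  rewrite -[W in _ + W]opprK -Wt [in RHS](eq_bigr (fun i => \sum_j W i j *: delta_mx i j - \sum_j W i j *: delta_mx j i)); last first.
    by move=> i _; rewrite -sumrB; apply: eq_bigr => j _; rewrite scalerBr.
  rewrite sumrB; congr (_ - _).
  rewrite {1}(matrix_sum_delta W) linear_sum; apply: eq_bigr => i _.
  rewrite linear_sum; apply: eq_bigr => j _.
  by rewrite linearZ /= trmx_delta.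
have H : nrm (A *m (2 *: W) *m A^T) <= ext2 A * nrm W.
  rewrite decW mulmx_sumr mulmx_suml; apply: le_trans (nrm_sum _ _ _) _.
  rewrite /ext2 mulr_suml; apply: ler_sum => i _.
  rewrite mulmx_sumr mulmx_suml; apply: le_trans (nrm_sum _ _ _) _.
  rewrite mulr_suml; apply: ler_sum => j _.
  rewrite -scalemxAr -scalemxAl nrmZ mulrC ler_wpM2l ?nrm_ge0 //.
  exact: le_nrm.
apply: le_trans H; rewrite -scalemxAr -scalemxAl nrmZ ler_peMl ?nrm_ge0 //.
by rewrite ger0_norm // ler1n.
Qed.

Lemma sum_const2 (c : R) : \sum_(i < d) \sum_(j < d) c = d%:R ^+ 2 * c.
Proof. by rewrite !sumr_const !card_ord -mulrnA -(mulr_natl c) natrM expr2. Qed.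

Lemma tr_deltaB (i j : 'I_d) :
  (delta_mx i j - delta_mx j i : 'M[R]_d)^T = - (delta_mx i j - delta_mx j i).
Proof. by rewrite linearB /= !trmx_delta opprB. Qed.

Lemma ext2M A B : ext2 (A *m B) <= ext2 A * ext2 B.
Proof.
rewrite {1}/ext2 [ext2 B]/ext2 mulr_sumr; apply: ler_sum => i _.
rewrite mulr_sumr; apply: ler_sum => j _; rewrite trmx_mul.
set E := delta_mx i j - _.
have -> : A *m B *m E *m (B^T *m A^T) = A *m (B *m E *m B^T) *m A^T.
  by rewrite !mulmxA.
apply: ext2_antisym.
by rewrite !trmx_mul trmxK /E tr_deltaB mulNmx mulmxN !mulmxA.
Qed.

Lemma ext2_le A : ext2 A <= 2 * d%:R ^+ 2 * nrm A ^+ 2.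
Proof.
apply: (@le_trans _ _ (\sum_(i < d) \sum_(j < d) 2 * nrm A ^+ 2)).
  apply: ler_sum => i _; apply: ler_sum => j _.
  apply: le_trans (nrmM _ _) _; rewrite nrm_tr.
  apply: (@le_trans _ _ (nrm A * 2 * nrm A)); last by rewrite le_eqVlt; apply/orP; left; apply/eqP; ring.
  rewrite ler_wpM2r ?nrm_ge0 //; apply: le_trans (nrmM _ _) _.
  rewrite ler_wpM2l ?nrm_ge0 //; apply: le_trans (nrmB _ _) _.
  by rewrite !nrm_delta.
by rewrite sum_const2 le_eqVlt; apply/orP; left; apply/eqP; ring.
Qed.

Lemma nrm_wedge_mul A x y :
  nrm (wedge (A *m x) (A *m y)) <= ext2 A * nrm (wedge x y).
Proof. by rewrite wedge_mul ext2_antisym // tr_wedge. Qed.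

Lemma ext2Z a A : ext2 (a *: A) = a ^+ 2 * ext2 A.
Proof.
rewrite /ext2 mulr_sumr; apply: eq_bigr => i _.
rewrite mulr_sumr; apply: eq_bigr => j _.
rewrite [in LHS]linearZ /= -!scalemxAl -scalemxAr !nrmZ mulrA -normrM -expr2.
by rewrite ger0_norm // sqr_ge0.
Qed.

(** A matrix [v f] kills all bivectors, since [f W f^T] is an antisymmetric
    matrix of size one; the action on bivectors is quadratic in the matrix. *)
Lemma ext2_rank1 (v : 'cV[R]_d) (f : 'rV[R]_d) B :
  ext2 B <= 2 * d%:R ^+ 2 * nrm (B - v *m f) * (nrm B + nrm (v *m f)).
Proof.
set E := v *m f; set e := nrm (B - E).
apply: (@le_trans _ _ (\sum_(i < d) \sum_(j < d) 2 * e * (nrm B + nrm E))); last first.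
  by rewrite sum_const2 le_eqVlt; apply/orP; left; apply/eqP; ring.
apply: ler_sum => i _; apply: ler_sum => j _.
set W := delta_mx i j - _.
have W2 : nrm W <= 2 by apply: le_trans (nrmB _ _) _; rewrite !nrm_delta.
have EWE : E *m W *m E^T = 0.
  have fWf : f *m W *m f^T = 0.
    have /matrixP/(_ 0 0) : (f *m W *m f^T)^T = - (f *m W *m f^T).
      by rewrite !trmx_mul trmxK tr_deltaB mulNmx mulmxN mulmxA.
    rewrite mxE [RHS]mxE => H; apply/matrixP => a b; rewrite !ord1 [RHS]mxE; lra.
  rewrite /E trmx_mul.
  have -> : v *m f *m W *m (f^T *m v^T) = v *m (f *m W *m f^T) *m v^T by rewrite !mulmxA.
  by rewrite fWf mulmx0 mul0mx.
clearbody W.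
have -> : B *m W *m B^T = (B - E) *m W *m B^T + E *m W *m (B - E)^T.
  by rewrite linearB /= mulmxBr EWE subr0 -!mulmxDl subrK.
apply: le_trans (nrmD _ _) _.
have -> : 2 * e * (nrm B + nrm E) = e * 2 * nrm B + nrm E * 2 * e by ring.
apply: lerD; apply: le_trans (nrmM _ _) _; rewrite nrm_tr.
  rewrite ler_wpM2r ?nrm_ge0 //; apply: le_trans (nrmM _ _) _.
  by rewrite ler_wpM2l ?nrm_ge0.
rewrite ler_wpM2r ?nrm_ge0 //; apply: le_trans (nrmM _ _) _.
by rewrite ler_wpM2l ?nrm_ge0.
Qed.

End Exterior.

(** * Convergence of sequences *)

Section Powers.
Variable R : realType.

Lemma cvg0P (a : nat -> R) : (forall n, 0 <= a n) ->
  (a @ \oo --> (0 : R)) <->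
  (forall e, 0 < e -> exists N, forall n, (N <= n)%N -> a n <= e).
Proof.
move=> a0; split.
  move=> /cvgrPdist_le H e e0; have [N _ HN] := H e e0.
  by exists N => n Nn; have := HN n Nn; rewrite sub0r normrN ger0_norm.
move=> H; apply/cvgrPdist_le => e e0; have [N HN] := H e e0.
by exists N => // n Nn; rewrite sub0r normrN ger0_norm // HN.
Qed.

Lemma geometric_small (rho c e : R) : 0 <= rho < 1 -> 0 < e ->
  exists N, forall n, (N <= n)%N -> c * rho ^+ n <= e.
Proof.
move=> /andP[r0 r1] e0.
have /cvgrPdist_le/(_ e e0)[N _ HN] : geometric c rho @ \oo --> (0 : R).
  by apply: cvg_geometric; rewrite ger0_norm.
exists N => n Nn; have := HN n Nn.
by rewrite sub0r normrN /geometric /=; apply: le_trans; exact: ler_norm.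
Qed.

(** From a time on at which [e] is small, the recursion leaves a geometric
    remainder and a sum of small terms weighted by a geometric series. *)
Lemma contraction_cvg0 (a e : nat -> R) (rho : R) : 0 <= rho < 1 ->
  (forall n, 0 <= a n) -> (forall n, 0 <= e n) ->
  (forall n, a n.+1 <= rho * a n + e n) ->
  e @ \oo --> (0 : R) -> a @ \oo --> (0 : R).
Proof.
move=> rho01 a0 e0 ae /(cvg0P e0) He; apply/(cvg0P a0) => eps eps0.
have /andP[r0 r1] := rho01.
have h0 : 0 < eps / 2 * (1 - rho) by rewrite mulr_gt0 ?divr_gt0 ?subr_gt0.
have [N HN] := He _ h0.
have aN k : a (k + N)%N <= rho ^+ k * a N + eps / 2.
  elim: k => [|k IH]; first by rewrite add0n expr0 mul1r lerDl; lra.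
  apply: le_trans (ae _) _.
  have := HN _ (leq_addl k N); have := ler_wpM2l r0 IH; rewrite exprS.
  by set x := rho ^+ k; nra.
have [K HK] := geometric_small (a N) rho01 (divr_gt0 eps0 (ltr0n R 2)).
exists (K + N)%N => n Kn.
have -> : n = (n - N + N)%N by rewrite subnK //; apply: leq_trans Kn; exact: leq_addl.
apply: le_trans (aN _) _.
have := HK (n - N)%N; rewrite mulrC => /(_ _); rewrite leq_subRL; last by apply: leq_trans Kn; exact: leq_addl.
by rewrite addnC => /(_ Kn); rewrite mulrC; lra.
Qed.

Lemma cmodD (x y : R[i]) : cmod (x + y) <= cmod x + cmod y.
Proof. exact: le_normcD. Qed.

Lemma cmodM (x y : R[i]) : cmod (x * y) = cmod x * cmod y.
Proof. exact: ComplexField.Normc.normcM. Qed.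

Lemma cmodN (x : R[i]) : cmod (- x) = cmod x.
Proof. exact: normcN. Qed.

Lemma cmod0 : cmod (0 : R[i]) = 0.
Proof. exact: ComplexField.Normc.normc0. Qed.

Lemma cmod0_eq (x : R[i]) : cmod x = 0 -> x = 0.
Proof. exact: ComplexField.Normc.eq0_normc. Qed.

Lemma cmod_ge0 (x : R[i]) : 0 <= cmod x.
Proof. by case: x => a b; exact: sqrtr_ge0. Qed.

Lemma cmod_gt0 (x : R[i]) : x != 0 -> 0 < cmod x.
Proof.
by move=> x0; rewrite lt_def cmod_ge0 andbT; apply: contra x0 => /eqP/cmod0_eq ->.
Qed.

Lemma cmodV (x : R[i]) : cmod x^-1 = (cmod x)^-1.
Proof. exact: ComplexField.Normc.normcV. Qed.

Lemma cmod_real (x : R) : cmod (x%:C)%C = `|x|.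
Proof. by rewrite /cmod normc_def /= expr0n addr0 sqrtr_sqr. Qed.

Lemma cmodJ (x : R[i]) : cmod (conjc x) = cmod x.
Proof. by case: x => a b; rewrite /cmod !normc_def /= sqrrN. Qed.

Definition clim (y : nat -> R[i]) (l : R[i]) :=
  (fun n => cmod (y n - l)) @ \oo --> (0 : R).

Lemma clim_unique y l l' : clim y l -> clim y l' -> l = l'.
Proof.
move=> yl yl'; apply/eqP; rewrite -subr_eq0; apply/eqP/cmod0_eq/eqP.
rewrite eq_le cmod_ge0 andbT; apply/ler_addgt0Pr => e e0; rewrite add0r.
have e20 : 0 < e / 2 by rewrite divr_gt0.
have /cvg0P := yl; move=> /(_ (fun _ => cmod_ge0 _))/(_ _ e20)[N HN].
have /cvg0P := yl'; move=> /(_ (fun _ => cmod_ge0 _))/(_ _ e20)[N' HN'].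
have := HN _ (leq_maxl N N'); have := HN' _ (leq_maxr N N').
set n := maxn _ _; have -> : l - l' = - (y n - l) + (y n - l') by ring.
by have := cmodD (- (y n - l)) (y n - l'); rewrite cmodN; lra.
Qed.

Lemma clim_lin y l z k a b : clim y l -> clim z k ->
  clim (fun n => a * y n + b * z n) (a * l + b * k).
Proof.
move=> yl zk; rewrite /clim.
apply: (@squeeze_cvgr _ _ _ _ (fun=> 0)
  (fun n => cmod a * cmod (y n - l) + cmod b * cmod (z n - k))).
- near=> n; rewrite cmod_ge0 /= -!cmodM.
  apply: le_trans (cmodD _ _); rewrite le_eqVlt; apply/orP; left; apply/eqP.
  by congr cmod; ring.
- exact: cvg_cst.
- rewrite (_ : (0 : R) = cmod a * 0 + cmod b * 0); last by rewrite !mulr0 addr0.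
  by apply: cvgD; apply: cvgM => //; exact: cvg_cst.
Unshelve. all: by end_near. Qed.

Lemma clim_cst l : clim (fun=> l) l.
Proof. by rewrite /clim subrr cmod0; exact: cvg_cst. Qed.

Lemma clim_sum n (y : 'I_n -> nat -> R[i]) (l : 'I_n -> R[i]) :
  (forall i, clim (y i) (l i)) ->
  clim (fun m => \sum_i y i m) (\sum_i l i).
Proof.
elim: n y l => [|n IH] y l H.
  rewrite big_ord0; have -> : (fun m => \sum_(i < 0) y i m) = (fun=> 0).
    by apply/funext => m; rewrite big_ord0.
  exact: clim_cst.
rewrite big_ord_recl; have -> : (fun m => \sum_(i < n.+1) y i m) =
  (fun m => 1 * y ord0 m + 1 * \sum_(i < n) y (lift ord0 i) m).
  by apply/funext => m; rewrite big_ord_recl !mul1r.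
by rewrite -[l ord0]mul1r -[X in _ + X]mul1r; apply: clim_lin => //; exact: IH.
Qed.

(** The distance from [y n] to [k / (1 - z)] obeys a contraction with vanishing
    forcing. *)
Lemma clim_rec (y w : nat -> R[i]) (z k : R[i]) : cmod z < 1 ->
  (forall n, y n.+1 = z * y n + w n) -> clim w k -> clim y (k / (1 - z)).
Proof.
move=> z1 yE wk; have z1' : 1 - z != 0.
  by apply: contraTneq z1 => /eqP; rewrite subr_eq0 => /eqP <-; rewrite -leNgt cmod_real normr1.
apply: (@contraction_cvg0 _ (fun n => cmod (w n - k)) (cmod z)) => //.
- by rewrite cmod_ge0.
- by move=> n; exact: cmod_ge0.
- by move=> n; exact: cmod_ge0.
move=> n; rewrite yE -cmodM; apply: le_trans (cmodD _ _).
rewrite le_eqVlt; apply/orP; left; apply/eqP; congr cmod; field => //.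
Qed.

End Powers.

(** * Powers of a proximal matrix *)

Section RankOne.
Variables (K : fieldType) (d : nat).
Implicit Types (C E : 'M[K]_d.+1).

(** If [l - C] has rank less than [d], all its cofactors vanish, so the equation
    [adj (X - C) E = psi E], which follows from [C E = l E], gives [E = 0] at
    [X = l].  Otherwise the kernel of [l - C] is at most a line. *)
Lemma rank_eigen_simple C E (l : K) (psi : {poly K}) :
  char_poly C = ('X - l%:P) * psi -> psi.[l] != 0 -> C *m E = l *: E ->
  (\rank E <= 1)%N.
Proof.
move=> charE psil CE.
pose D := l%:M - C.
have DE : D *m E = 0 by rewrite mulmxBl mul_scalar_mx CE subrr.
have [rkD|rkD] := leqP d (\rank D).
  by have := mulmx0_rank_max DE; lia.
have adj0 : \adj D = 0.
  apply/matrixP => i j; rewrite !mxE /cofactor.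
  apply/eqP; rewrite mulf_eq0; apply/orP; right.
  apply: contraTT rkD => detD; rewrite -leqNgt.
  have : row' j (col' i D) \in unitmx by rewrite unitmxE unitfE.
  rewrite -row_free_unit => /eqP /= rkM.
  suff : (\rank (row' j (col' i D)) <= \rank D)%N by rewrite rkM.
  have -> : row' j (col' i D) = rowsub (lift j) (col' i D).
    by apply/matrixP => a b; rewrite !mxE.
  apply: leq_trans (mxrankS (rowsub_sub _ _)) _.
  rewrite -mxrank_tr -[X in (_ <= X)%N]mxrank_tr.
  have -> : (col' i D)^T = rowsub (lift i) D^T.
    by apply/matrixP => a b; rewrite !mxE.
  exact: mxrankS (rowsub_sub _ _).
have adjE : \adj (char_poly_mx C) *m map_mx polyC E = psi *: map_mx polyC E.
  have H : ('X - l%:P) *: (\adj (char_poly_mx C) *m map_mx polyC E) =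
           ('X - l%:P) *: (psi *: map_mx polyC E).
    rewrite scalerA -charE -[RHS]mul_scalar_mx /char_poly -mul_adj_mx -[RHS]mulmxA scalemxAr.
    congr mulmx; rewrite /char_poly_mx mulmxBl mul_scalar_mx scalerBl.
    congr (_ - _); rewrite -map_mxM CE; apply/matrixP => i j.
    by rewrite !mxE /= polyCM.
  apply/matrixP => i j; move/matrixP: H => /(_ i j).
  by rewrite [LHS]mxE [RHS]mxE; apply: mulfI; rewrite polyXsubC_eq0.
have E0 : E = 0.
  have := congr1 (map_mx (horner_eval l)) adjE.
  rewrite map_mxM /= map_mx_adj.
  have -> : map_mx (horner_eval l) (char_poly_mx C) = D.
    by apply/matrixP => i j; rewrite !mxE /horner_eval !hornerE hornerMn !hornerE.
  rewrite adj0 mul0mx => H; apply/matrixP => i j.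
  move/matrixP: H => /(_ i j); rewrite !mxE /horner_eval !hornerE.
  by move=> /esym/eqP; rewrite mulf_eq0 (negPf psil) => /eqP.
by rewrite E0 mxrank0.
Qed.

Lemma rank1_factor (E : 'M[K]_d) : E != 0 -> (\rank E <= 1)%N ->
  exists (v : 'cV[K]_d) (f : 'rV[K]_d), E = v *m f.
Proof.
move=> E0 rkE.
have [i fi] : exists i, row i E != 0.
  apply/existsP; apply: contraNT E0; rewrite negb_exists => /forallP H.
  apply/eqP/row_matrixP => i; have := H i; rewrite negbK => /eqP ->.
  by rewrite row0.
have : (E <= row i E)%MS.
  have /mxrank_leqif_sup[_ <-] := row_sub i E.
  rewrite eqn_leq mxrankS ?row_sub //=; apply: leq_trans rkE _.
  by rewrite lt0n mxrank_eq0.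
by move=> /submxP[v ->]; exists v, (row i E).
Qed.

End RankOne.

Section Proximal.
Variable R : realType.

Lemma mx_lin2 (K : pzRingType) m n (a b : K) (X Y : 'M[K]_(m, n)) i j :
  (a *: X + b *: Y) i j = a * X i j + b * Y i j.
Proof. by rewrite !mxE. Qed.

Lemma clim_scale (y : nat -> R[i]) l a : clim y l -> clim (fun n => a * y n) (a * l).
Proof.
move=> yl; have := clim_lin a 0 yl (clim_cst (0 : R[i])).
by rewrite mul0r addr0; congr clim; apply/funext => n; rewrite addr0.
Qed.

Lemma clim_mulmxl m n p (A : 'M[R[i]]_(m, n)) (Y : nat -> 'M[R[i]]_(n, p)) (E : 'M[R[i]]_(n, p)) :
  (forall i j, clim (fun k => Y k i j) (E i j)) ->
  forall i j, clim (fun k => (A *m Y k) i j) ((A *m E) i j).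
Proof.
move=> YE i j; rewrite mxE.
have -> : (fun k => (A *m Y k) i j) = (fun k => \sum_h A i h * Y k h j).
  by apply/funext => k; rewrite mxE.
by apply: clim_sum => h; exact: clim_scale.
Qed.

Lemma clim_mulmxr m n p (Y : nat -> 'M[R[i]]_(m, n)) (A : 'M[R[i]]_(n, p)) (E : 'M[R[i]]_(m, n)) :
  (forall i j, clim (fun k => Y k i j) (E i j)) ->
  forall i j, clim (fun k => (Y k *m A) i j) ((E *m A) i j).
Proof.
move=> YE i j; rewrite mxE.
have -> : (fun k => (Y k *m A) i j) = (fun k => \sum_h A h j * Y k i h).
  by apply/funext => k; rewrite mxE; apply: eq_bigr => h _; rewrite mulrC.
have -> : \sum_h E i h * A h j = \sum_h A h j * E i h.
  by apply: eq_bigr => h _; rewrite mulrC.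
by apply: clim_sum => h; exact: clim_scale.
Qed.

Section ComplexPowers.
Variables (d : nat) (C : 'M[R[i]]_d.+1) (l : R[i]).
Hypothesis l0 : l != 0.

Let CpowS m : C ^+ m.+1 = C ^+ m *m C. Proof. exact: exprSr. Qed.
Let CpowSl m : C ^+ m.+1 = C *m C ^+ m. Proof. exact: exprS. Qed.

Definition conv_after (Q : 'M[R[i]]_d.+1) := exists E : 'M[R[i]]_d.+1,
  forall i j, clim (fun m => (l^-1 ^+ m *: (C ^+ m *m Q)) i j) (E i j).

Let factors (s : seq R[i]) := \prod_(z <- s) ('X - z%:P).

(** The normalized powers [y n] applied to the remaining factors satisfy
    [y (n + 1) = (z / l) y n + w n], where [w] converges and [|z / l| < 1]. *)
Lemma conv_after_factor z s : cmod z < cmod l ->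
  conv_after (horner_mx C (factors (z :: s))) ->
  conv_after (horner_mx C (factors s)).
Proof.
move=> zl [E HE]; set Q := horner_mx C (factors s).
exists (\matrix_(i, j) ((l^-1 * E i j + 0 * 0) / (1 - z / l))) => i j; rewrite mxE.
apply: (@clim_rec _ _ (fun m => l^-1 * (l^-1 ^+ m *: (C ^+ m *m
          horner_mx C (factors (z :: s)))) i j + 0 * 0)).
- by rewrite cmodM cmodV ltr_pdivrMr ?cmod_gt0 // mul1r.
- move=> n; rewrite mul0r addr0 /factors big_cons rmorphM rmorphB /= horner_mx_X horner_mx_C.
  rewrite -/(factors s) -/Q -mx_lin2; congr (fun_of_matrix _ i j).
  have -> : (C - z%:M) * Q = (C - z%:M) *m Q by [].
  rewrite mulmxBl mul_scalar_mx mulmxBr scalerBr scalerBr -scalemxAr.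
  rewrite !scalerA mulmxA -[C ^+ n *m C]exprSr.
  by rewrite exprS addrC -addrA -scaleNr -scalerDl [X in _ + X *: _](_ : _ = 0) ?scale0r ?addr0 //; ring.
- by apply: clim_lin; [exact: HE | exact: clim_cst].
Qed.

Lemma conv_after1 s : (forall z, z \in s -> cmod z < cmod l) ->
  conv_after (horner_mx C (factors s)) -> conv_after 1.
Proof.
elim: s => [|z s IH] zs; first by rewrite /factors big_nil rmorph1.
move=> /conv_after_factor H; apply: IH; last by apply: H; apply: zs; rewrite mem_head.
by move=> y ys; apply: zs; rewrite in_cons ys orbT.
Qed.

(** The product of the factors [C - z], for the roots [z] other than [l], has
    its image in the eigenspace of [l], where the normalized powers are constant;
    the factors are then removed one at a time. *)
Lemma dominant_limit :
  eigenvalue C l -> mup l (char_poly C) = 1%N ->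
  (forall z, eigenvalue C z -> z != l -> cmod z < cmod l) ->
  exists E : 'M[R[i]]_d.+1, [/\ C *m E = l *: E, E *m E = E, E != 0,
    (\rank E <= 1)%N &
    forall i j, clim (fun m => (l^-1 ^+ m *: (C ^+ m)) i j) (E i j)].
Proof.
move=> lev mupl dom.
have [r rE] := closed_field_poly_normal (char_poly C).
rewrite (eqP (char_poly_monic C)) scale1r in rE.
have lr : l \in r by move: lev; rewrite eigenvalue_root_char rE root_prod_XsubC.
pose s := rem l r.
have charE : char_poly C = ('X - l%:P) * factors s.
  by rewrite rE (perm_big _ (perm_to_rem lr)) big_cons.
have ls : l \notin s.
  apply/negP => ls; have : (2 <= mup l (char_poly C))%N.
    rewrite mup_geq ?monic_neq0 ?char_poly_monic // charE expr2.
    by rewrite /factors (perm_big _ (perm_to_rem ls)) big_cons mulrA dvdp_mulr.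
  by rewrite mupl.
have sl z : z \in s -> cmod z < cmod l.
  move=> zs; apply: dom; last by apply: contraNneq ls => <-.
  by rewrite eigenvalue_root_char rE root_prod_XsubC (mem_rem zs).
have CG : C *m horner_mx C (factors s) = l *: horner_mx C (factors s).
  apply/eqP; rewrite -subr_eq0 -mul_scalar_mx -mulmxBl; apply/eqP.
  rewrite -[RHS](Cayley_Hamilton C) charE rmorphM rmorphB /=.
  by rewrite horner_mx_X horner_mx_C.
have : conv_after 1.
  apply: conv_after1 sl _; exists (horner_mx C (factors s)) => i j.
  have -> : (fun m => (l^-1 ^+ m *: (C ^+ m *m horner_mx C (factors s))) i j) =
     (fun m => horner_mx C (factors s) i j); last exact: clim_cst.
  apply/funext => m; congr (fun_of_matrix _ i j).
  elim: m => [|m IH]; first by rewrite !expr0 scale1r mul1mx.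
  rewrite CpowS -mulmxA CG -scalemxAr scalerA exprSr -mulrA mulVf // mulr1.
  exact: IH.
case=> E HE0.
have HE i j : clim (fun m => (l^-1 ^+ m *: (C ^+ m)) i j) (E i j).
  have -> : (fun m => (l^-1 ^+ m *: C ^+ m) i j) = (fun m => (l^-1 ^+ m *: (C ^+ m *m 1)) i j).
    by apply/funext => m; rewrite mulmx1.
  exact: HE0.
have CE : C *m E = l *: E.
  apply/matrixP => i j.
  apply: (@clim_unique _ (fun m => (C *m (l^-1 ^+ m *: (C ^+ m))) i j)).
    exact: clim_mulmxl.
  rewrite mxE; have -> : (fun m => (C *m (l^-1 ^+ m *: C ^+ m)) i j) =
     (fun m => l * (l^-1 ^+ m.+1 *: C ^+ m.+1) i j).
    apply/funext => m.
    have -> : l * (l^-1 ^+ m.+1 *: C ^+ m.+1) i j = (l *: (l^-1 ^+ m.+1 *: C ^+ m.+1)) i j by rewrite [RHS]mxE.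
    by rewrite scalerA CpowSl exprS mulrA mulfV // mul1r -scalemxAr.
  apply: clim_scale.
  by have := HE i j; rewrite /clim -(cvg_shiftS (fun n => cmod _)).
have yE m : l^-1 ^+ m *: (C ^+ m *m E) = E.
  elim: m => [|m IH]; first by rewrite !expr0 scale1r mul1mx.
  rewrite CpowS -mulmxA CE -scalemxAr scalerA exprSr -mulrA mulVf // mulr1.
  exact: IH.
have EE : E *m E = E.
  apply/matrixP => i j.
  apply: (@clim_unique _ (fun m => ((l^-1 ^+ m *: C ^+ m) *m E) i j)); last first.
    have -> : (fun m => ((l^-1 ^+ m *: C ^+ m) *m E) i j) = (fun=> E i j).
      by apply/funext => m; rewrite -scalemxAl yE.
    exact: clim_cst.
  exact: clim_mulmxr.
exists E; split => //.
- have /eigenvalueP[u uC u0] := lev.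
  apply: contraNneq u0 => E0; apply/eqP/rowP => j.
  apply: (@clim_unique _ (fun m => (u *m (l^-1 ^+ m *: C ^+ m)) 0 j)).
    have -> : (fun m => (u *m (l^-1 ^+ m *: C ^+ m)) 0 j) = (fun=> u 0 j).
      apply/funext => m; congr (fun_of_matrix _ 0 j).
      elim: m => [|m IH]; first by rewrite !expr0 scale1r mulmx1.
      rewrite CpowSl exprS -scalemxAr mulmxA uC -scalemxAl scalerA mulrAC mulVf // mul1r.
      by rewrite scalemxAr.
    exact: clim_cst.
  have -> : (0 : 'rV[R[i]]_d.+1) 0 j = (u *m E) 0 j by rewrite E0 mulmx0.
  exact: clim_mulmxl.
- apply: rank_eigen_simple charE _ CE.
  by rewrite -[_ != _]/(~~ root _ _) /factors root_prod_XsubC.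
Qed.

End ComplexPowers.

Lemma clim_real (x : nat -> R) (e : R[i]) : clim (fun m => (x m)%:C%C) e ->
  (complex.Re e)%:C%C = e.
Proof.
move=> xe.
have : clim (fun m => (x m)%:C%C) (conjc e).
  move: xe; rewrite /clim.
  have -> // : (fun m => cmod ((x m)%:C%C - e)) = (fun m => cmod ((x m)%:C%C - conjc e)).
  apply/funext => m; rewrite -cmodJ; congr cmod.
  by rewrite (rmorphB (@conjc R)); congr (_ - _); exact: conjc_real.
move=> /(clim_unique xe); case: e {xe} => a b [bb].
by congr (_ +i* _)%C; lra.
Qed.

(** The dominant eigenvalue is real, its conjugate being an eigenvalue of the
    same modulus; so the limit of the normalized powers is a real projection on
    the eigenline. *)
Lemma proximal_rank1 d (B : 'M[R]_d.+1) : \det B != 0 -> proximal_mx B ->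
  exists (lam : R) (v : 'cV[R]_d.+1) (f : 'rV[R]_d.+1),
    [/\ lam != 0, f *m v = 1%:M, B *m v = lam *: v, f *m B = lam *: f &
      (fun m => nrm (lam^-1 ^+ m *: B ^+ m - v *m f)) @ \oo --> (0 : R)].
Proof.
move=> detB [l [lev mupl lmod dom]].
have l0 : l != 0.
  apply: contraNneq detB => l0; move: lev; rewrite l0 eigenvalue_root_char.
  rewrite /root horner_coef0 /complexify -map_char_poly coef_map char_poly_det.
  by rewrite fmorph_eq0 mulf_eq0 signr_eq0.
have [lam lE] : exists lam : R, l = (lam%:C)%C.
  have conjl : eigenvalue (complexify B) (conjc l).
    move: lev; rewrite !eigenvalue_root_char /complexify -map_char_poly.
    rewrite -complex_root_conj -map_poly_comp /=.
    congr root; by apply: eq_map_poly => x /=; rewrite oppr0.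
  have [/eqP E|/(dom _ conjl)] := boolP (conjc l == l); last by rewrite cmodJ lmod ltxx.
  case: l E {lev mupl lmod dom l0 conjl} => a b [bb]; exists a.
  by congr (_ +i* _)%C; lra.
have lam0 : lam != 0 by apply: contraNneq l0 => l0; rewrite lE l0.
have [|E [CE EE E0 rkE lim]] := dominant_limit l0 lev mupl.
  by move=> z zev zl; rewrite lmod; exact: dom.
pose E1 := map_mx (@complex.Re R) E.
have powE m : l^-1 ^+ m *: complexify B ^+ m = complexify (lam^-1 ^+ m *: B ^+ m).
  by rewrite /complexify map_mxZ !rmorphXn /= fmorphV lE.
have EE1 : E = complexify E1.
  apply/matrixP => i j; rewrite !mxE.
  rewrite (@clim_real (fun m => (lam^-1 ^+ m *: B ^+ m) i j)) //.
  by have := lim i j; congr clim; apply/funext => m; rewrite powE mxE.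
have inj := @map_mx_inj _ _ (real_complex R).
have E10 : E1 != 0 by apply: contraNneq E0 => E10; rewrite EE1 E10 /complexify map_mx0.
have E11 : E1 *m E1 = E1 by apply: inj; rewrite map_mxM -/(complexify E1) -EE1.
have BE1 : B *m E1 = lam *: E1.
  by apply: inj; rewrite map_mxM map_mxZ -/(complexify E1) -/(complexify B) -EE1 CE lE.
have rkE1 : (\rank E1 <= 1)%N by rewrite -(mxrank_map (real_complex R)) -/(complexify E1) -EE1.
have [v [f E1vf]] := rank1_factor E10 rkE1.
have limR i j : (fun m => `|(lam^-1 ^+ m *: B ^+ m - v *m f) i j|) @ \oo --> (0 : R).
  have := lim i j; rewrite /clim.
  have -> // : (fun m => cmod ((l^-1 ^+ m *: complexify B ^+ m) i j - E i j)) =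
    (fun m => `|(lam^-1 ^+ m *: B ^+ m - v *m f) i j|).
  apply/funext => m; rewrite powE EE1 -E1vf -cmod_real; congr cmod.
  set Y := _ *: B ^+ m; have -> : (Y - E1) i j = Y i j - E1 i j by rewrite !mxE.
  by rewrite [X in _ = (X)%:C%C]/= rmorphB /complexify; congr (_ - _); rewrite mxE.
have limN : (fun m => nrm (lam^-1 ^+ m *: B ^+ m - v *m f)) @ \oo --> (0 : R).
  have sum0 n (y : 'I_n -> nat -> R) : (forall i, y i @ \oo --> (0 : R)) ->
      (fun m => \sum_i y i m) @ \oo --> (0 : R).
    elim: n y => [|n IH] y y0.
      have -> : (fun m => \sum_(i < 0) y i m) = (fun=> 0).
        by apply/funext => m; rewrite big_ord0.
      exact: cvg_cst.
    have -> : (fun m => \sum_(i < n.+1) y i m) =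
        (fun m => y ord0 m + \sum_(i < n) y (lift ord0 i) m).
      by apply/funext => m; rewrite big_ord_recl.
    by rewrite -[X in _ --> X]addr0; apply: cvgD => //; exact: IH.
  by apply: (sum0 _) => i; apply: (sum0 _) => j; exact: limR.
have fv : f *m v = 1%:M.
  have H : (f *m v) 0 0 *: (v *m f) = v *m f.
    rewrite -{2}E1vf -E11 E1vf mulmxA -(mulmxA v f v) [f *m v]mx11_scalar mul_mx_scalar.
    by rewrite -scalemxAl mxE eqxx mulr1n.
  rewrite [LHS]mx11_scalar; congr (_%:M); apply/eqP.
  move/eqP: H; rewrite -subr_eq0 -{2}[v *m f]scale1r -scalerBl scaler_eq0 subr_eq0.
  by rewrite -E1vf (negPf E10) orbF.
have Bv : B *m v = lam *: v.
  have E1v : E1 *m v = v by rewrite E1vf -mulmxA fv mulmx1.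
  by rewrite -[in LHS]E1v mulmxA BE1 -scalemxAl E1v.
exists lam, v, f; split => //.
have EB : E1 *m B = lam *: E1.
  apply/eqP; rewrite -subr_eq0 -nrm_eq0 eq_le nrm_ge0 andbT.
  apply/ler_addgt0Pr => e e0; rewrite add0r.
  have c0 : 0 < 2 * nrm B + 1 by rewrite ltr_wpDl // mulr_ge0 ?nrm_ge0.
  have /cvg0P := limN; move=> /(_ (fun _ => nrm_ge0 _))/(_ _ (divr_gt0 e0 c0))[N HN].
  have := HN N (leqnn N); rewrite -E1vf; set Y := _ *: B ^+ N => HY.
  have YB : Y *m B = B *m Y.
    rewrite /Y -scalemxAl -scalemxAr.
    by congr (_ *: _); rewrite -[LHS]exprSr exprS.
  have -> : E1 *m B - lam *: E1 = B *m (Y - E1) - (Y - E1) *m B.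
    by rewrite mulmxBl mulmxBr YB BE1 opprB addrAC (addrC (B *m Y)) subrK.
  apply: le_trans (nrmB _ _) _.
  apply: le_trans (lerD (nrmM _ _) (nrmM _ _)) _.
  move: HY; rewrite ler_pdivlMr //; set x := nrm (Y - E1).
  have : 0 <= x := nrm_ge0 _; nra.
have fE1 : f *m E1 = f by rewrite E1vf mulmxA fv mul1mx.
by rewrite -[in LHS]fE1 -mulmxA EB -scalemxAr fE1.
Qed.

End Proximal.

(** * Words of matrices and irreducibility *)

Section Words.
Variable I : finType.

Section Sums.
Variable V : nmodType.
Implicit Type F : seq I -> V.

Lemma sum_word0 F : \sum_(w : 0.-tuple I) F w = F [::].
Proof. by rewrite (big_pred1 [tuple]) // => w; apply/esym/eqP; exact: tuple0. Qed.

Lemma sum_word_cons n F :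
  \sum_(w : n.+1.-tuple I) F w = \sum_(i : I) \sum_(w : n.-tuple I) F (i :: w).
Proof.
rewrite pair_big /=.
rewrite (reindex (fun p : I * n.-tuple I => [tuple of p.1 :: p.2])) //=.
exists (fun w => (thead w, [tuple of behead w])) => /= [[i w] _|w _].
  by congr pair; apply: val_inj.
by rewrite -tuple_eta.
Qed.

Lemma sum_word_cat m n F :
  \sum_(w : (m + n).-tuple I) F w =
  \sum_(u : m.-tuple I) \sum_(v : n.-tuple I) F (u ++ v).
Proof.
elim: m F => [|m IH] F; first by rewrite (sum_word0 (fun u => \sum_(v : n.-tuple I) F (u ++ v))).
rewrite sum_word_cons (sum_word_cons _ (fun u => \sum_(v : n.-tuple I) F (u ++ v))).
by apply: eq_bigr => i _; exact: (IH (fun w => F (i :: w))).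
Qed.

Lemma sum_word1 F : \sum_(w : 1.-tuple I) F w = \sum_(i : I) F [:: i].
Proof.
by rewrite sum_word_cons; apply: eq_bigr => i _; exact: (sum_word0 (fun w => F (i :: w))).
Qed.

Lemma sum_word_rcons n F :
  \sum_(w : n.+1.-tuple I) F w = \sum_(w : n.-tuple I) \sum_(i : I) F (rcons w i).
Proof.
rewrite -addn1 sum_word_cat; apply: eq_bigr => w _.
by rewrite (sum_word1 (fun v => F (w ++ v))); apply: eq_bigr => i _; rewrite cats1.
Qed.

End Sums.

Lemma word_le_sum (R : numDomainType) n (F : seq I -> R) (w : seq I) :
  size w = n -> (forall w, 0 <= F w) -> F w <= \sum_(w : n.-tuple I) F w.
Proof.
move=> /eqP sw F0; rewrite (bigD1 (Tuple sw)) //= lerDl; exact: sumr_ge0.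
Qed.

End Words.

Section Connect.
Variables (R : realType) (d : nat) (I : finType) (A : I -> 'M[R]_d).

Definition mxw (w : seq I) : 'M[R]_d := foldr (fun i B => A i *m B) 1%:M w.

Lemma mxw_cat u v : mxw (u ++ v) = mxw u *m mxw v.
Proof. by elim: u => [|i u IH] /=; rewrite ?mul1mx // IH mulmxA. Qed.

Lemma mxw1 i : mxw [:: i] = A i. Proof. by rewrite /= mulmx1. Qed.

Lemma mxw_rcons w i : mxw (rcons w i) = mxw w *m A i.
Proof. by rewrite -cats1 mxw_cat mxw1. Qed.

Hypothesis Ainv : forall i, A i \in unitmx.
Hypothesis Airr : strongly_irreducible A.

Lemma mxw_unit w : mxw w \in unitmx.
Proof. by elim: w => [|i w IH]; rewrite /= ?unitmx1 // unitmx_mul Ainv. Qed.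

Notation subsp := {vspace 'cV[R]_d}.

(** Such a cycle of subspaces is a finite union preserved by the matrices. *)
Lemma stable_cycle (V : nat -> subsp) n p : (0 < p)%N ->
  (forall k, (n <= k < n + p)%N -> V k != 0%VS /\ V k != fullv) ->
  (forall i k x, (n <= k < n + p)%N -> x \in V k ->
     exists2 k', (n <= k' < n + p)%N & A i *m x \in V k') -> False.
Proof.
move=> p0 proper stab; apply: Airr.
have memVs V0 : V0 \in [seq V k | k <- iota n p] ->
    exists2 k, (n <= k < n + p)%N & V0 = V k.
  by case/mapP => k; rewrite mem_iota => ? ->; exists k.
exists [seq V k | k <- iota n p]; split.
- by case: p p0 {proper stab memVs}.
- by move=> V0 /memVs[k /proper H ->].
move=> i _ [x [V0 /memVs[k kp ->] xV] <-].
have [k' kp' AxV] := stab i k x kp xV.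
by exists (V k') => //; apply/map_f; rewrite mem_iota.
Qed.

Lemma nat_stationary (f : nat -> nat) : (forall j, f j.+1 <= f j)%N ->
  exists j, f j.+1 = f j.
Proof.
move=> fdec; apply: contrapT => /forallNP H.
have : forall j, (f j + j <= f 0)%N.
  elim => [|j IH]; first by rewrite addn0.
  by move: (H j) (fdec j) => /eqP ? ?; lia.
by move=> /(_ (f 0).+1); rewrite addnS ltnNge leq_addl.
Qed.

Section Iterates.
Variables (T : subsp -> subsp) (V0 : subsp) (p : nat).
Hypothesis Tmono : forall U V, (U <= V)%VS -> (T U <= T V)%VS.
Let V n := iter n T V0.

Lemma iter_mono n U W : (U <= W)%VS -> (iter n T U <= iter n T W)%VS.
Proof. by elim: n => [//|n IH] UW /=; apply/Tmono/IH. Qed.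

(** Along the multiples of [p] the iterates form a monotone sequence, whose
    dimensions are constant from some point on. *)
Lemma eventually_periodic :
  (V p <= V0)%VS \/ (V0 <= V p)%VS ->
  exists n0, forall n, (n0 <= n)%N -> V (n + p) = V n.
Proof.
move=> mono.
have shift j : V (j.+1 * p) = iter (j * p) T (V p) by rewrite mulSn addnC /V iterD.
have [j Vj] : exists j, V (j.+1 * p) = V (j * p).
  case: mono => mono.
    have sub j : (V (j.+1 * p) <= V (j * p))%VS by rewrite shift iter_mono.
    have [j dimj] := nat_stationary (fun j => dimvS (sub j)).
    by exists j; apply/eqP; rewrite eqEdim sub dimj leqnn.
  have sub j : (V (j * p) <= V (j.+1 * p))%VS by rewrite shift iter_mono.
  have [|j dimj] := @nat_stationary (fun j => \dim {: 'cV[R]_d} - \dim (V (j * p)))%N.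
    by move=> j; rewrite leq_sub2l // dimvS.
  exists j; apply/esym/eqP; rewrite eqEdim sub /=.
  move: (dimvS (subvf (V (j.+1 * p)))) (dimvS (subvf (V (j * p)))) => ? ?; lia.
exists (j * p)%N => n jn.
have -> : (n + p = (n - j * p) + j.+1 * p)%N by rewrite mulSn; lia.
by rewrite /V iterD -/(V (j.+1 * p)) Vj /V -iterD subnK.
Qed.
End Iterates.

Let Af i := linfun (mulmx (A i) : 'cV[R]_d -> 'cV[R]_d).

Let AfE i x : Af i x = A i *m x. Proof. by rewrite lfunE. Qed.

Section Spans.
Variables (w0 : seq I) (lam : R).
Hypotheses (w0n : (0 < size w0)%N) (lam0 : lam != 0).
Let p := size w0.

Section Columns.
Variable v : 'cV[R]_d.
Hypotheses (v0 : v != 0) (Bv : mxw w0 *m v = lam *: v).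

Let T (V : subsp) : subsp := (\sum_i (Af i @: V))%VS.
Let W n : subsp := iter n T <[v]>%VS.

Let Tmono U V : (U <= V)%VS -> (T U <= T V)%VS.
Proof.
move=> UV; apply/subv_sumP => i _; apply: subv_trans (limgS _ UV) _.
exact: (sumv_sup i).
Qed.

Let WS n i x : x \in W n -> A i *m x \in W n.+1.
Proof.
move=> xW; rewrite -AfE; apply: (subvP (sumv_sup i _ (subvv _))) => //.
exact: memv_img.
Qed.

Let Wword w x n : x \in W n -> mxw w *m x \in W (size w + n).
Proof. by move=> xW; elim: w => [|i w IH]; rewrite /= ?mul1mx // -mulmxA WS. Qed.

Let W_comb n x : x \in W n ->
  exists c : n.-tuple I -> R, x = \sum_k c k *: (mxw k *m v).
Proof.
elim: n x => [|n IH] x.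
  move=> /vlineP[a ->]; exists (fun=> a).
  by rewrite (sum_word0 (fun k => a *: (mxw k *m v))) mul1mx.
move=> /memv_sumP[y yW ->].
have H : forall i, exists c : n.-tuple I -> R,
    y i = \sum_k c k *: (mxw (i :: k) *m v).
  move=> i; have /memv_imgP[z zW ->] := yW i isT.
  have [c ->] := IH z zW; exists c; rewrite AfE mulmx_sumr; apply: eq_bigr => k _.
  by rewrite -scalemxAr mulmxA.
have [c cE] := choice H.
pose c' (w : seq I) := if w is i :: w' then
  (if insub w' is Some k then c i k else 0) else 0.
exists (fun k => c' k); rewrite (sum_word_cons _ (fun k => c' k *: (mxw k *m v))).
apply: eq_bigr => i _; rewrite cE; apply: eq_bigr => k _; congr (_ *: _).
by rewrite /c' valK.
Qed.

(** The images of [v] under the words of length [n] span spaces [W n] which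
    increase along the multiples of the length of [w0], because [v] is an
    eigenvector of the product along [w0].  If none of them were the whole space
    they would end up in a cycle of proper subspaces. *)
Lemma columns_span : exists l (h : l.-tuple I -> 'rV[R]_d),
  \sum_(k : l.-tuple I) (mxw k *m v) *m h k = 1%:M.
Proof.
suff [l Wl] : exists l, W l = fullv.
  have /choice[c cE] : forall j : 'I_d, exists c : l.-tuple I -> R,
      delta_mx j 0 = \sum_k c k *: (mxw k *m v).
    by move=> j; apply: W_comb; rewrite Wl memvf.
  exists l, (fun k => \sum_j c j k *: delta_mx 0 j).
  have -> : 1%:M = \sum_j delta_mx j 0 *m (delta_mx 0 j : 'rV[R]_d).
    rewrite [LHS]matrix_sum_delta; apply: eq_bigr => j _.
    rewrite (bigD1 j) //= big1 ?addr0; last first.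
      by move=> k /negPf kj; rewrite mxE eq_sym kj scale0r.
    by rewrite mxE eqxx scale1r mul_delta_mx.
  under [RHS]eq_bigr do rewrite cE mulmx_suml.
  rewrite exchange_big; apply: eq_bigr => k _ /=.
  rewrite mulmx_sumr; apply: eq_bigr => j _.
  by rewrite -scalemxAr -scalemxAl.
apply: contrapT => /forallNP nfull.
have Wp : (W 0 <= W p)%VS.
  rewrite -memvE; have := Wword w0 (memv_line v : v \in W 0).
  rewrite Bv addn0 => H; have := memvZ lam^-1 H.
  by rewrite scalerA mulVf // scale1r.
have [n0 per] := eventually_periodic Tmono (or_intror Wp).
apply: (@stable_cycle W n0 p) => //.
  move=> k _; split; last by apply/eqP; exact: nfull.
  have vv : v \in W 0 by exact: memv_line.
  have [w wk] : exists w : seq I, size w = k.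
    by case: w0 w0n => // i _ _; exists (nseq k i); rewrite size_nseq.
  have := Wword w vv; rewrite addn0 wk => vW; apply: contraTneq vW => ->.
  rewrite memv0; apply: contra v0 => /eqP vw0.
  by rewrite -[v](mulKmx (mxw_unit w)) vw0 mulmx0.
move=> i k x /andP[k1 k2] xW.
have := WS i xW; have [->|kn] := eqVneq k.+1 (n0 + p)%N.
  by rewrite /W per // => ?; exists n0 => //; rewrite leqnn /= -addn1 leq_add2l.
by exists k.+1 => //; rewrite (leq_trans k1 (leqnSn k)) ltn_neqAle kn.
Qed.

End Columns.

Section Rows.
Variable f : 'rV[R]_d.
Hypotheses (f0 : f != 0) (fB : f *m mxw w0 = lam *: f).

Let T (V : subsp) : subsp := (\bigcap_i (Af i @^-1: V))%VS.
Let V0 : subsp := lker (linfun (mulmx f : 'cV[R]_d -> 'cV[R]_1)).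
Let V n : subsp := iter n T V0.

Let memT U x : (x \in T U) = [forall i, A i *m x \in U].
Proof.
apply/idP/forallP => [xT i|H].
  by rewrite -AfE memv_preim; apply: (subvP (bigcapv_inf i _ (subvv _))) xT.
rewrite memvE; apply/subv_bigcapP => i _.
by rewrite -memvE -memv_preim AfE.
Qed.

Let memV n x :
  reflect (forall k, size k = n -> f *m mxw k *m x = 0) (x \in V n).
Proof.
elim: n x => [|n IH] x.
  rewrite memv_ker lfunE /=; apply: (iffP eqP) => H.
    by move=> k /size0nil ->; rewrite mulmx1.
  by have := H [::] erefl; rewrite mulmx1.
rewrite memT; apply: (iffP forallP) => H.
  move=> k; case/lastP: k => [//|k i]; rewrite size_rcons => -[sk].
  by have := elimT (IH _) (H i) k sk; rewrite mxw_rcons !mulmxA.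
move=> i; apply/IH => k sk; have := H (rcons k i).
by rewrite mxw_rcons size_rcons sk !mulmxA; apply.
Qed.

(** Dually, the vectors which [f] kills after every word of length [n] form
    spaces that decrease along the multiples of the length of [w0]. *)
Lemma rows_span : exists l (g : l.-tuple I -> 'cV[R]_d),
  \sum_(k : l.-tuple I) g k *m (f *m mxw k) = 1%:M.
Proof.
suff [l Vl] : exists l, V l = 0%VS.
  pose F := \matrix_(a < #|{: l.-tuple I}|) (f *m mxw (enum_val a)).
  have /row_fullP[G GF] : row_full F.
    rewrite -[row_full F]/(\rank F == d) -mxrank_tr -/(row_free F^T) -kermx_eq0.
    apply/eqP/row_matrixP => i; rewrite row0; set x := row i _.
    have xF : F *m x^T = 0.
      apply: trmx_inj; rewrite trmx_mul trmxK trmx0 /x -row_mul mulmx_ker.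
      by rewrite row0.
    have : x^T \in V l.
      apply/memV => k /eqP sk; have := congr1 (row (enum_rank (Tuple sk))) xF.
      by rewrite row_mul rowK enum_rankK row0.
    by rewrite Vl memv0 => /eqP/(congr1 trmx); rewrite trmxK trmx0.
  exists l, (fun k => col (enum_rank k) G); rewrite -GF.
  rewrite (reindex (fun a : 'I_#|{: l.-tuple I}| => enum_val a)) /=; last first.
    by exists enum_rank => k _; rewrite ?enum_valK ?enum_rankK.
  apply/matrixP => a b; rewrite summxE [RHS]mxE; apply: eq_bigr => k _.
  by rewrite enum_valK mxE big_ord1 mxE [F _ _]mxE.
apply: contrapT => /forallNP n0V.
have Vp : (V p <= V 0)%VS.
  apply/subvP => x /memV H; rewrite memv_ker lfunE /=; apply/eqP.
  have := H w0 erefl; rewrite fB -scalemxAl => /eqP.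
  by rewrite scaler_eq0 (negPf lam0) => /eqP.
have Tmono U W : (U <= W)%VS -> (T U <= T W)%VS.
  move=> /subvP UW; apply/subvP => x; rewrite !memT => /forallP H.
  by apply/forallP => i; apply/UW/H.
have [n0 per] := eventually_periodic Tmono (or_introl Vp).
apply: (@stable_cycle V n0 p) => //.
  move=> k _; split; first by apply/eqP; exact: n0V.
  apply: contraNneq f0 => Vk.
  have [w wk] : exists w : seq I, size w = k.
    by case: w0 w0n => // i _ _; exists (nseq k i); rewrite size_nseq.
  have fw0 : f *m mxw w = 0.
    apply/eqP; rewrite -[_ *m _]mulmx1; apply/eqP/matrixP => a b.
    have /memV/(_ w wk)/matrixP/(_ a 0) : (delta_mx b 0 : 'cV[R]_d) \in V k by rewrite Vk memvf.
    rewrite mulmx1 -colE !mxE; by rewrite !ord1.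
  by rewrite -[f](mulmxK (mxw_unit w)) fw0 mul0mx.
move=> i k x /andP[k1 k2] xV.
have step n : x \in V n.+1 -> A i *m x \in V n by rewrite /V /= memT => /forallP.
case: k k1 k2 xV => [|k] k1 k2 xV.
  have n00 : n0 = 0%N by lia.
  have : x \in V p by rewrite -[p]add0n /V per ?n00.
  have pn0 : (0 < p)%N := w0n.
  rewrite -(prednK pn0) => /step H; exists p.-1 => //.
  by rewrite n00 add0n /= prednK.
have [E|kn] := eqVneq n0 k.+1; last by exists k; [lia|exact: step].
have : x \in V (n0 + p) by rewrite /V per // E.
move: (w0n); rewrite -/p => pn0.
have -> : (n0 + p = (n0 + p).-1.+1)%N by lia.
by move=> /step H; exists (n0 + p).-1 => //; lia.
Qed.

End Rows.
End Spans.
End Connect.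

(** * Word measures *)

Section WordMeasures.
Variables (R : realType) (I : finType).
Implicit Type p : seq I -> R.

(** The values on cylinders of a shift-invariant probability measure. *)
Definition word_measure p := [/\ p [::] = 1, forall w, 0 <= p w,
  forall w, \sum_i p (rcons w i) = p w & forall w, \sum_i p (i :: w) = p w].

(** The error is relative to the product of the masses, so that it can be summed
    over [u] and [w]. *)
Definition psi_mixing p := exists D gamma : R, [/\ 0 < D, 0 < gamma < 1 &
  forall n u w, `|\sum_(k : n.-tuple I) p (u ++ k ++ w) - p u * p w| <=
                D * gamma ^+ n * (p u * p w)].

End WordMeasures.

(** * Connecting, pinching and attracting words *)

Section Cocycle.
Variables (R : realType) (d : nat) (I : finType).
Implicit Type A : I -> 'M[R]_d.

Definition connecting A := exists l (c : R), 0 < c /\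
  forall m n (U : 'M[R]_(m, d)) (X : 'M[R]_(d, n)),
  exists2 k, size k = l & c * nrm U * nrm X <= nrm (U *m mxw A k *m X).

(** [ext2 B] is small against [nrm B ^+ 2] when [B] is close to rank one up to a
    scalar. *)
Definition pinching A := forall delta : R, 0 < delta ->
  exists w, ext2 (mxw A w) <= delta * nrm (mxw A w) ^+ 2.

(** The words have a common length so that all starting points can be compared
    under the same power of the transfer operator. *)
Definition attracting A := exists2 v : 'cV[R]_d, v != 0 &
  forall (delta : R) n0, 0 < delta -> exists N (p : R), [/\ (n0 <= N)%N, 0 < p &
    forall x : 'cV[R]_d, exists k, [/\ size k = N,
      p * nrm x <= nrm (mxw A k *m x) &
      nrm (wedge (mxw A k *m x) v) <= delta * (nrm (mxw A k *m x) * nrm v)]].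

Lemma mxwZ A (c : R) w : mxw (fun i => c *: A i) w = c ^+ size w *: mxw A w.
Proof.
elim: w => [|i w IH] /=; first by rewrite expr0 scale1r.
by rewrite IH -scalemxAl -scalemxAr scalerA exprS.
Qed.

Lemma connectingZ A (c : R) : 0 < c -> connecting A -> connecting (fun i => c *: A i).
Proof.
move=> c0 [l [a [a0 H]]]; exists l, (c ^+ l * a); split; first by rewrite mulr_gt0 ?exprn_gt0.
move=> m n U X; have [k sk Hk] := H m n U X; exists k => //.
rewrite mxwZ sk -scalemxAr -scalemxAl nrmZ ger0_norm ?exprn_ge0 ?(ltW c0) //.
rewrite -!mulrA; apply: ler_wpM2l; first by rewrite exprn_ge0 ?(ltW c0).
by rewrite mulrA.
Qed.

Lemma pinchingZ A (c : R) : 0 < c -> pinching A -> pinching (fun i => c *: A i).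
Proof.
move=> c0 H delta /H[w Hw]; exists w; rewrite mxwZ ext2Z nrmZ exprMn.
rewrite ger0_norm ?exprn_ge0 ?(ltW c0) // mulrCA; apply: ler_wpM2l => //.
by rewrite !exprn_ge0 ?(ltW c0).
Qed.

Lemma attractingZ A (c : R) : 0 < c -> attracting A -> attracting (fun i => c *: A i).
Proof.
move=> c0 [v v0 H]; exists v => // delta n0 /(H _ n0)[N [p [n0N p0 HN]]].
exists N, (c ^+ N * p); split => //; first by rewrite mulr_gt0 ?exprn_gt0.
have cN : 0 <= c ^+ N by rewrite exprn_ge0 ?(ltW c0).
move=> x; have [k [sk k1 k2]] := HN x; exists k; split => //; rewrite mxwZ sk -scalemxAl.
  by rewrite nrmZ ger0_norm // -mulrA ler_wpM2l.
rewrite wedgeZl !nrmZ ger0_norm // -[X in _ <= _ * X]mulrA mulrCA.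
by rewrite ler_wpM2l.
Qed.

End Cocycle.

Section RankOnePowers.
Variables (R : realType) (d : nat) (I : finType) (A : I -> 'M[R]_d.+1).
Hypothesis Ainv : forall i, A i \in unitmx.
Hypothesis Airr : strongly_irreducible A.

Variables (w0 : seq I) (lam : R) (v : 'cV[R]_d.+1) (f : 'rV[R]_d.+1).
Hypotheses (w0n : (0 < size w0)%N) (lam0 : lam != 0) (fv : f *m v = 1%:M)
  (Bv : mxw A w0 *m v = lam *: v) (fB : f *m mxw A w0 = lam *: f)
  (lim : (fun m => nrm (lam^-1 ^+ m *: mxw A w0 ^+ m - v *m f)) @ \oo --> (0 : R)).

Let v0 : v != 0.
Proof.
apply/negP => /eqP v0; move: fv; rewrite v0 mulmx0 => /matrixP/(_ 0 0).
by rewrite !mxE eqxx => /eqP; rewrite eq_sym oner_eq0.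
Qed.

Let f0 : f != 0.
Proof.
apply/negP => /eqP f0; move: fv; rewrite f0 mul0mx => /matrixP/(_ 0 0).
by rewrite !mxE eqxx => /eqP; rewrite eq_sym oner_eq0.
Qed.

Let word_of_size n : exists w : seq I, size w = n.
Proof. by case: w0 w0n => // i _ _; exists (nseq n i); rewrite size_nseq. Qed.

(** One of the terms carries a definite share of the sum. *)
Let pigeon l (a h : l.-tuple I -> R) (u : R) : 0 <= u -> (forall k, 0 <= a k) ->
  (forall k, 0 <= h k) -> u <= \sum_k a k * h k ->
  exists k : l.-tuple I, u <= (\sum_k h k + 1) * a k.
Proof.
move=> u0 a0 h0 uah; apply: contrapT => /forallNP H.
have [w sw] := word_of_size l.
have H1 k : (\sum_k h k + 1) * a k <= u by have /negP := H k; rewrite -ltNge; exact: ltW.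
set S := \sum_k h k in H H1.
have S0 : 0 <= S by exact: sumr_ge0.
have : (S + 1) * u <= u * S.
  apply: le_trans (ler_wpM2l _ uah) _; first by rewrite addr_ge0.
  rewrite mulr_sumr /S mulr_sumr; apply: ler_sum => k _.
  by rewrite mulrA ler_wpM2r.
move=> Hu; have u00 : u = 0 by nra.
move/eqP: sw => sw; apply: (H (Tuple sw)).
by rewrite u00 mulr_ge0 // addr_ge0.
Qed.

Let left_span : exists l (K : R), 0 < K /\
  forall m (U : 'M[R]_(m, d.+1)), exists2 k, size k = l &
    nrm U <= K * nrm (U *m mxw A k *m v).
Proof.
have [l [h hE]] := columns_span Ainv Airr w0n lam0 v0 Bv.
exists l, (\sum_k nrm (h k) + 1); split.
  by rewrite ltr_wpDl // sumr_ge0 // => k _; exact: nrm_ge0.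
move=> m U.
have [|k Hk] := @pigeon l (fun k => nrm (U *m mxw A k *m v)) (fun k => nrm (h k))
  (nrm U) (nrm_ge0 _) (fun _ => nrm_ge0 _) (fun _ => nrm_ge0 _).
  rewrite -{1}[U]mulmx1 -hE mulmx_sumr; apply: le_trans (nrm_sum _ _ _) _.
  by apply: ler_sum => k _; rewrite !mulmxA; exact: nrmM.
by exists k => //; exact: size_tuple.
Qed.

Let right_span : exists l (K : R), 0 < K /\
  forall n (X : 'M[R]_(d.+1, n)), exists2 k, size k = l &
    nrm X <= K * nrm (f *m mxw A k *m X).
Proof.
have [l [g gE]] := rows_span Ainv Airr w0n lam0 f0 fB.
exists l, (\sum_k nrm (g k) + 1); split.
  by rewrite ltr_wpDl // sumr_ge0 // => k _; exact: nrm_ge0.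
move=> n X.
have [|k Hk] := @pigeon l (fun k => nrm (f *m mxw A k *m X)) (fun k => nrm (g k))
  (nrm X) (nrm_ge0 _) (fun _ => nrm_ge0 _) (fun _ => nrm_ge0 _).
  rewrite -{1}[X]mul1mx -gE mulmx_suml; apply: le_trans (nrm_sum _ _ _) _.
  by apply: ler_sum => k _; rewrite -mulmxA mulrC; exact: nrmM.
by exists k => //; exact: size_tuple.
Qed.

Let wpow m := flatten (nseq m w0).

Let mxw_pow m : mxw A (wpow m) = mxw A w0 ^+ m.
Proof. by elim: m => [//|m IH]; rewrite /wpow /= mxw_cat IH exprS. Qed.

Let size_wpow m : size (wpow m) = (m * size w0)%N.
Proof. by elim: m => [//|m IH]; rewrite /wpow /= size_cat IH mulSn. Qed.

Let Y m := lam^-1 ^+ m *: mxw A w0 ^+ m.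

Let powY m : mxw A (wpow m) = lam ^+ m *: Y m.
Proof. by rewrite mxw_pow /Y scalerA -exprMn divff // expr1n scale1r. Qed.

Let near_rank1 e n0 : 0 < e -> exists2 m, (n0 <= m)%N & nrm (Y m - v *m f) <= e.
Proof.
move=> e0; have /cvg0P := lim; move=> /(_ (fun _ => nrm_ge0 _))/(_ _ e0)[N HN].
by exists (maxn n0 N); rewrite ?leq_maxl // HN // leq_maxr.
Qed.

Let word_bound l : exists2 a : R, 0 < a & forall k, size k = l -> nrm (mxw A k) <= a.
Proof.
exists (\sum_(k : l.-tuple I) nrm (mxw A k) + 1).
  by rewrite ltr_wpDl // sumr_ge0 // => k _; exact: nrm_ge0.
move=> k sk; have := word_le_sum sk (fun w => nrm_ge0 (mxw A w)).
by move=> /le_trans; apply; rewrite lerDl.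
Qed.

(** A high power of the product along [w0] is close to a multiple of [v f]; it
    is surrounded by words [k1] and [k2] such that [U k1 v] and [f k2 X] are not
    small. *)
Lemma connecting_of_rank1 : connecting A.
Proof.
have [l1 [K1 [K10 H1]]] := left_span; have [l2 [K2 [K20 H2]]] := right_span.
have [a1 a10 B1] := word_bound l1; have [a2 a20 B2] := word_bound l2.
have e0 : 0 < (2 * K1 * K2 * a1 * a2)^-1 by rewrite invr_gt0 !mulr_gt0.
have [m _ Ym] := near_rank1 0 e0.
exists (l1 + (m * size w0 + l2))%N, (`|lam| ^+ m * (2 * K1 * K2)^-1); split.
  by rewrite mulr_gt0 ?exprn_gt0 ?normr_gt0 ?invr_gt0 ?mulr_gt0.
move=> p q U X; have [k1 s1 Hk1] := H1 p U; have [k2 s2 Hk2] := H2 q X.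
exists (k1 ++ wpow m ++ k2); first by rewrite !size_cat s1 s2 size_wpow.
rewrite !mxw_cat powY -scalemxAl -!scalemxAr -scalemxAl nrmZ normrX -!mulrA.
rewrite ler_wpM2l ?exprn_ge0 //.
set U1 := U *m mxw A k1; set X2 := mxw A k2 *m X.
have -> : U *m (mxw A k1 *m (Y m *m mxw A k2)) *m X = U1 *m Y m *m X2.
  by rewrite /U1 /X2 !mulmxA.
have -> : U1 *m Y m *m X2 = (U1 *m v) *m (f *m X2) - U1 *m (v *m f - Y m) *m X2.
  by rewrite mulmxBr mulmxBl !mulmxA opprB addrCA subrr addr0.
have main : nrm U * nrm X <= K1 * K2 * nrm ((U1 *m v) *m (f *m X2)).
  rewrite nrm_colrow; have := ler_pM (nrm_ge0 _) (nrm_ge0 _) Hk1 Hk2.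
  by rewrite /X2 mulmxA -/U1 [in X in _ -> X]mulrACA.
have err : nrm (U1 *m (v *m f - Y m) *m X2) <= (2 * K1 * K2)^-1 * (nrm U * nrm X).
  apply: le_trans (nrmM _ _) _.
  apply: (@le_trans _ _ (nrm U * a1 * (2 * K1 * K2 * a1 * a2)^-1 * (a2 * nrm X))).
    apply: ler_pM; rewrite ?nrm_ge0 //.
      apply: le_trans (nrmM _ _) _; apply: ler_pM; rewrite ?nrm_ge0 //; last by rewrite nrm_distC.
      by apply: le_trans (nrmM _ _) _; rewrite ler_wpM2l ?nrm_ge0 // B1.
    by apply: le_trans (nrmM _ _) _; rewrite ler_wpM2r ?nrm_ge0 // B2.
  rewrite le_eqVlt; apply/orP; left; apply/eqP; field.
  by rewrite !gt_eqF.
have main' : (K1 * K2)^-1 * (nrm U * nrm X) <= nrm ((U1 *m v) *m (f *m X2)).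
  by rewrite ler_pdivrMl // mulr_gt0.
have := nrm_dist (U1 *m v *m (f *m X2)) (U1 *m (v *m f - Y m) *m X2).
move=> /(le_trans (ler_norm _)); apply: le_trans.
have E : (K1 * K2)^-1 = 2 * (2 * K1 * K2)^-1 by field; rewrite !gt_eqF.
move: main' err; rewrite E; lra.
Qed.

Lemma pinching_of_rank1 : pinching A.
Proof.
move=> delta delta0; set E := v *m f.
have E0 : 0 < nrm E.
  rewrite nrm_gt0; apply: contra v0 => /eqP E0.
  by rewrite -[v]mulmx1 -fv mulmxA -/E E0 mul0mx.
pose e := Num.min (nrm E / 2) (delta * nrm E / (24 * d.+1%:R ^+ 2)).
have D0 : 0 < d.+1%:R ^+ 2 :> R by rewrite exprn_gt0 // ltr0n.
have e0 : 0 < e by rewrite lt_min divr_gt0 //= divr_gt0 ?mulr_gt0.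
have [m _ Ym] := near_rank1 0 e0.
exists (wpow m); rewrite powY ext2Z nrmZ exprMn real_normK ?num_real //.
rewrite mulrCA ler_wpM2l ?sqr_ge0 //.
apply: le_trans (ext2_rank1 v f (Y m)) _; rewrite -/E.
set r := nrm (Y m - E) in Ym *; set D := _ ^+ 2 in D0 e Ym e0 *.
have r0 : 0 <= r := nrm_ge0 _.
have r1 : 2 * r <= nrm E.
  by rewrite mulrC -ler_pdivlMr //; apply: le_trans Ym _; rewrite ge_min lexx.
have r2 : 24 * D * r <= delta * nrm E.
  by rewrite mulrC -ler_pdivlMr ?mulr_gt0 //; apply: le_trans Ym _; rewrite ge_min lexx orbT.
have := nrm_dist (Y m) E; rewrite -/r ler_norml => /andP[n1 n2].
apply: (@le_trans _ _ (5 * nrm E * (D * r))).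
  rewrite (_ : 2 * D * r * _ = 2 * (nrm (Y m) + nrm E) * (D * r)); last by ring.
  by rewrite ler_wpM2r ?mulr_ge0 ?(ltW D0) //; lra.
apply: (@le_trans _ _ (delta * (nrm E / 2) ^+ 2)).
  have := ler_wpM2l (ltW E0) r2; rewrite expr2; nra.
rewrite ler_wpM2l ?(ltW delta0) // ler_pXn2r ?nnegrE ?nrm_ge0 //; lra.
Qed.

(** A first word brings [x] away from the kernel of [f], after which a high power
    of the product along [w0] aligns it with [v]. *)
Lemma attracting_of_rank1 : attracting A.
Proof.
exists v => // delta n0 delta0.
have [l [K [K0 H]]] := right_span; have [a a0 Ba] := word_bound l.
have nv0 : 0 < nrm v by rewrite nrm_gt0.
pose e := Num.min (nrm v / (2 * K * a)) (delta * nrm v / (4 * K * a)).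
have e0 : 0 < e by rewrite lt_min !divr_gt0 ?mulr_gt0.
have [m n0m Ym] := near_rank1 n0 e0.
have lm0 : 0 < `|lam| ^+ m by rewrite exprn_gt0 // normr_gt0.
exists (m * size w0 + l)%N, (`|lam| ^+ m * (nrm v / (2 * K))); split.
- apply: leq_trans (leq_addr _ _); apply: leq_trans n0m _.
  by rewrite leq_pmulr.
- by rewrite mulr_gt0 // divr_gt0 // mulr_gt0.
move=> x; have [k sk Hk] := H _ x.
exists (wpow m ++ k); rewrite size_cat size_wpow sk mxw_cat powY -scalemxAl -scalemxAl.
rewrite -(mulmxA (Y m)).
rewrite -mulmxA in Hk; set y := mxw A k *m x in Hk *; set Z := Y m - v *m f.
have ZY : Y m *m y = (f *m y) 0 0 *: v + Z *m y.
  rewrite /Z mulmxBl -(mulmxA v f y) [f *m y]mx11_scalar mul_mx_scalar.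
  by rewrite mxE eqxx mulr1n addrC subrK.
have fy : nrm (f *m y) = `|(f *m y) 0 0| by rewrite /nrm !big_ord1.
have ny : nrm y <= a * nrm x.
  by apply: le_trans (nrmM _ _) _; rewrite ler_wpM2r ?nrm_ge0 // Ba.
have Zy : nrm (Z *m y) <= e * (a * nrm x).
  by apply: le_trans (nrmM _ _) _; apply: ler_pM; rewrite ?nrm_ge0.
have e1 : e * (2 * K * a) <= nrm v.
  by rewrite -ler_pdivlMr ?mulr_gt0 // ge_min lexx.
have e2 : e * (4 * K * a) <= delta * nrm v.
  by rewrite -ler_pdivlMr ?mulr_gt0 // ge_min lexx orbT.
have nx := nrm_ge0 x.
have lower : nrm x * nrm v <= 2 * K * nrm (Y m *m y).
  have : nrm (Y m *m y) >= nrm (f *m y) * nrm v - nrm (Z *m y).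
    have := nrm_dist ((f *m y) 0 0 *: v) (- (Z *m y)).
    by rewrite opprK -ZY nrmN nrmZ -fy => /(le_trans (ler_norm _)).
  have h1 := ler_wpM2r (ltW nv0) Hk; have h2 := ler_wpM2r nx e1.
  have h3 := ler_wpM2l (ltW K0) Zy => /(ler_wpM2l (ltW K0)).
  move: h1 h2 h3; lra.
split => //.
  rewrite nrmZ normrX -mulrA ler_wpM2l ?(ltW lm0) //.
  have K20 : 0 < 2 * K by rewrite mulr_gt0.
  by rewrite mulrAC ler_pdivrMr // (mulrC (nrm v)) (mulrC _ (2 * K)).
rewrite wedgeZl !nrmZ normrX -[X in _ <= _ * X]mulrA mulrCA ler_wpM2l ?(ltW lm0) //.
have -> : wedge (Y m *m y) v = wedge (Z *m y) v.
  by rewrite -(wedge_subl _ _ ((f *m y) 0 0)) ZY addrC addKr.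
apply: le_trans (nrm_wedge _ _) _.
rewrite mulrA ler_wpM2r ?(ltW nv0) // -(ler_pM2l K0) -(ler_pM2l (ltr0n R 2)).
have h1 := ler_wpM2l (ltW delta0) lower; have h2 := ler_wpM2r nx e2.
have h3 := ler_wpM2l (ltW K0) Zy; move: h1 h2 h3; lra.
Qed.

End RankOnePowers.

Lemma mxword_mxw (R : realType) d (I : finType) (A : I -> 'M[R]_d) n w :
  mxword A n w = mxw A [seq w i | i <- iota 0 n].
Proof.
rewrite /mxword -(big_mkord xpredT (fun i => A (w i))) /index_iota subn0.
by elim: (iota 0 n) => [|i s IH]; rewrite ?big_nil // big_cons IH.
Qed.

Lemma proximal_irreducible_words (R : realType) d (I : finType) (A : I -> 'M[R]_d.+1) :
  (forall i, A i \in unitmx) -> proximal A -> strongly_irreducible A ->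
  [/\ connecting A, pinching A & attracting A].
Proof.
move=> Ainv [n [w]]; rewrite mxword_mxw; set w0 := map _ _ => prox irr.
have w0n : (0 < size w0)%N by rewrite size_map size_iota.
have det0 : \det (mxw A w0) != 0.
  by have := mxw_unit Ainv w0; rewrite unitmxE unitfE.
have [lam [v [f [lam0 fv Bv fB lim]]]] := proximal_rank1 det0 prox.
split.
- exact: connecting_of_rank1 w0n lam0 fv Bv fB lim.
- exact: pinching_of_rank1 fv lim.
- exact: attracting_of_rank1 w0n lam0 fv fB lim.
Qed.

(** * Banach limits *)

Section BanachLimit.
Variable R : realType.
Implicit Types a b : nat -> R.

Definition bounded_seq a := exists C, forall n, `|a n| <= C.

Lemma bounded_seqD a b : bounded_seq a -> bounded_seq b ->
  bounded_seq (fun n => a n + b n).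
Proof.
move=> [C aC] [D bD]; exists (C + D) => n.
by apply: le_trans (ler_normD _ _) _; rewrite lerD.
Qed.

Lemma bounded_seqZ c a : bounded_seq a -> bounded_seq (fun n => c * a n).
Proof.
by move=> [C aC]; exists (`|c| * C) => n; rewrite normrM ler_wpM2l.
Qed.

Lemma bounded_seq_sum (J : finType) (a : J -> nat -> R) :
  (forall j, bounded_seq (a j)) -> bounded_seq (fun n => \sum_j a j n).
Proof.
move=> H; have /choice[C HC] := H.
exists (\sum_j C j) => n; apply: le_trans (ler_norm_sum _ _ _) _.
by apply: ler_sum => j _.
Qed.

Lemma bounded_seq_shift a : bounded_seq a -> bounded_seq (fun n => a n.+1).
Proof. by move=> [C aC]; exists C. Qed.

Lemma bounded_seq_cst c : bounded_seq (fun=> c).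
Proof. by exists `|c|. Qed.

Let U : set_system nat := projT1 (cid (ultraFilterLemma (F := \oo) _)).

Let Uultra : UltraFilter U.
Proof. by rewrite /U; case: cid => G []. Qed.

Let U_infty : \oo `<=` U.
Proof. by rewrite /U; case: cid => G []. Qed.

Let Uproper : ProperFilter U.
Proof. exact: (@ultra_proper _ _ Uultra). Qed.
#[local] Existing Instance Uproper.

Let U_all (P : set nat) : (forall n, P n) -> U P.
Proof. by move=> H; apply: (filterS _ (filterT : U setT)) => n _; exact: H. Qed.

Definition cesaro a n : R := (\sum_(k < n.+1) a k) / n.+1%:R.

(** A Banach limit: the limit of the Cesaro averages along a fixed free
    ultrafilter.  It turns approximate invariance under the transfer operator
    into exact invariance. *)
Definition blim a : R := lim (cesaro a @ U).

Lemma cesaro_le a n C : (forall n, `|a n| <= C) -> `|cesaro a n| <= C.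
Proof.
move=> aC; rewrite normrM normfV [`|n.+1%:R|]ger0_norm // ler_pdivrMr ?ltr0n //.
apply: le_trans (ler_norm_sum _ _ _) _.
apply: (@le_trans _ _ (\sum_(k < n.+1) C)); first by apply: ler_sum => k _.
by rewrite sumr_const card_ord mulr_natr.
Qed.

Lemma blim_cvg a : bounded_seq a -> cvg (cesaro a @ U).
Proof.
move=> [C aC]; have [|p [_ clp]] := @segment_compact R (- C) C (cesaro a @ U) _.
  by apply: U_all => n; rewrite /= in_itv /= -ler_norml; exact: cesaro_le.
apply/cvg_ex; exists p => B Bp.
have [//|UB] := in_ultra_setVsetC (cesaro a @^-1` B) Uultra.
have [x [xB Bx]] := clp (~` B) B UB Bp.
by [].
Qed.

Lemma blimD a b : bounded_seq a -> bounded_seq b ->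
  blim (fun n => a n + b n) = blim a + blim b.
Proof.
move=> ba bb; rewrite /blim -limD; [|exact: blim_cvg..].
congr (lim (_ @ U)); apply/funext => n.
by rewrite /cesaro big_split mulrDl.
Qed.

Lemma blimZ c a : bounded_seq a -> blim (fun n => c * a n) = c * blim a.
Proof.
move=> ba; rewrite /blim.
have -> : cesaro (fun n => c * a n) = (fun n => c * cesaro a n).
  by apply/funext => n; rewrite /cesaro -mulr_sumr mulrA.
apply: cvg_lim => //; apply: cvgM; [exact: cvg_cst|exact: blim_cvg].
Qed.

Lemma blim_cst c : blim (fun=> c) = c.
Proof.
rewrite /blim; have -> : cesaro (fun=> c) = (fun=> c).
  apply/funext => n; rewrite /cesaro sumr_const card_ord -[c *+ _]mulr_natr mulfK //.
exact: lim_cst.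
Qed.

Lemma blim_shift a : bounded_seq a -> blim (fun n => a n.+1) = blim a.
Proof.
move=> ba; have [C aC] := ba; apply/eqP; rewrite -subr_eq0; apply/eqP.
have C0 : 0 <= C by apply: le_trans (aC 0).
have bs := bounded_seq_shift ba.
rewrite -mulN1r -blimZ // -blimD //; last exact: bounded_seqZ.
apply: cvg_lim => //; apply: (@cvg_trans _ (cesaro (fun n => a n.+1 + -1 * a n) @ \oo)).
  by move=> B; exact: U_infty.
apply/cvgrPdist_le => e e0.
exists (Num.truncn (2 * C / e)) => // n /= en.
rewrite sub0r normrN /cesaro.
have -> : \sum_(k < n.+1) (a k.+1 + -1 * a k) = a n.+1 - a 0.
  under eq_bigr do rewrite mulN1r.
  by rewrite -(big_mkord xpredT (fun k => a k.+1 - a k)) telescope_sumr.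
rewrite normrM normfV [`|n.+1%:R|]ger0_norm // ler_pdivrMr ?ltr0n //.
apply: le_trans (ler_normB _ _) _.
apply: (@le_trans _ _ (2 * C)); first by have := aC n.+1; have := aC 0; lra.
rewrite -ler_pdivrMl // mulrC ltW //.
have /truncn_itv/andP[_ /lt_le_trans] : 0 <= 2 * C / e by rewrite divr_ge0 ?mulr_ge0 ?(ltW e0).
by apply; rewrite ler_nat.
Qed.

Lemma blim_le_all a b : bounded_seq a -> bounded_seq b ->
  (forall n, a n <= b n) -> blim a <= blim b.
Proof.
move=> ba bb ab; apply: ler_lim; try exact: blim_cvg.
apply: U_all => n; rewrite /cesaro ler_wpM2r ?invr_ge0 //.
by apply: ler_sum.
Qed.

Lemma blim_le a b N : bounded_seq a -> bounded_seq b ->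
  (forall n, (N <= n)%N -> a n <= b n) -> blim a <= blim b.
Proof.
elim: N a b => [|N IH] a b ba bb ab; first by apply: blim_le_all => // n; exact: ab.
rewrite -(blim_shift ba) -(blim_shift bb).
by apply: IH => [| |n Nn]; [exact: bounded_seq_shift..|exact: ab].
Qed.

Lemma blim_sum (J : finType) (a : J -> nat -> R) :
  (forall j, bounded_seq (a j)) ->
  blim (fun n => \sum_j a j n) = \sum_j blim (a j).
Proof.
move=> ba.
pose P (r : seq J) := bounded_seq (fun n => \sum_(j <- r) a j n) /\
   blim (fun n => \sum_(j <- r) a j n) = \sum_(j <- r) blim (a j).
suff [] : P (index_enum J) by [].
elim: (index_enum J) => [|j r [Pb Pl]].
  split; rewrite ?big_nil; under eq_fun do rewrite big_nil.
    exact: bounded_seq_cst.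
  exact: blim_cst.
split; rewrite ?big_cons; under eq_fun do rewrite big_cons.
  exact: bounded_seqD.
by rewrite blimD // Pl.
Qed.

Lemma blim_dist a b c N : bounded_seq a -> bounded_seq b -> bounded_seq c ->
  (forall n, (N <= n)%N -> `|a n - b n| <= c n) -> `|blim a - blim b| <= blim c.
Proof.
move=> ba bb bc H.
have E : blim a - blim b = blim (fun n => a n + -1 * b n).
  by rewrite blimD ?blimZ ?mulN1r //; exact: bounded_seqZ.
have bE : bounded_seq (fun n => a n + -1 * b n) by apply: bounded_seqD => //; exact: bounded_seqZ.
rewrite ler_norml E; apply/andP; split.
  rewrite -(mulN1r (blim c)) -blimZ //; apply: (@blim_le _ _ N) => //; first exact: bounded_seqZ.
  by move=> n /H; rewrite ler_norml !mulN1r => /andP[].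
by apply: (@blim_le _ _ N) => // n /H; rewrite ler_norml !mulN1r => /andP[].
Qed.

End BanachLimit.

(** * Real powers and pressure *)

Section RealPowers.
Variable R : realType.
Implicit Types a b u r s t : R.

Lemma powR_le r a b : 0 <= r -> 0 <= a -> a <= b -> a `^ r <= b `^ r.
Proof. by move=> r0 a0 ab; rewrite ge0_ler_powR ?nnegrE // (le_trans a0). Qed.

Lemma powR_sqr a s : 0 <= a -> (a ^+ 2) `^ s = a `^ (2 * s).
Proof. by move=> a0; rewrite -powR_mulrn // -powRrM. Qed.

(** Bernoulli's inequality, for real exponents. *)
Lemma one_sub_powR t : 0 < t -> exists2 L : R, 0 < L &
  forall u, 0 <= u <= 1 -> 1 - u `^ t <= L * (1 - u).
Proof.
move=> t0; pose n := (Num.truncn t).+1.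
have tn : t <= n%:R by have /andP[_ /ltW] := truncn_itv (ltW t0).
exists n%:R; first by rewrite ltr0n.
move=> u /andP[u0 u1].
have bern k : 1 - u ^+ k <= k%:R * (1 - u).
  elim: k => [|k IH]; first by rewrite expr0 subrr mul0r.
  rewrite exprS -natr1 mulrDl mul1r.
  have := ler_wpM2l u0 IH; have : 0 <= k%:R * (1 - u) by rewrite mulr_ge0 ?subr_ge0.
  move: (u ^+ k) (k%:R * (1 - u)) => x y; nra.
apply: le_trans (bern n); rewrite lerD2l lerN2 -powR_mulrn //.
move: u0; rewrite le_eqVlt => /predU1P[<-|u0].
  by rewrite !powR0 ?gt_eqF // ltr0n.
by apply: ger_powR => //; rewrite u0.
Qed.

(** The exponent [s <= t] keeps the bound homogeneous of degree [t] even where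
    the power function is not Lipschitz. *)
Lemma powR_hoelder t s : 0 < s <= 1 -> s <= t -> exists2 L : R, 0 < L &
  forall M a b delta, 0 <= a <= M -> 0 <= b <= M -> 0 <= delta ->
    `|a - b| <= M * delta -> `|a `^ t - b `^ t| <= L * (M `^ t * delta `^ s).
Proof.
move=> /andP[s0 s1] st; have t0 : 0 < t by exact: lt_le_trans st.
have [L L0 HL] := one_sub_powR t0; exists L => //.
suff main M a b delta : 0 <= b -> b <= a -> a <= M -> 0 <= delta ->
    a - b <= M * delta -> a `^ t - b `^ t <= L * (M `^ t * delta `^ s).
  move=> M a b delta /andP[a0 aM] /andP[b0 bM] d0.
  case: (lerP a b) => ab.
    rewrite distrC !ger0_norm ?subr_ge0 //; last exact: powR_le (ltW t0) a0 ab.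
    exact: main.
  rewrite !ger0_norm ?subr_ge0 ?(ltW ab) //; last exact: powR_le (ltW t0) b0 (ltW ab).
  by apply: main => //; exact: ltW.
move=> b0 ba aM d0 abd.
have a0 := le_trans b0 ba; have M0 := le_trans a0 aM.
have [->|an0] := eqVneq a 0.
  rewrite powR0 ?gt_eqF // sub0r; apply: (@le_trans _ _ 0).
    by rewrite oppr_le0 powR_ge0.
  by rewrite !mulr_ge0 ?powR_ge0 // ltW.
have a1 : 0 < a by rewrite lt_def an0.
pose u := b / a.
have u01 : 0 <= u <= 1 by rewrite divr_ge0 //= ler_pdivrMr // mul1r.
have bE : b = a * u by rewrite /u mulrCA divff // mulr1.
have /andP[u0 u1] := u01.
apply: (@le_trans _ _ (L * (a `^ t * (1 - u) `^ s))).
  rewrite {1}bE powRM // -{1}[a `^ t]mulr1 -mulrBr mulrCA ler_wpM2l ?powR_ge0 //.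
  apply: le_trans (HL u u01) _; rewrite ler_wpM2l ?(ltW L0) //.
  have [->|un1] := eqVneq u 1; first by rewrite subrr powR_ge0.
  have u1' : 0 < 1 - u by rewrite subr_gt0 lt_def eq_sym un1.
  rewrite -{1}[1 - u]powRr1 ?(ltW u1') //; apply: ger_powR => //.
  by rewrite u1' gerBl.
rewrite ler_wpM2l ?(ltW L0) //.
have split c : 0 <= c -> c != 0 -> c `^ t = c `^ (t - s) * c `^ s.
  by move=> c0 cn0; rewrite -powRD ?subrK // cn0 implybT.
have Mn0 : M != 0 by rewrite gt_eqF // (lt_le_trans a1).
rewrite (split a) // (split M) // -!mulrA -!powRM // ?subr_ge0 //; last first.
apply: ler_pM; rewrite ?powR_ge0 //; first by apply: powR_le; rewrite ?subr_ge0.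
apply: powR_le; rewrite ?(ltW s0) //; first by rewrite mulr_ge0 // subr_ge0.
by rewrite mulrBr mulr1 -bE.
Qed.

End RealPowers.

(** Some coordinate of [y] has a definite size; dividing by it recovers [x] as a
    multiple [c y], up to the bivector, and [|c|] is close to one because both
    norms are one. *)
Lemma nrm_sub_sign (R : realFieldType) d (x y : 'cV[R]_d) : nrm x = 1 -> nrm y = 1 ->
  exists2 e : R, e = 1 \/ e = -1 & nrm (x - e *: y) <= 2 * d%:R * nrm (wedge x y).
Proof.
move=> x1 y1; set W := nrm _.
have [i yi] : exists i, 1 <= d%:R * `|y i 0|.
  apply/existsP; apply: contraT; rewrite negb_exists => /forallP H.
  have d0 : (0 < d)%N.
    by rewrite lt0n; apply/eqP => d0; move: y1 H; rewrite /nrm; subst d; rewrite big_ord0 => /eqP; rewrite eq_sym oner_eq0.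
  have : \sum_(i < d) d%:R * `|y i 0| < \sum_(i < d) (1 : R).
    apply: ltr_sum; first by apply/hasP; exists (Ordinal d0); rewrite ?mem_index_enum.
    by move=> i _; rewrite ltNge; exact: H.
  rewrite -mulr_sumr sumr_const card_ord.
  have -> : \sum_(i < d) `|y i 0| = nrm y by rewrite /nrm; apply: eq_bigr => i _; rewrite big_ord1.
  by rewrite y1 mulr1 ltxx.
have yi0 : y i 0 != 0 by apply: contraTneq yi => ->; rewrite normr0 mulr0 ler10.
pose c := x i 0 / y i 0.
have near : nrm (x - c *: y) <= d%:R * W.
  have : `|y i 0| * nrm (x - c *: y) <= W.
    rewrite -nrmZ; apply: (@le_trans _ _ (\sum_j `|wedge x y j i|)).
      rewrite /nrm; apply: ler_sum => j _; rewrite big_ord1 /wedge !mxE !big_ord1 !mxE.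
      rewrite le_eqVlt; apply/orP; left; apply/eqP; congr `|_|; rewrite /c; field => //.
    by rewrite /W /nrm; apply: ler_sum => j _; rewrite (bigD1 i) //= lerDl sumr_ge0.
  move=> H; apply: le_trans (ler_wpM2l (ler0n _ d) H).
  by rewrite mulrA ler_peMl ?nrm_ge0.
have cc : `|1 - `|c| | <= d%:R * W.
  apply: le_trans near; have := nrm_dist x (c *: y).
  by rewrite nrmZ x1 y1 mulr1.
have [e e1 ce] : exists2 e : R, e = 1 \/ e = -1 & `|c - e| = `|1 - `|c| |.
  have [c0|c0] := lerP 0 c; [exists 1; first by left|exists (-1); first by right].
    by rewrite distrC (ger0_norm c0).
  by rewrite (ltr0_norm c0) !opprK addrC.
exists e => //.
have -> : x - e *: y = (x - c *: y) + (c - e) *: y by rewrite scalerBl addrA subrK.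
apply: le_trans (nrmD _ _) _; rewrite nrmZ y1 mulr1 ce; lra.
Qed.

Section WordSums.
Variables (R : realType) (d' : nat) (I : finType).
Notation d := d'.+1.
Variables (A : I -> 'M[R]_d) (t : R).
Hypothesis t0 : 0 < t.

Definition nrm_pow m n (X : 'M[R]_(m, n)) : R := nrm X `^ t.

Lemma nrm_pow_ge0 m n (X : 'M[R]_(m, n)) : 0 <= nrm_pow X.
Proof. exact: powR_ge0. Qed.

Lemma nrm_powM m n p (X : 'M[R]_(m, n)) (Y : 'M[R]_(n, p)) : nrm_pow (X *m Y) <= nrm_pow X * nrm_pow Y.
Proof.
by rewrite /nrm_pow -powRM ?nrm_ge0 //; apply: powR_le; rewrite ?nrm_ge0 ?(ltW t0) ?nrmM.
Qed.

Lemma nrm_pow_gt0 m n (X : 'M[R]_(m, n)) : X != 0 -> 0 < nrm_pow X.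
Proof. by move=> X0; rewrite powR_gt0 // nrm_gt0. Qed.

Lemma nrm_powZ m n a (X : 'M[R]_(m, n)) : nrm_pow (a *: X) = `|a| `^ t * nrm_pow X.
Proof. by rewrite /nrm_pow nrmZ powRM ?nrm_ge0. Qed.

Definition word_sum n := \sum_(w : n.-tuple I) nrm_pow (mxw A w).

Definition sandwich_sum n p q (U : 'M[R]_(p, d)) (X : 'M[R]_(d, q)) :=
  \sum_(w : n.-tuple I) nrm_pow (U *m mxw A w *m X).

Lemma sandwich_ge0 n p q (U : 'M[R]_(p, d)) (X : 'M[R]_(d, q)) : 0 <= sandwich_sum n U X.
Proof. by apply: sumr_ge0 => w _; exact: nrm_pow_ge0. Qed.

Lemma sandwich_le_word_sum n p q (U : 'M[R]_(p, d)) (X : 'M[R]_(d, q)) : sandwich_sum n U X <= nrm_pow U * word_sum n * nrm_pow X.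
Proof.
rewrite /sandwich_sum /word_sum mulr_sumr mulr_suml; apply: ler_sum => w _.
by apply: le_trans (nrm_powM _ _) _; rewrite ler_wpM2r ?nrm_pow_ge0 // nrm_powM.
Qed.

Lemma sandwich_cat m n p q (U : 'M[R]_(p, d)) (X : 'M[R]_(d, q)) :
  sandwich_sum (m + n) U X = \sum_(u : m.-tuple I) sandwich_sum n (U *m mxw A u) X.
Proof.
rewrite /sandwich_sum (sum_word_cat _ _ (fun w => nrm_pow (U *m mxw A w *m X))).
apply: eq_bigr => u _; apply: eq_bigr => v _; by rewrite mxw_cat !mulmxA.
Qed.

Lemma sandwich_consl n p q (U : 'M[R]_(p, d)) (X : 'M[R]_(d, q)) :
  sandwich_sum n.+1 U X = \sum_i sandwich_sum n (U *m A i) X.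
Proof.
rewrite /sandwich_sum (sum_word_cons _ (fun w => nrm_pow (U *m mxw A w *m X))).
by apply: eq_bigr => i _; apply: eq_bigr => w _; rewrite /= !mulmxA.
Qed.

Lemma sandwich_consr n p q (U : 'M[R]_(p, d)) (X : 'M[R]_(d, q)) :
  sandwich_sum n.+1 U X = \sum_i sandwich_sum n U (A i *m X).
Proof.
rewrite /sandwich_sum (sum_word_rcons _ (fun w => nrm_pow (U *m mxw A w *m X))) exchange_big.
by apply: eq_bigr => i _; apply: eq_bigr => w _; rewrite mxw_rcons !mulmxA.
Qed.

Lemma word_sumM m n : word_sum (m + n) <= word_sum m * word_sum n.
Proof.
rewrite /word_sum (sum_word_cat _ _ (fun w => nrm_pow (mxw A w))) mulr_suml.
apply: ler_sum => u _; rewrite mulr_sumr; apply: ler_sum => v _.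
by rewrite mxw_cat nrm_powM.
Qed.

Lemma connecting_sum : connecting A -> exists l (K : R), 0 < K /\
  forall p q (U : 'M[R]_(p, d)) (X : 'M[R]_(d, q)), nrm_pow U * nrm_pow X <= K * sandwich_sum l U X.
Proof.
move=> [l [c [c0 H]]]; exists l, (c `^ t)^-1; split; first by rewrite invr_gt0 powR_gt0.
move=> p q U X; have [k sk Hk] := H p q U X.
rewrite ler_pdivlMl ?powR_gt0 //.
apply: le_trans (word_le_sum sk (fun w => nrm_pow_ge0 (U *m mxw A w *m X))).
rewrite /nrm_pow -!powRM ?mulr_ge0 ?nrm_ge0 ?(ltW c0) //.
rewrite mulrA; apply: powR_le => //; first exact: ltW.
by rewrite !mulr_ge0 ?nrm_ge0 ?(ltW c0).
Qed.

(** The sums over words are submultiplicative, and connecting words make them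
    supermultiplicative up to a constant; their logarithms are therefore linear
    up to a bounded error. *)
Lemma pressure : connecting A -> (forall n, 0 < word_sum n) ->
  exists C P : R, 0 < C /\
    forall n, expR (n%:R * P) <= word_sum n <= C * expR (n%:R * P).
Proof.
move=> /connecting_sum[l [K [K0 HK]]] Z0.
pose c := Num.min 1 (K * word_sum l)^-1.
have c0 : 0 < c by rewrite lt_min ltr01 invr_gt0 mulr_gt0.
have c1 : c <= 1 by rewrite ge_min lexx.
have Zsup m n : c * word_sum m * word_sum n <= word_sum (m + n).
  have cK : c <= (K * word_sum l)^-1 by rewrite ge_min lexx orbT.
  rewrite -mulrA; apply: le_trans (ler_wpM2r _ cK) _; first by rewrite mulr_ge0 ?(ltW (Z0 _)).
  rewrite ler_pdivrMl ?mulr_gt0 //.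
  have H : word_sum m * word_sum n <= K * word_sum (m + (l + n)).
    rewrite /word_sum mulr_suml (sum_word_cat _ _ (fun w => nrm_pow (mxw A w))) mulr_sumr.
    apply: ler_sum => u _; rewrite (sum_word_cat _ _ (fun w => nrm_pow (mxw A (u ++ w)))).
    rewrite exchange_big !mulr_sumr; apply: ler_sum => v _.
    apply: le_trans (HK _ _ (mxw A u) (mxw A v)) _; rewrite /sandwich_sum ler_wpM2l ?(ltW K0) //.
    by apply: ler_sum => k _; rewrite !mxw_cat !mulmxA.
  apply: le_trans H _; rewrite -mulrA ler_wpM2l ?(ltW K0) //.
  by rewrite addnCA; exact: word_sumM.
have sup_pow n m : (c * word_sum n) ^+ m.+1 <= c * word_sum (n * m.+1).
  elim: m => [|m IH]; first by rewrite expr1 muln1.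
  rewrite exprS mulnS; apply: le_trans (ler_wpM2l _ IH) _; first by rewrite mulr_ge0 ?ltW.
  have := Zsup n (n * m.+1)%N; rewrite -(ler_pM2l c0); apply: le_trans.
  by rewrite le_eqVlt; apply/orP; left; apply/eqP; ring.
have sub_pow n m : word_sum (n * m.+1) <= word_sum n ^+ m.+1.
  elim: m => [|m IH]; first by rewrite expr1 muln1.
  rewrite exprS mulnS; apply: le_trans (word_sumM _ _) _.
  by rewrite ler_wpM2l ?(ltW (Z0 _)).
have compare n m : ln (c * word_sum n.+1) / n.+1%:R <= ln (word_sum m.+1) / m.+1%:R.
  rewrite ler_pdivrMr ?ltr0n // mulrAC ler_pdivlMr ?ltr0n //.
  have E (x : R) k : 0 < x -> ln x * k%:R = ln (x ^+ k).
    by move=> x0; rewrite lnXn // mulr_natr.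
  rewrite !E ?mulr_gt0 // ler_ln ?posrE ?exprn_gt0 ?mulr_gt0 //.
  apply: le_trans (sup_pow n.+1 m) _; apply: le_trans (_ : word_sum (n.+1 * m.+1) <= _).
    by rewrite ler_piMl // ltW.
  by rewrite mulnC; exact: sub_pow.
pose S := [set ln (c * word_sum n.+1) / n.+1%:R | n in setT].
have Sne : S !=set0 by exists (ln (c * word_sum 1) / 1); exists 0%N.
have Sub m : ubound S (ln (word_sum m.+1) / m.+1%:R) by move=> _ [n _ <-]; exact: compare.
have Z01 : 1 <= word_sum 0.
  rewrite /word_sum (sum_word0 (fun w => nrm_pow (mxw A w))) /nrm_pow /= nrm_id.
  have d1 : 1 <= d%:R :> R by rewrite ler1n.
  by have := ler_powR d1 (ltW t0); rewrite powRr0.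
exists (Num.max (word_sum 0) c^-1), (sup S); split; first by rewrite lt_max Z0.
case=> [|n]; first by rewrite mul0r expR0 mulr1 Z01 le_max lexx.
apply/andP; split.
  rewrite -[leRHS]lnK ?posrE // ler_expR mulrC -ler_pdivlMr ?ltr0n //.
  exact: ge_sup.
apply: (@le_trans _ _ (c^-1 * expR (n.+1%:R * sup S))).
  rewrite ler_pdivlMl // -[leLHS]lnK ?posrE ?mulr_gt0 // ler_expR.
  have supS : has_sup S by split => //; exists (ln (word_sum 1) / 1); exact: Sub 0%N.
  rewrite (mulrC _ (sup S)) -ler_pdivrMr ?ltr0n //; apply: (sup_upper_bound supS).
  by exists n.
by rewrite ler_wpM2r ?expR_ge0 // le_max lexx orbT.
Qed.

End WordSums.

(** * Bivectors along typical words *)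

(** The induction step of a decay of mass: [y] is the part of the mass [x] on
    which the small bound [e] already holds, [p] the least share of that part. *)
Lemma decay_step (R : realFieldType) (a b x y q p e : R) :
  a <= e * y -> b <= (e + q) * (x - y) -> q * (p * x) <= q * y ->
  a + b <= (e + (1 - p) * q) * x.
Proof.
move=> H1 H2 H3; have := lerD (lerD H1 H2) H3; rewrite -subr_ge0 => hsum.
rewrite -subr_ge0; apply: le_trans hsum _; rewrite le_eqVlt; apply/orP; left.
by apply/eqP; ring.
Qed.

Section Normalized.
Variables (R : realType) (d' : nat) (I : finType).
Notation d := d'.+1.
Variables (A : I -> 'M[R]_d) (t : R).
Hypothesis t0 : 0 < t.
Hypothesis Ainv : forall i, A i \in unitmx.
Hypotheses (conn : connecting A) (pinch : pinching A).
Variable C0 : R.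
Hypothesis Zbd : forall n, 1 <= word_sum A t n <= C0.

Local Notation nt := (nrm_pow t).
Local Notation sandwich := (sandwich_sum A t).
Local Notation wsum := (word_sum A t).
Local Notation mxw := (mxw A).

Let C00 : 0 < C0.
Proof. by have /andP[a b] := Zbd 0; apply: lt_le_trans b; apply: lt_le_trans a. Qed.

Let Z_ge1 n : 1 <= wsum n. Proof. by have /andP[] := Zbd n. Qed.
Let Z_le n : wsum n <= C0. Proof. by have /andP[] := Zbd n. Qed.

Lemma mxw_neq0 w : mxw w != 0.
Proof.
apply/eqP => w0; have := mxw_unit Ainv w; rewrite w0 unitmxE det0.
by rewrite unitr0.
Qed.

Lemma sandwich_le n p q (U : 'M[R]_(p, d)) (X : 'M[R]_(d, q)) :
  sandwich n U X <= C0 * (nt U * nt X).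
Proof.
apply: le_trans (sandwich_le_word_sum _ t0 _ _ _) _; rewrite mulrAC mulrC.
by rewrite ler_wpM2r // mulr_ge0 ?nrm_pow_ge0.
Qed.

Lemma sandwich_bounded p q (U : 'M[R]_(p, d)) (X : 'M[R]_(d, q)) :
  bounded_seq (fun n => sandwich n U X).
Proof.
by exists (C0 * (nt U * nt X)) => n; rewrite ger0_norm ?sandwich_ge0 ?sandwich_le.
Qed.

(** Connecting words are inserted on both sides of a word of arbitrary length. *)
Lemma sandwich_ge : exists N (c1 : R), 0 < c1 /\ forall n, (N <= n)%N ->
  forall p q (U : 'M[R]_(p, d)) (X : 'M[R]_(d, q)), c1 * (nt U * nt X) <= sandwich n U X.
Proof.
have [l [K [K0 HK]]] := connecting_sum t0 conn.
exists (l + l)%N, (K ^- 2); split; first by rewrite invr_gt0 exprn_gt0.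
move=> n ln p q U X.
have -> : n = (l + ((n - (l + l)) + l))%N by lia.
rewrite ler_pdivrMl ?exprn_gt0 // expr2 -mulrA.
set j := (n - (l + l))%N.
have -> : sandwich (l + (j + l)) U X =
    \sum_(w : j.-tuple I) \sum_(k : l.-tuple I) sandwich l U (mxw w *m mxw k *m X).
  rewrite sandwich_cat.
  under eq_bigr => u _ do rewrite /sandwich_sum (sum_word_cat _ _ (fun w => nt (U *m mxw u *m mxw w *m X))).
  rewrite exchange_big; apply: eq_bigr => w _; rewrite exchange_big.
  apply: eq_bigr => k _; apply: eq_bigr => u _.
  by rewrite mxw_cat !mulmxA.
apply: (@le_trans _ _ (K * \sum_(w : j.-tuple I) nt U * sandwich l (mxw w) X)); last first.
  rewrite ler_wpM2l ?(ltW K0) // [leRHS]mulr_sumr; apply: ler_sum => w _.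
  rewrite /sandwich_sum mulr_sumr mulr_sumr; apply: ler_sum => k _; exact: HK.
rewrite mulr_sumr; apply: (@le_trans _ _ (\sum_(w : j.-tuple I) nt U * (nt (mxw w) * nt X))).
  rewrite -mulr_sumr -mulr_suml; apply: ler_wpM2l; first exact: nrm_pow_ge0.
  by rewrite ler_peMl ?nrm_pow_ge0 // Z_ge1.
by apply: ler_sum => w _; rewrite [leRHS]mulrCA ler_wpM2l ?nrm_pow_ge0.
Qed.

(** The total weight of all the words inserted between [U] and [X]; exactly
    invariant under absorbing one letter on either side. *)
Definition limit_form p q (U : 'M[R]_(p, d)) (X : 'M[R]_(d, q)) := blim (fun n => sandwich n U X).

Lemma limit_form_consl p q (U : 'M[R]_(p, d)) (X : 'M[R]_(d, q)) :
  \sum_i limit_form (U *m A i) X = limit_form U X.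
Proof.
rewrite /limit_form -blim_sum; last by move=> i; exact: sandwich_bounded.
rewrite -(blim_shift (sandwich_bounded U X)).
by congr blim; apply/funext => n; rewrite sandwich_consl.
Qed.

Lemma limit_form_consr p q (U : 'M[R]_(p, d)) (X : 'M[R]_(d, q)) :
  \sum_i limit_form U (A i *m X) = limit_form U X.
Proof.
rewrite /limit_form -blim_sum; last by move=> i; exact: sandwich_bounded.
rewrite -(blim_shift (sandwich_bounded U X)).
by congr blim; apply/funext => n; rewrite sandwich_consr.
Qed.

Lemma limit_form_wordl n p q (U : 'M[R]_(p, d)) (X : 'M[R]_(d, q)) :
  \sum_(w : n.-tuple I) limit_form (U *m mxw w) X = limit_form U X.
Proof.
elim: n U => [|n IH] U.
  by rewrite (sum_word0 (fun w => limit_form (U *m mxw w) X)) mulmx1.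
rewrite (sum_word_cons _ (fun w => limit_form (U *m mxw w) X)) -[RHS]limit_form_consl.
by apply: eq_bigr => i _; rewrite -[RHS]IH; apply: eq_bigr => w _; rewrite /= mulmxA.
Qed.

Lemma limit_form_wordr n p q (U : 'M[R]_(p, d)) (X : 'M[R]_(d, q)) :
  \sum_(w : n.-tuple I) limit_form U (mxw w *m X) = limit_form U X.
Proof.
elim: n X => [|n IH] X.
  by rewrite (sum_word0 (fun w => limit_form U (mxw w *m X))) mul1mx.
rewrite (sum_word_rcons _ (fun w => limit_form U (mxw w *m X))) exchange_big -[RHS]limit_form_consr.
by apply: eq_bigr => i _; rewrite -[RHS]IH; apply: eq_bigr => w _; rewrite mxw_rcons mulmxA.
Qed.

Lemma limit_form_le p q (U : 'M[R]_(p, d)) (X : 'M[R]_(d, q)) : limit_form U X <= C0 * (nt U * nt X).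
Proof.
rewrite -[leRHS]blim_cst; apply: (@blim_le _ _ _ 0).
- exact: sandwich_bounded.
- exact: bounded_seq_cst.
- by move=> n _; exact: sandwich_le.
Qed.

Lemma limit_form_ge : exists2 c1 : R, 0 < c1 & forall p q (U : 'M[R]_(p, d)) (X : 'M[R]_(d, q)),
  c1 * (nt U * nt X) <= limit_form U X.
Proof.
have [N [c1 [c10 H1]]] := sandwich_ge; exists c1 => // p q U X.
rewrite -[leLHS]blim_cst; apply: (@blim_le _ _ _ N).
- exact: bounded_seq_cst.
- exact: sandwich_bounded.
- by move=> n Nn; exact: H1.
Qed.

Lemma limit_formZr p q (U : 'M[R]_(p, d)) (X : 'M[R]_(d, q)) a :
  limit_form U (a *: X) = `|a| `^ t * limit_form U X.
Proof.
rewrite /limit_form -blimZ; last exact: sandwich_bounded.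
congr blim; apply/funext => n; rewrite /sandwich_sum mulr_sumr; apply: eq_bigr => w _.
by rewrite -scalemxAr nrm_powZ.
Qed.

Section Gap.

(** The total mass of the continuations of the prefix [U]. *)
Let m p (U : 'M[R]_(p, d)) := limit_form U (1%:M : 'M[R]_d).

Let D := nt (1%:M : 'M[R]_d).
Let D0 : 0 < D. Proof. by rewrite nrm_pow_gt0 // oner_neq0. Qed.

Let m_ge0 p (U : 'M[R]_(p, d)) : 0 <= m U.
Proof.
by have [c1 c10 h] := limit_form_ge; apply: le_trans (h _ _ U 1%:M); rewrite !mulr_ge0 ?nrm_pow_ge0 ?(ltW c10).
Qed.

Definition pair_const : R := 2 * d%:R ^+ 2.
Let pair_const_gt0 : 0 < pair_const. Proof. by rewrite mulr_gt0 // exprn_gt0 // ltr0n. Qed.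

Definition unpinched (delta : R) (U : 'M[R]_d) := delta * nrm U ^+ 2 < ext2 U.

Let F delta n (U : 'M[R]_d) : R :=
  \sum_(w : n.-tuple I | unpinched delta (U *m mxw w)) m (U *m mxw w).

Let F_le delta n U : F delta n U <= m U.
Proof.
rewrite /F /m -(limit_form_wordl n U) [leRHS](bigID (fun w : n.-tuple I => unpinched delta (U *m mxw w))) /=.
by rewrite lerDl; apply: sumr_ge0 => w _; exact: m_ge0.
Qed.

(** Once a prefix is strongly pinched, the whole word stays pinched unless a
    cancellation occurs in the product, which is unlikely. *)
Let pinched_prefix : exists2 C : R, 0 < C & forall delta delta' e n U, 0 < e ->
  0 <= delta' -> delta' * pair_const <= delta * e ^+ 2 ->
  ext2 U <= delta' * nrm U ^+ 2 -> F delta n U <= C * e `^ t * m U.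
Proof.
have [c1 c10 h] := limit_form_ge.
exists (C0 * D * C0 / (c1 * D)); first by rewrite divr_gt0 ?mulr_gt0.
move=> delta delta' e n U e0 d'0 dd' Up.
have small w : unpinched delta (U *m mxw w) -> m (U *m mxw w) <= C0 * D * (e `^ t * (nt U * nt (mxw w))).
  rewrite /unpinched => bad.
  have lt : nrm (U *m mxw w) <= e * (nrm U * nrm (mxw w)).
    have delta0 : 0 < delta.
      have : 0 <= delta * e ^+ 2 by apply: le_trans dd'; rewrite mulr_ge0 // ltW.
      rewrite pmulr_lge0 ?exprn_gt0 // le_eqVlt => /predU1P[d0|//].
      move: dd' bad; rewrite -d0 !mul0r => dd' bad.
      have d'00 : delta' = 0 by apply/eqP; rewrite eq_le d'0 andbT -(pmulr_lle0 _ pair_const_gt0).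
      have := lt_le_trans bad (ext2M _ _); move: Up; rewrite d'00 mul0r => Up.
      have -> : ext2 U = 0 by apply/eqP; rewrite eq_le Up ext2_ge0.
      by rewrite mul0r ltxx.
    have H1 : delta * nrm (U *m mxw w) ^+ 2 <= delta * (e * (nrm U * nrm (mxw w))) ^+ 2.
      apply: ltW; apply: lt_le_trans bad _; apply: le_trans (ext2M _ _) _.
      apply: (@le_trans _ _ (delta' * nrm U ^+ 2 * (pair_const * nrm (mxw w) ^+ 2))).
        by apply: ler_pM; rewrite ?ext2_ge0 //; exact: ext2_le.
      rewrite (_ : _ * _ = delta' * pair_const * (nrm U * nrm (mxw w)) ^+ 2); last by ring.
      rewrite [leRHS](_ : _ = delta * e ^+ 2 * (nrm U * nrm (mxw w)) ^+ 2); last by ring.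
      by rewrite ler_wpM2r // sqr_ge0.
    by move: H1; rewrite ler_pM2l // ler_pXn2r ?nnegrE ?mulr_ge0 ?nrm_ge0 ?(ltW e0).
  apply: le_trans (limit_form_le _ _) _; rewrite -/D.
  rewrite [leLHS](_ : _ = C0 * D * nt (U *m mxw w)); last by ring.
  rewrite ler_wpM2l ?mulr_ge0 ?(ltW C00) ?(ltW D0) //.
  rewrite /nrm_pow -!powRM ?mulr_ge0 ?nrm_ge0 ?(ltW e0) //; apply: powR_le; rewrite ?nrm_ge0 ?(ltW t0) //.
apply: (@le_trans _ _ (\sum_(w : n.-tuple I) C0 * D * (e `^ t * (nt U * nt (mxw w))))).
  rewrite /F big_mkcond /=; apply: ler_sum => w _; case: ifP => [/small //|_].
  by rewrite !mulr_ge0 ?nrm_pow_ge0 ?powR_ge0 ?(ltW C00) ?(ltW D0).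
rewrite -!mulr_sumr -/(word_sum A t n).
apply: (@le_trans _ _ (C0 * D * (e `^ t * (nt U * C0)))).
  by rewrite !ler_wpM2l ?mulr_ge0 ?nrm_pow_ge0 ?powR_ge0 ?(ltW C00) ?(ltW D0) // Z_le.
have := h _ _ U (1%:M : 'M[R]_d); rewrite -/(m U) -/D => hU.
rewrite [leRHS](_ : _ = C0 * D * (e `^ t * ((m U / (c1 * D)) * C0))); last first.
  by field; rewrite !gt_eqF.
rewrite !ler_wpM2l ?mulr_ge0 ?nrm_pow_ge0 ?powR_ge0 ?(ltW C00) ?(ltW D0) //.
rewrite ler_wpM2r ?(ltW C00) // ler_pdivlMr ?mulr_gt0 //.
by rewrite mulrCA.
Qed.

Let ext2_word_bound l : exists2 E : R, 0 < E & forall k, size k = l -> ext2 (mxw k) <= E.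
Proof.
exists (\sum_(k : l.-tuple I) ext2 (mxw k) + 1).
  by rewrite ltr_wpDl // sumr_ge0 // => k _; exact: ext2_ge0.
move=> k sk; have := word_le_sum sk (fun w => ext2_ge0 (mxw w)).
by move=> /le_trans; apply; rewrite lerDl.
Qed.

(** A connecting word followed by a pinching word strongly pinches any prefix,
    and the mass of this continuation is a definite share. *)
Let pinched_extension delta : 0 < delta -> exists L (p : R), 0 < p <= 1 /\
  forall U, exists k, [/\ size k = L, p * m U <= m (U *m mxw k) &
    ext2 (U *m mxw k) <= delta * nrm (U *m mxw k) ^+ 2].
Proof.
move=> delta0; have [c1 c10 h] := limit_form_ge; have [l [c [c0 Hc]]] := conn.
have [E E0 HE] := ext2_word_bound l.
have [|w Hw] := pinch (_ : 0 < delta * c ^+ 2 / (pair_const * E)).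
  by rewrite divr_gt0 ?mulr_gt0 ?exprn_gt0.
have nw0 : 0 < nt (mxw w) by rewrite nrm_pow_gt0 // mxw_neq0.
exists (l + size w)%N, (Num.min 1 (c1 * (c `^ t * nt (mxw w)) / C0)); split.
  by rewrite lt_min ltr01 ge_min lexx /= andbT divr_gt0 // !mulr_gt0 // powR_gt0.
move=> U; have [k1 s1 Hk1] := Hc _ _ U (mxw w).
have nUk : 0 <= c * nrm U * nrm (mxw w) by rewrite !mulr_ge0 ?nrm_ge0 ?(ltW c0).
exists (k1 ++ w); split; first by rewrite size_cat s1.
  rewrite mxw_cat mulmxA; apply: le_trans (h _ _ _ _); rewrite -/D.
  apply: (@le_trans _ _ (c1 * (c `^ t * nt (mxw w)) / C0 * m U)).
    by rewrite ler_wpM2r ?m_ge0 // ge_min lexx orbT.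
  rewrite mulrAC ler_pdivrMr //.
  apply: (@le_trans _ _ (c1 * (c `^ t * nt (mxw w)) * (C0 * (nt U * D)))).
    by rewrite ler_wpM2l ?limit_form_le // !mulr_ge0 ?powR_ge0 ?nrm_pow_ge0 ?(ltW c10).
  rewrite [leLHS](_ : _ = c1 * ((c `^ t * nt U * nt (mxw w)) * D) * C0); last by ring.
  rewrite ler_wpM2r ?(ltW C00) // ler_wpM2l ?(ltW c10) // ler_wpM2r ?(ltW D0) //.
  rewrite /nrm_pow -!powRM ?mulr_ge0 ?nrm_ge0 ?(ltW c0) //; exact: powR_le (ltW t0) _ _.
rewrite mxw_cat mulmxA.
apply: (@le_trans _ _ (delta * (c * nrm U * nrm (mxw w)) ^+ 2)); last first.
  by rewrite ler_wpM2l ?(ltW delta0) // ler_pXn2r ?nnegrE ?nrm_ge0.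
apply: le_trans (ext2M _ _) _.
apply: (@le_trans _ _ (pair_const * nrm U ^+ 2 * E * (delta * c ^+ 2 / (pair_const * E) * nrm (mxw w) ^+ 2))).
  apply: ler_pM; rewrite ?ext2_ge0 //; apply: le_trans (ext2M _ _) _.
  by apply: ler_pM; rewrite ?ext2_ge0 ?HE //; exact: ext2_le.
by rewrite le_eqVlt; apply/orP; left; apply/eqP; field; rewrite !gt_eqF.
Qed.

(** In each period of length [L] a share [p] of the remaining mass becomes
    strongly pinched, and by [pinched_prefix] nearly all of it stays pinched. *)
Let unpinched_decay delta eta : 0 < delta -> 0 < eta ->
  exists n, forall U, F delta n U <= eta * m U.
Proof.
move=> delta0 eta0; have [C CC HC] := pinched_prefix.
pose e := (eta / (2 * C)) `^ t^-1.
have e0 : 0 < e by rewrite powR_gt0 // divr_gt0 ?mulr_gt0.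
have et : C * e `^ t = eta / 2.
  rewrite /e -powRrM mulVf ?gt_eqF // powRr1 ?divr_ge0 ?mulr_ge0 ?(ltW CC) ?(ltW eta0) //.
  by field; rewrite gt_eqF.
pose delta' := delta * e ^+ 2 / pair_const.
have d'0 : 0 < delta' by rewrite divr_gt0 ?mulr_gt0 ?exprn_gt0.
have [L [p [/andP[p0 p1] ext]]] := pinched_extension d'0.
have key J U : F delta (J * L) U <= (eta / 2 + (1 - p) ^+ J) * m U.
  elim: J U => [|J IH] U.
    apply: le_trans (F_le _ _ _) _; rewrite expr0 ler_peMl ?m_ge0 //.
    by rewrite lerDr divr_ge0 // ltW.
  have [k [sk k1 k2]] := ext U.
  have -> : F delta (J.+1 * L) U = \sum_(u : L.-tuple I) F delta (J * L) (U *m mxw u).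
    rewrite /F mulSn big_mkcond /=.
    rewrite (sum_word_cat _ _ (fun w => if unpinched delta (U *m mxw w) then m (U *m mxw w) else 0)).
    apply: eq_bigr => u _; rewrite [RHS]big_mkcond; apply: eq_bigr => v _.
    by rewrite mxw_cat mulmxA.
  move/eqP: sk => sk.
  have mU : m U = m (U *m mxw k) + \sum_(u : L.-tuple I | u != Tuple sk) m (U *m mxw u).
    by rewrite /m -[LHS](limit_form_wordl L) (bigD1 (Tuple sk)).
  rewrite (bigD1 (Tuple sk)) //=.
  have rest : \sum_(u : L.-tuple I | u != Tuple sk) F delta (J * L) (U *m mxw u) <=
      (eta / 2 + (1 - p) ^+ J) * (m U - m (U *m mxw k)).
    rewrite mU [m _ + _]addrC addrK mulr_sumr; apply: ler_sum => u _; exact: IH.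
  have first : F delta (J * L) (U *m mxw k) <= eta / 2 * m (U *m mxw k).
    rewrite -et; apply: (HC _ _ _ _ _ e0 (ltW d'0) _ k2).
    by rewrite /delta' divfK // gt_eqF.
  have qJ : 0 <= (1 - p) ^+ J by rewrite exprn_ge0 // subr_ge0.
  by rewrite exprS; exact: decay_step first rest (ler_wpM2l qJ k1).
have q01 : 0 <= 1 - p < 1 by rewrite subr_ge0 p1 ltrBlDr ltrDl.
have [J HJ] := geometric_small 1 q01 (divr_gt0 eta0 (ltr0n R 2)).
exists (J * L)%N => U; apply: le_trans (key J U) _; rewrite ler_wpM2r ?m_ge0 //.
by have := HJ J (leqnn J); rewrite mul1r; lra.
Qed.

Section ExteriorSums.
Variable s : R.
Hypotheses (s0 : 0 < s) (st : 2 * s <= t).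

(** The factor by which the Hoelder constant is multiplied under [n] steps of the
    transfer operator: the projective distance is contracted by [ext2] divided
    by the square of the norm. *)
Definition ext_sum n := \sum_(w : n.-tuple I) nrm (mxw w) `^ (t - 2 * s) * ext2 (mxw w) `^ s.

Let ext_sum_ge0 n : 0 <= ext_sum n.
Proof. by apply: sumr_ge0 => w _; rewrite mulr_ge0 ?powR_ge0. Qed.

Let st0 : 0 <= t - 2 * s. Proof. by rewrite subr_ge0. Qed.

Let ext_sumM m' n : ext_sum (m' + n) <= ext_sum m' * ext_sum n.
Proof.
rewrite /ext_sum (sum_word_cat _ _ (fun w => nrm (mxw w) `^ (t - 2 * s) * ext2 (mxw w) `^ s)).
rewrite mulr_suml; apply: ler_sum => u _; rewrite mulr_sumr; apply: ler_sum => v _.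
rewrite mxw_cat mulrACA -!powRM ?nrm_ge0 ?ext2_ge0 //; apply: ler_pM; rewrite ?powR_ge0 //.
  by apply: powR_le; rewrite ?nrm_ge0 ?nrmM.
by apply: powR_le; rewrite ?ext2_ge0 ?ext2M ?(ltW s0).
Qed.

Let ext_term kappa (X : 'M[R]_d) : 0 <= kappa -> ext2 X <= kappa * nrm X ^+ 2 ->
  nrm X `^ (t - 2 * s) * ext2 X `^ s <= kappa `^ s * nt X.
Proof.
move=> k0 Xk; apply: (@le_trans _ _ (nrm X `^ (t - 2 * s) * (kappa `^ s * nrm X `^ (2 * s)))).
  rewrite ler_wpM2l ?powR_ge0 // -powR_sqr ?nrm_ge0 // -powRM ?sqr_ge0 //.
  by apply: powR_le; rewrite ?ext2_ge0 ?(ltW s0).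
rewrite mulrCA ler_wpM2l ?powR_ge0 //.
have [->|X0] := eqVneq (nrm X) 0.
  by rewrite (powR0 (x := 2 * s)) ?mulr0 ?powR_ge0 // gt_eqF // mulr_gt0.
by rewrite -powRD ?subrK // X0 implybT.
Qed.

(** Pinched words contribute a small factor, unpinched ones have a small mass. *)
Let ext_sum_half : exists n, ext_sum n <= 2^-1.
Proof.
have [c1 c10 h] := limit_form_ge.
pose delta := (4 * C0)^-1 `^ s^-1.
have delta0 : 0 < delta by rewrite powR_gt0 // invr_gt0 mulr_gt0.
have ds : delta `^ s * C0 = 4^-1.
  rewrite /delta -powRrM mulVf ?gt_eqF // powRr1 ?invr_ge0 ?mulr_ge0 ?(ltW C00) //.
  by field; rewrite gt_eqF.
pose eta := c1 / (4 * pair_const `^ s * C0 * D).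
have eta0 : 0 < eta by rewrite divr_gt0 // !mulr_gt0 // powR_gt0.
have [n Hn] := unpinched_decay delta0 eta0; exists n.
rewrite /ext_sum (bigID (fun w : n.-tuple I => unpinched delta (mxw w))) /=.
have -> : 2^-1 = 4^-1 + 4^-1 :> R by lra.
apply: lerD.
  have := Hn 1%:M; have -> : F delta n 1%:M =
      \sum_(w : n.-tuple I | unpinched delta (mxw w)) m (mxw w).
    by apply: eq_big => w; rewrite mul1mx.
  move=> H1.
  apply: (@le_trans _ _ (\sum_(w : n.-tuple I | unpinched delta (mxw w)) (pair_const `^ s / (c1 * D)) * m (mxw w))).
    apply: ler_sum => w _; apply: le_trans (ext_term (ltW pair_const_gt0) (ext2_le _)) _.
    rewrite -mulrA; apply: ler_wpM2l; first exact: powR_ge0.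
    have cD0 : 0 < c1 * D by rewrite mulr_gt0.
    by rewrite ler_pdivlMl // -mulrA (mulrC D); exact: h.
  rewrite -mulr_sumr; apply: le_trans (ler_wpM2l _ H1) _.
    by rewrite divr_ge0 ?powR_ge0 ?mulr_ge0 ?(ltW c10) ?(ltW D0).
  apply: (@le_trans _ _ (pair_const `^ s / (c1 * D) * (eta * (C0 * (D * D))))).
    rewrite ler_wpM2l ?divr_ge0 ?powR_ge0 ?mulr_ge0 ?(ltW c10) ?(ltW D0) //.
    by rewrite ler_wpM2l ?(ltW eta0) ?limit_form_le.
  rewrite le_eqVlt; apply/orP; left; apply/eqP; rewrite /eta; field.
  by rewrite !gt_eqF //; exact: powR_gt0.
apply: (@le_trans _ _ (\sum_(w : n.-tuple I) delta `^ s * nt (mxw w))).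
  rewrite big_mkcond /=; apply: ler_sum => w _; case: ifP => [|_].
    by rewrite /unpinched -leNgt => /ext_term; apply; exact: ltW.
  by rewrite mulr_ge0 ?powR_ge0 ?nrm_pow_ge0.
by rewrite -mulr_sumr -ds ler_wpM2l ?powR_ge0 ?Z_le.
Qed.

(** The sums are submultiplicative, so one value below one half suffices. *)
Lemma ext_sum_small e : 0 < e -> exists N, forall n, (N <= n)%N -> ext_sum n <= e.
Proof.
move=> e0; have [n0 Hn0] := ext_sum_half.
case: n0 Hn0 => [|n0] Hn0.
  exists 0%N => n _; have := ext_sumM 0 n; rewrite add0n.
  have := ler_wpM2r (ext_sum_ge0 n) Hn0; have := ltW e0; lra.
pose B := \sum_(i < n0.+1) ext_sum i.
have half01 : 0 <= (2^-1 : R) < 1 by apply/andP; split; lra.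
have [J HJ] := geometric_small B half01 e0.
exists (J * n0.+1)%N => n Jn.
have pow j i : ext_sum (j * n0.+1 + i) <= 2^-1 ^+ j * ext_sum i.
  elim: j => [|j IH]; first by rewrite mul1r.
  rewrite mulSn -addnA exprS -mulrA; apply: le_trans (ext_sumM _ _) _.
  by apply: ler_pM.
rewrite (divn_eq n n0.+1); apply: le_trans (pow _ _) _.
apply: le_trans (HJ (n %/ n0.+1)%N _); last by rewrite leq_divRL.
rewrite mulrC; apply: ler_wpM2r; first by rewrite exprn_ge0 // invr_ge0.
have lt : (n %% n0.+1 < n0.+1)%N by rewrite ltn_mod.
rewrite /B (bigD1 (Ordinal lt)) //= lerDl; exact: sumr_ge0.
Qed.

End ExteriorSums.

End Gap.
End Normalized.

(** * The eigenfunction *)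

Section Eigenfunction.
Variables (R : realType) (d' : nat) (I : finType).
Notation d := d'.+1.
Variables (A : I -> 'M[R]_d) (t : R).
Hypothesis t0 : 0 < t.
Hypothesis Ainv : forall i, A i \in unitmx.
Hypothesis (conn : connecting A).
Variable C0 : R.
Hypothesis Zbd : forall n, 1 <= word_sum A t n <= C0.

Local Notation nt := (nrm_pow t).
Local Notation mxw := (mxw A).
Local Notation limit_form := (limit_form A t).
Implicit Types (x y : 'cV[R]_d) (f : 'cV[R]_d -> R).

Let C00 : 0 < C0.
Proof. by have /andP[a b] := Zbd 0; apply: lt_le_trans b; apply: lt_le_trans a. Qed.

Let Z_le n : word_sum A t n <= C0. Proof. by have /andP[] := Zbd n. Qed.

(** Positivity and homogeneity come from those of the norm, and invariance from
    the absorption of letters on the right. *)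
Definition eigenfun x := limit_form (1%:M : 'M[R]_d) x.

Let D := nt (1%:M : 'M[R]_d).
Let D0 : 0 < D. Proof. by rewrite nrm_pow_gt0 // oner_neq0. Qed.

Lemma eigenfun_bounds : exists a1 a2 : R, [/\ 0 < a1, 0 < a2 &
  forall x, a1 * nt x <= eigenfun x <= a2 * nt x].
Proof.
have [c1 c10 hc] := limit_form_ge t0 conn Zbd; exists (c1 * D), (C0 * D).
split; [by rewrite mulr_gt0..|move=> x; rewrite -!mulrA].
by apply/andP; split; [exact: hc|exact: (limit_form_le t0 Zbd)].
Qed.

Lemma eigenfunZ c x : eigenfun (c *: x) = `|c| `^ t * eigenfun x.
Proof. exact: (limit_formZr t0 Zbd). Qed.

Lemma eigenfun_word n x : \sum_(w : n.-tuple I) eigenfun (mxw w *m x) = eigenfun x.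
Proof. exact: (limit_form_wordr t0 Zbd). Qed.

Variable s : R.
Hypotheses (s0 : 0 < s) (s2t : 2 * s <= t) (s21 : 2 * s <= 1).

Lemma eigenfun_hoelder_near : exists2 L : R, 0 < L & forall (B : 'M[R]_d) x y delta,
  nrm x = 1 -> nrm y = 1 -> nrm (x - y) <= delta ->
  `|eigenfun (B *m x) - eigenfun (B *m y)| <= L * (nt B * delta `^ (2 * s)).
Proof.
have s201 : 0 < 2 * s <= 1 by rewrite mulr_gt0.
have [L L0 HL] := powR_hoelder s201 s2t.
exists (L * C0 * D); first by rewrite !mulr_gt0.
move=> B x y delta x1 y1 xy.
have delta0 : 0 <= delta := le_trans (nrm_ge0 _) xy.
have bT (z : 'cV[R]_d) := sandwich_bounded t0 Zbd (1%:M : 'M[R]_d) z.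
rewrite -[leRHS]blim_cst; apply: (@blim_dist _ _ _ _ 0); try exact: bT.
  exact: bounded_seq_cst.
move=> n _; rewrite /sandwich_sum -sumrB; apply: le_trans (ler_norm_sum _ _ _) _.
apply: (@le_trans _ _ (\sum_(w : n.-tuple I) L * (nt (mxw w *m B) * delta `^ (2 * s)))).
  apply: ler_sum => w _; rewrite mul1mx /nrm_pow !mulmxA.
  have le1 z : nrm z = 1 -> 0 <= nrm (mxw w *m B *m z) <= nrm (mxw w *m B).
    by move=> z1; rewrite nrm_ge0 /=; apply: le_trans (nrmM _ _) _; rewrite z1 mulr1.
  apply: HL; rewrite ?le1 //.
  apply: le_trans (nrm_dist _ _) _; rewrite -mulmxBr.
  by apply: le_trans (nrmM _ _) _; rewrite ler_wpM2l ?nrm_ge0.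
rewrite -mulr_sumr -mulr_suml.
rewrite [leRHS](_ : _ = L * (C0 * (D * nt B) * delta `^ (2 * s))); last by ring.
rewrite ler_wpM2l ?(ltW L0) // ler_wpM2r ?powR_ge0 //.
have := sandwich_le t0 Zbd n (1%:M : 'M[R]_d) B; rewrite /sandwich_sum -/D.
by under eq_bigr do rewrite mul1mx.
Qed.

(** The eigenfunction is even, so unit vectors may be compared up to sign. *)
Lemma eigenfun_hoelder : exists2 L : R, 0 < L & forall (B : 'M[R]_d) x y,
  nrm x = 1 -> nrm y = 1 ->
  `|eigenfun (B *m x) - eigenfun (B *m y)| <= L * (nt B * nrm (wedge x y) `^ s).
Proof.
have [L L0 HL] := eigenfun_hoelder_near.
exists (L * ((2 * d%:R) `^ (2 * s) * 2 `^ s)).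
  by rewrite !mulr_gt0 ?powR_gt0 ?mulr_gt0 // ltr0n.
move=> B x y x1 y1; set W := nrm _.
have W0 : 0 <= W := nrm_ge0 _.
have W2 : W <= 2 by apply: le_trans (nrm_wedge _ _) _; rewrite x1 y1 !mulr1.
have [e e1 He] := nrm_sub_sign x1 y1.
have ne : `|e| = 1 by case: e1 => ->; rewrite ?normrN normr1.
have -> : eigenfun (B *m y) = eigenfun (B *m (e *: y)) by rewrite -scalemxAr eigenfunZ ne powR1 mul1r.
apply: le_trans (HL B _ _ _ x1 _ He) _; first by rewrite nrmZ ne y1 mulr1.
rewrite -[leRHS]mulrA ler_wpM2l ?(ltW L0) // [leRHS]mulrCA ler_wpM2l ?nrm_pow_ge0 //.
rewrite (powRM _ (_ : 0 <= 2 * d%:R) W0) ?mulr_ge0 // -[leRHS]mulrA.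
apply: ler_wpM2l; first exact: powR_ge0.
have -> : W `^ (2 * s) = W `^ s * W `^ s by rewrite -powR_sqr // expr2 powRM.
by rewrite ler_wpM2r ?powR_ge0 //; apply: powR_le => //; exact: ltW.
Qed.

End Eigenfunction.

(** * The transfer operator on projective space *)

Section Transfer.
Variables (R : realType) (d' : nat) (I : finType).
Notation d := d'.+1.
Variables (A : I -> 'M[R]_d) (t : R).
Hypothesis t0 : 0 < t.
Hypothesis Ainv : forall i, A i \in unitmx.
Variable C0 : R.
Hypothesis Z_le : forall n, word_sum A t n <= C0.

Local Notation nt := (nrm_pow t).
Local Notation mxw := (mxw A).
Implicit Types (x y : 'cV[R]_d) (f : 'cV[R]_d -> R).

Variables (s : R) (h : 'cV[R]_d -> R) (a1 a2 Lh : R).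
Hypotheses (s0 : 0 < s) (s2t : 2 * s <= t).
Hypotheses (a10 : 0 < a1) (a20 : 0 < a2) (Lh0 : 0 < Lh).
Hypothesis hbd : forall x, a1 * nt x <= h x <= a2 * nt x.
Hypothesis hZ : forall c x, h (c *: x) = `|c| `^ t * h x.
Hypothesis h_word : forall n x, \sum_(w : n.-tuple I) h (mxw w *m x) = h x.
Hypothesis h_hoelder : forall (B : 'M[R]_d) x y, nrm x = 1 -> nrm y = 1 ->
  `|h (B *m x) - h (B *m y)| <= Lh * (nt B * nrm (wedge x y) `^ s).

Let C00 : 0 < C0.
Proof.
apply: lt_le_trans (Z_le 0); rewrite /word_sum (sum_word0 (fun w => nt (mxw w))).
by rewrite nrm_pow_gt0 // oner_neq0.
Qed.

Lemma h_le x : h x <= a2 * nt x. Proof. by have /andP[] := hbd x. Qed.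
Lemma h_ge x : a1 * nt x <= h x. Proof. by have /andP[] := hbd x. Qed.

Lemma h_gt0 x : x != 0 -> 0 < h x.
Proof. by move=> x0; apply: lt_le_trans (h_ge x); rewrite mulr_gt0 ?nrm_pow_gt0. Qed.

Lemma h_ge0 x : 0 <= h x.
Proof. by apply: le_trans (h_ge x); rewrite mulr_ge0 ?nrm_pow_ge0 ?ltW. Qed.

Lemma mul_neq0 w x : x != 0 -> mxw w *m x != 0.
Proof.
apply: contra => /eqP wx0.
by rewrite -[x](mulKmx (mxw_unit Ainv w)) wx0 mulmx0.
Qed.

(** Transition probabilities of the normalized operator. *)
Definition weight (B : 'M[R]_d) x := h (B *m x) / h x.

Lemma weight_ge0 B x : 0 <= weight B x.
Proof. by rewrite divr_ge0 ?h_ge0. Qed.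

Lemma weight_le B x : nrm x = 1 -> weight B x <= a2 / a1 * nt (B *m x).
Proof.
move=> x1; have x0 : x != 0 by rewrite -nrm_gt0 x1 ltr01.
have h1 : a1 <= h x by apply: le_trans (h_ge x); rewrite /nrm_pow x1 powR1 mulr1.
rewrite /weight; apply: (@le_trans _ _ (a2 * nt (B *m x) / a1)); last by rewrite mulrAC.
have h0 := h_gt0 x0; apply: ler_pM; rewrite ?h_ge0 ?invr_ge0 ?h_ge0 ?h_le //.
by rewrite lef_pV2 ?posrE.
Qed.

Lemma weight_unit_hoelder : exists2 L : R, 0 < L & forall B x y, nrm x = 1 -> nrm y = 1 ->
  `|weight B x - weight B y| <= L * (nt B * nrm (wedge x y) `^ s).
Proof.
pose D := nt (1%:M : 'M[R]_d).
have D0 : 0 < D by rewrite nrm_pow_gt0 // oner_neq0.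
have [L L0 HL] : exists2 L : R, 0 < L & forall (B : 'M[R]_d) x y, nrm x = 1 -> nrm y = 1 ->
  `|h (B *m x) - h (B *m y)| <= L * (nt B * nrm (wedge x y) `^ s) by exists Lh.
exists (L / a1 + a2 * (L * D) / (a1 * a1)).
  by rewrite addr_gt0 // ?divr_gt0 ?mulr_gt0.
move=> B x y x1 y1; set W := _ `^ s.
have W0 : 0 <= W := powR_ge0 _ _.
have nz z : nrm z = 1 -> 0 < h z.
  by move=> z1; apply: h_gt0; rewrite -nrm_gt0 z1 ltr01.
have hz z : nrm z = 1 -> (h z)^-1 <= a1^-1.
  move=> z1; rewrite lef_pV2 ?posrE ?nz //.
  by apply: le_trans (h_ge z); rewrite /nrm_pow z1 powR1 mulr1.
have -> : weight B x - weight B y =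
    (h (B *m x) - h (B *m y)) * (h x)^-1 - h (B *m y) * ((h x - h y) * ((h x)^-1 * (h y)^-1)).
  by rewrite /weight; field; rewrite !gt_eqF ?nz.
apply: le_trans (ler_normB _ _) _; rewrite [leRHS]mulrDl; apply: lerD.
  rewrite normrM [`|_^-1|]ger0_norm ?invr_ge0 ?h_ge0 //.
  rewrite [leRHS](_ : _ = L * (nt B * W) * a1^-1); last by ring.
  apply: ler_pM; [exact: normr_ge0|by rewrite invr_ge0 h_ge0|exact: HL|exact: hz].
rewrite normrM ger0_norm ?h_ge0 // normrM [`|_^-1 * _|]ger0_norm ?mulr_ge0 ?invr_ge0 ?h_ge0 //.
rewrite [leRHS](_ : _ = (a2 * nt B) * ((L * (D * W)) * (a1^-1 * a1^-1))); last first.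
  by rewrite -invfM; ring.
have hB : h (B *m y) <= a2 * nt B.
  apply: le_trans (h_le _) _; rewrite ler_wpM2l ?(ltW a20) //.
  by apply: le_trans (nrm_powM t0 _ _) _; rewrite {2}/nrm_pow y1 powR1 mulr1.
have ih z : 0 <= (h z)^-1 by rewrite invr_ge0 h_ge0.
apply: ler_pM => //; [exact: h_ge0|by rewrite mulr_ge0 ?normr_ge0 ?mulr_ge0|].
apply: ler_pM => //; [by rewrite mulr_ge0| |by apply: ler_pM; rewrite ?hz].
by have := HL 1%:M x y x1 y1; rewrite !mul1mx.
Qed.

Lemma weight_variation : exists2 L : R, 0 < L & forall n x y, nrm x = 1 -> nrm y = 1 ->
  \sum_(w : n.-tuple I) `|weight (mxw w) x - weight (mxw w) y| <= L * nrm (wedge x y) `^ s.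
Proof.
have [L L0 HL] := weight_unit_hoelder; exists (L * C0); first by rewrite mulr_gt0.
move=> n x y x1 y1; set W := _ `^ s.
apply: (@le_trans _ _ (\sum_(w : n.-tuple I) L * (nt (mxw w) * W))).
  by apply: ler_sum => w _; exact: HL.
rewrite -mulr_sumr -mulr_suml -mulrA ler_wpM2l ?(ltW L0) // ler_wpM2r ?powR_ge0 //.
exact: Z_le.
Qed.

Lemma weight_sum n x : x != 0 -> \sum_(w : n.-tuple I) weight (mxw w) x = 1.
Proof.
by move=> x0; rewrite /weight -mulr_suml h_word divff // gt_eqF // h_gt0.
Qed.

Lemma weightZ B c x : c != 0 -> weight B (c *: x) = weight B x.
Proof.
move=> c0; rewrite /weight -scalemxAr !hZ -mulf_div divff ?mul1r //.
by rewrite gt_eqF // powR_gt0 // normr_gt0.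
Qed.

(** The normalized transfer operator, a Markov operator on projective space. *)
Definition transfer n f x := \sum_(w : n.-tuple I) weight (mxw w) x * f (mxw w *m x).

Definition projective f := forall c x, c != 0 -> f (c *: x) = f x.

Lemma transfer_projective n f : projective f -> projective (transfer n f).
Proof.
move=> pf c x c0; apply: eq_bigr => w _.
by rewrite weightZ // -scalemxAr pf.
Qed.

Lemma transferD m n f x : x != 0 -> transfer (m + n) f x = transfer m (transfer n f) x.
Proof.
move=> x0; rewrite addnC /transfer (sum_word_cat _ _ (fun w => weight (mxw w) x * f (mxw w *m x))).
rewrite exchange_big; apply: eq_bigr => u _; rewrite mulr_sumr; apply: eq_bigr => v _.
rewrite mxw_cat mulrA -mulmxA; congr (_ * _); rewrite /weight mulmxA.
have hx : h x != 0 by rewrite gt_eqF ?h_gt0.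
have hu : h (mxw u *m x) != 0 by rewrite gt_eqF ?h_gt0 ?mul_neq0.
by field; rewrite hx hu.
Qed.

Lemma transfer_bound n f lo hi : (forall x, x != 0 -> lo <= f x <= hi) ->
  forall x, x != 0 -> lo <= transfer n f x <= hi.
Proof.
move=> fb x x0; rewrite -{1}[lo]mul1r -{1}[hi]mul1r -(weight_sum n x0) !mulr_suml.
apply/andP; split; apply: ler_sum => w _; rewrite ler_wpM2l ?weight_ge0 //.
  by have /andP[] := fb _ (mul_neq0 w x0).
by have /andP[] := fb _ (mul_neq0 w x0).
Qed.

(** The projective distance, comparable to the angle between the two lines. *)
Definition pdist x y := nrm (wedge x y) / (nrm x * nrm y).

Lemma pdistC x y : pdist x y = pdist y x.
Proof.
rewrite /pdist mulrC [nrm x * _]mulrC mulrC; congr (_ / _).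
by rewrite -[LHS]nrmN /wedge opprB.
Qed.

Lemma pdist_ge0 x y : 0 <= pdist x y.
Proof. by rewrite divr_ge0 ?mulr_ge0 ?nrm_ge0. Qed.

Lemma pdistZ a b x y : a != 0 -> b != 0 -> pdist (a *: x) (b *: y) = pdist x y.
Proof.
move=> a0 b0; rewrite /pdist wedgeZl wedgeZr !nrmZ mulrA mulrACA -mulf_div.
by rewrite divff ?mul1r // mulf_neq0 // normr_eq0.
Qed.

(** Weighting by the point whose image is shorter leaves the nonnegative power
    [t - 2 s] of the norm of that image. *)
Let weight_pdist B x y : nrm x = 1 -> nrm y = 1 -> B *m x != 0 ->
  nrm (B *m x) <= nrm (B *m y) ->
  weight B x * pdist (B *m x) (B *m y) `^ s <=
  a2 / a1 * (nrm B `^ (t - 2 * s) * ext2 B `^ s) * nrm (wedge x y) `^ s.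
Proof.
move=> x1 y1 Bx0 xy.
have a0 : 0 < nrm (B *m x) by rewrite nrm_gt0.
have b0 : 0 < nrm (B *m y) := lt_le_trans a0 xy.
apply: (@le_trans _ _ (a2 / a1 * nt (B *m x) * ((ext2 B * nrm (wedge x y)) / nrm (B *m x) ^+ 2) `^ s)).
  apply: ler_pM; rewrite ?weight_ge0 ?powR_ge0 ?weight_le //.
  apply: powR_le; rewrite ?pdist_ge0 ?(ltW s0) // /pdist.
  apply: ler_pM; rewrite ?nrm_ge0 ?invr_ge0 ?mulr_ge0 ?nrm_ge0 ?nrm_wedge_mul //.
  by rewrite lef_pV2 ?posrE ?mulr_gt0 // expr2 ler_pM2l.
rewrite -!mulrA !ler_wpM2l ?invr_ge0 ?(ltW a10) ?(ltW a20) //.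
rewrite powRM ?mulr_ge0 ?ext2_ge0 ?nrm_ge0 ?invr_ge0 ?sqr_ge0 //.
rewrite powRM ?nrm_ge0 ?invr_ge0 ?sqr_ge0 //.
rewrite [leLHS](_ : _ = (nt (B *m x) * (nrm (B *m x) ^- 2) `^ s) *
   (ext2 B `^ s * nrm (wedge x y) `^ s)); last by ring.
rewrite ler_wpM2r ?mulr_ge0 ?powR_ge0 //.
have -> : nt (B *m x) * (nrm (B *m x) ^- 2) `^ s = nrm (B *m x) `^ (t - 2 * s).
  have -> : (nrm (B *m x) ^- 2) `^ s = nrm (B *m x) `^ (- (2 * s)).
    by rewrite powRN -powR_sqr ?nrm_ge0 // -powRN -powR_inv1 ?sqr_ge0 // -powRrM mulN1r.
  by rewrite -powRD // (gt_eqF a0) implybT.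
apply: powR_le; rewrite ?nrm_ge0 ?subr_ge0 //.
by apply: le_trans (nrmM _ _) _; rewrite x1 mulr1.
Qed.

Definition hoelder_proj K f := forall x y, x != 0 -> y != 0 ->
  `|f x - f y| <= K * pdist x y `^ s.

Let unitize x : x != 0 -> exists c, [/\ c != 0 & nrm (c *: x) = 1].
Proof.
move=> x0; exists (nrm x)^-1; rewrite invr_neq0 ?nrm_eq0 //; split => //.
by rewrite nrmZ ger0_norm ?invr_ge0 ?nrm_ge0 // mulVf // nrm_eq0.
Qed.

(** The oscillation of [f] along the words contributes [ext_sum], an average of
    the contraction of the projective distance; the variation of the weights
    costs a multiple of the oscillation [m] of [f]. *)
Lemma lasota_yorke : exists2 C : R, 0 < C & forall n f lo m K, 0 <= m -> 0 <= K ->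
  projective f -> (forall x, x != 0 -> lo <= f x <= lo + m) -> hoelder_proj K f ->
  hoelder_proj (C * K * ext_sum A t s n + C * m) (transfer n f).
Proof.
have [L L0 HL] := weight_variation.
exists (Num.max (a2 / a1) L); first by rewrite lt_max divr_gt0.
move=> n f lo m K m0 K0 pf fb fK x0 y0 x0n y0n.
have pQ := transfer_projective n pf.
have [a [an x1]] := unitize x0n; have [b [bn y1]] := unitize y0n.
rewrite -(pQ a x0 an) -(pQ b y0 bn) -(pdistZ x0 y0 an bn).
move: (a *: x0) (b *: y0) x1 y1 => x y x1 y1 {x0 y0 x0n y0n a b an bn pQ}.
have xn : x != 0 by rewrite -nrm_gt0 x1 ltr01.
have yn : y != 0 by rewrite -nrm_gt0 y1 ltr01.
have -> : pdist x y = nrm (wedge x y) by rewrite /pdist x1 y1 mul1r divr1.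
set W := nrm _; have Ws0 : 0 <= W `^ s := powR_ge0 _ _.
(* Subtracting a constant leaves the oscillation unchanged and makes the values
   comparable to [m]. *)
pose g z := f z - lo.
have Qg z : z != 0 -> transfer n f z = transfer n g z + lo.
  move=> z0; rewrite /transfer /g -[X in _ + X]mul1r -(weight_sum n z0) mulr_suml -big_split.
  by apply: eq_bigr => w _; rewrite /= -mulrDr subrK.
have gb z : z != 0 -> 0 <= g z <= m.
  by move=> /fb; rewrite /g subr_ge0 lerBlDl.
rewrite (Qg x xn) (Qg y yn) opprD addrACA subrr addr0 /transfer -sumrB.
apply: le_trans (ler_norm_sum _ _ _) _.
apply: (@le_trans _ _ (\sum_(w : n.-tuple I)
   (a2 / a1 * K * (nrm (mxw w) `^ (t - 2 * s) * ext2 (mxw w) `^ s) * W `^ s +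
    m * `|weight (mxw w) x - weight (mxw w) y|))).
  apply: ler_sum => w _.
  set B := mxw w; have Bx : B *m x != 0 by exact: mul_neq0.
  have By : B *m y != 0 by exact: mul_neq0.
  have gK u v : u != 0 -> v != 0 -> `|g u - g v| <= K * pdist u v `^ s.
    move=> u0 v0; have -> : g u - g v = f u - f v by rewrite /g; ring.
    exact: fK.
  have gm u : u != 0 -> `|g u| <= m by move=> /gb/andP[g0 gm]; rewrite ger0_norm.
  case: (lerP (nrm (B *m x)) (nrm (B *m y))) => xy.
    have -> : weight B x * g (B *m x) - weight B y * g (B *m y) =
       weight B x * (g (B *m x) - g (B *m y)) + (weight B x - weight B y) * g (B *m y) by ring.
    apply: le_trans (ler_normD _ _) _; apply: lerD; last first.
      by rewrite normrM mulrC ler_wpM2r ?gm.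
    rewrite normrM ger0_norm ?weight_ge0 //.
    apply: le_trans (ler_wpM2l (weight_ge0 _ _) (gK _ _ Bx By)) _.
    have := ler_wpM2l K0 (weight_pdist x1 y1 Bx xy).
    by rewrite mulrCA => /le_trans; apply; rewrite le_eqVlt; apply/orP; left; apply/eqP; rewrite /W; ring.
  have -> : weight B x * g (B *m x) - weight B y * g (B *m y) =
     weight B y * (g (B *m x) - g (B *m y)) + (weight B x - weight B y) * g (B *m x) by ring.
  apply: le_trans (ler_normD _ _) _; apply: lerD; last first.
    by rewrite normrM mulrC ler_wpM2r ?gm.
  rewrite normrM ger0_norm ?weight_ge0 //.
  apply: le_trans (ler_wpM2l (weight_ge0 _ _) (gK _ _ Bx By)) _.
  have := ler_wpM2l K0 (weight_pdist y1 x1 By (ltW xy)).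
  have -> : nrm (wedge y x) = W by rewrite /W -[RHS]nrmN /wedge opprB.
  rewrite pdistC mulrCA => /le_trans; apply; rewrite le_eqVlt; apply/orP; left; apply/eqP; ring.
rewrite big_split /= -!mulr_suml -!mulr_sumr [leRHS]mulrDl; apply: lerD.
  rewrite ler_wpM2r // /ext_sum ler_wpM2r ?ler_wpM2r //; last by rewrite le_max lexx.
  by apply: sumr_ge0 => w _; rewrite mulr_ge0 ?powR_ge0.
apply: le_trans (ler_wpM2l m0 (HL n x y x1 y1)) _; rewrite -/W.
by rewrite [leLHS]mulrCA [leLHS]mulrA !ler_wpM2r // le_max lexx orbT.
Qed.

(** For a suitable [a] these functions are stable under a power of the transfer
    operator, with a smaller [m]. *)
Definition controlled a lo m f := [/\ projective f,
  forall x, x != 0 -> lo <= f x <= lo + m & hoelder_proj (a * m) f].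

Lemma weight_le1 n w x : x != 0 -> size w = n -> weight (mxw w) x <= 1.
Proof.
move=> x0 sw; rewrite -(weight_sum n x0).
exact: (word_le_sum sw (fun w => weight_ge0 (mxw w) x)).
Qed.

(** Isolating one word [k] in the average. *)
Let transfer_upper n f x S k : x != 0 -> (forall y, y != 0 -> f y <= S) -> size k = n ->
  transfer n f x <= S - weight (mxw k) x * (S - f (mxw k *m x)).
Proof.
move=> x0 fS /eqP sk.
have : transfer n f x <= \sum_(w : n.-tuple I) (weight (mxw w) x * S -
     (if w == Tuple sk then weight (mxw k) x * (S - f (mxw k *m x)) else 0)).
  apply: ler_sum => w _; case: eqP => [->/=|_]; first by rewrite mulrBr opprB addrCA subrr addr0.
  by rewrite subr0 ler_wpM2l ?weight_ge0 // fS // mul_neq0.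
by rewrite sumrB -mulr_suml weight_sum // mul1r -big_mkcond big_pred1_eq.
Qed.

Let transfer_opp n f x : transfer n (fun y => - f y) x = - transfer n f x.
Proof. by rewrite /transfer -sumrN; apply: eq_bigr => w _; rewrite mulrN. Qed.

Let transfer_lower n f x S k : x != 0 -> (forall y, y != 0 -> S <= f y) -> size k = n ->
  S + weight (mxw k) x * (f (mxw k *m x) - S) <= transfer n f x.
Proof.
move=> x0 fS sk; have := @transfer_upper n (fun y => - f y) x (- S) k x0 _ sk.
rewrite transfer_opp lerNl opprB opprK [weight _ _ * (_ + _)](_ : _ = - (weight (mxw k) x * (S - f (mxw k *m x)))); last first.
  by rewrite -mulrN; congr (_ * _); ring.
move=> H; apply: le_trans (H _); last by move=> y y0; rewrite lerN2 fS.
by rewrite le_eqVlt; apply/orP; left; apply/eqP; ring.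
Qed.

(** All trajectories visit the same small region with a definite probability,
    so the oscillation contracts; the Lasota-Yorke inequality keeps the Hoelder
    constant under control. *)
Lemma contraction : attracting A ->
  (forall e, 0 < e -> exists N, forall n, (N <= n)%N -> ext_sum A t s n <= e) ->
  exists a kappa N, [/\ 0 < a, 0 < kappa < 1, (0 < N)%N & forall f lo m, 0 <= m ->
    controlled a lo m f -> exists lo', controlled a lo' (kappa * m) (transfer N f)].
Proof.
move=> [v v0 attr] small; have [C CC LY] := lasota_yorke.
(* With this [a] the Hoelder bound [C * a * m * ext_sum + C * m] of the image is
   at most half of [a * m], as soon as [ext_sum] is at most [1 / (4 C)]. *)
pose a := 4 * C; have aa : 0 < a by rewrite mulr_gt0.
(* At distance [delta] from [v] the function varies by at most [m / 4]. *)
pose delta := (4 * a)^-1 `^ s^-1.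
have delta0 : 0 < delta by rewrite powR_gt0 // invr_gt0 mulr_gt0.
have ds : a * delta `^ s = 4^-1.
  rewrite /delta -powRrM mulVf ?gt_eqF // powRr1 ?invr_ge0 ?mulr_ge0 ?(ltW CC) //.
  by field; rewrite gt_eqF.
have C40 : 0 < (4 * C)^-1 by rewrite invr_gt0 mulr_gt0.
have [N1 HN1] := small _ C40.
have [N [p0 [N1N p00 HN]]] := attr delta (maxn N1 1) delta0.
pose p := a1 / a2 * p0 `^ t.
have pp : 0 < p by rewrite mulr_gt0 ?divr_gt0 ?powR_gt0.
have target x : x != 0 -> exists k, [/\ size k = N, p <= weight (mxw k) x &
    pdist (mxw k *m x) v <= delta].
  move=> x0; have [k [sk k1 k2]] := HN x; exists k; split => //.
    rewrite /weight ler_pdivlMr ?h_gt0 //; apply: le_trans (h_ge _).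
    apply: le_trans (ler_wpM2l (ltW pp) (h_le x)) _.
    rewrite [leLHS](_ : _ = a1 * (p0 `^ t * nt x)); last first.
      by rewrite /p; field; rewrite gt_eqF.
    rewrite ler_wpM2l ?(ltW a10) // /nrm_pow -powRM ?nrm_ge0 ?(ltW p00) //.
    by apply: powR_le; rewrite ?mulr_ge0 ?nrm_ge0 ?(ltW p00) ?(ltW t0).
  rewrite /pdist ler_pdivrMr // mulr_gt0 // nrm_gt0 //; exact: mul_neq0.
have p1 : p <= 1.
  by have [k [sk k1 _]] := target v v0; apply: le_trans k1 (weight_le1 v0 sk).
exists a; exists (1 - p / 2); exists N; split => //.
- by apply/andP; split; lra.
- by apply: leq_trans N1N; rewrite leq_maxr.
move=> f lo m m0 [pf fb fH].
have fv x k : x != 0 -> pdist (mxw k *m x) v <= delta -> `|f (mxw k *m x) - f v| <= m / 4.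
  move=> x0 kd; apply: le_trans (fH _ _ (mul_neq0 k x0) v0) _.
  apply: (@le_trans _ _ (a * m * delta `^ s)).
    apply: ler_wpM2l; first by rewrite (mulr_ge0 (ltW aa)).
    by apply: powR_le; rewrite ?pdist_ge0 ?(ltW s0).
  by rewrite mulrAC ds mulrC.
exists (lo + p * (f v - m / 4 - lo)); split.
- exact: transfer_projective.
- move=> x x0; have [k [sk k1 k2]] := target x x0.
  have /andP[f1 f2] := fb _ (mul_neq0 k x0).
  have := fv x k x0 k2; rewrite ler_norml => /andP[f3 f4].
  have fS y : y != 0 -> f y <= lo + m by move=> /fb/andP[].
  have fI y : y != 0 -> lo <= f y by move=> /fb/andP[].
  have up := transfer_upper x0 fS sk; have low := transfer_lower x0 fI sk.
  move: k1 up low f1 f2 f3 f4; set F := f (mxw k *m x); set q := weight _ _ => k1 up low f1 f2 f3 f4.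
  apply/andP; split.
    apply: le_trans low; rewrite lerD2l; apply: (@le_trans _ _ (p * (F - lo))).
      by rewrite ler_wpM2l ?(ltW pp) //; lra.
    by rewrite ler_wpM2r // subr_ge0.
  apply: le_trans up _.
  apply: (@le_trans _ _ (lo + m - p * (lo + m - F))).
    by rewrite lerD2l lerN2 ler_wpM2r // subr_ge0.
  rewrite [leRHS](_ : _ = lo + m - p * (lo + m - (f v + m / 4))); last by field.
  by rewrite lerD2l lerN2 ler_wpM2l ?(ltW pp) //; lra.
move=> x y x0 y0; have am0 : 0 <= a * m by rewrite (mulr_ge0 (ltW aa)).
apply: le_trans (LY N f lo m (a * m) m0 am0 pf fb fH x y x0 y0) _.
rewrite ler_wpM2r ?powR_ge0 //.
have S1 : ext_sum A t s N <= (4 * C)^-1.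
  by apply: HN1; apply: leq_trans N1N; rewrite leq_maxl.
have : C * (a * m) * ext_sum A t s N <= m * C.
  apply: (@le_trans _ _ (C * (a * m) * (4 * C)^-1)).
    by rewrite ler_wpM2l // !mulr_ge0 // ltW.
  by rewrite le_eqVlt; apply/orP; left; apply/eqP; rewrite /a; field; rewrite gt_eqF.
have : 0 <= (1 - p) * (m * C) by rewrite !mulr_ge0 ?subr_ge0 // ltW.
rewrite /a; lra.
Qed.

Lemma eq_controlled a lo m f g : (forall x, x != 0 -> f x = g x) ->
  controlled a lo m f -> controlled a lo m g.
Proof.
move=> fg [pf fb fH]; split.
- move=> c x c0; have [->|x0] := eqVneq x 0; first by rewrite scaler0.
  by rewrite -!fg ?scaler_eq0 ?negb_or ?c0 // pf.
- by move=> x x0; rewrite -fg // fb.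
- by move=> x y x0 y0; rewrite -!fg // fH.
Qed.

(** The bound by the power of the norm becomes a bound by the mass of [u],
    through the Gibbs property. *)
Lemma weight_controlled a : 0 < a -> exists2 M : R, 0 < M &
  forall u, controlled a 0 (M * nt (mxw u)) (weight (mxw u)).
Proof.
move=> aa; have [L L0 HL] := weight_unit_hoelder.
exists (a2 / a1 + L / a); first by rewrite addr_gt0 ?divr_gt0.
move=> u; split.
- by move=> c x c0; exact: weightZ.
- move=> x /unitize[c [c0 x1]]; rewrite add0r weight_ge0 /= -(weightZ _ _ c0).
  apply: le_trans (weight_le _ x1) _; apply: (@le_trans _ _ (a2 / a1 * nt (mxw u))).
    rewrite ler_wpM2l ?divr_ge0 ?(ltW a10) ?(ltW a20) //.
    by apply: le_trans (nrm_powM t0 _ _) _; rewrite {2}/nrm_pow x1 powR1 mulr1.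
  by rewrite ler_wpM2r ?nrm_pow_ge0 // lerDl divr_ge0 // ltW.
move=> x0 y0 /unitize[c [c0 x1]] /unitize[e [e0 y1]].
rewrite -(weightZ _ x0 c0) -(weightZ _ y0 e0) -(pdistZ x0 y0 c0 e0).
apply: le_trans (HL _ _ _ x1 y1) _; rewrite /pdist x1 y1 mul1r divr1 mulrA.
rewrite ler_wpM2r ?powR_ge0 // mulrA ler_wpM2r ?nrm_pow_ge0 //.
have -> : a * (a2 / a1 + L / a) = a * (a2 / a1) + L by field; rewrite !gt_eqF.
by rewrite lerDr mulr_ge0 ?divr_ge0 // ltW.
Qed.

Section WordMeasure.
Variables (a kappa : R) (N : nat).
Hypotheses (aa : 0 < a) (kappa01 : 0 < kappa < 1) (N0 : (0 < N)%N).
Hypothesis contr : forall f lo m, 0 <= m ->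
  controlled a lo m f -> exists lo', controlled a lo' (kappa * m) (transfer N f).

Let kappa0 : 0 < kappa. Proof. by case/andP: kappa01. Qed.

Lemma transfer_squeeze f lo m j : 0 <= m -> controlled a lo m f ->
  exists lo', forall n x, (j * N <= n)%N -> x != 0 ->
    lo' <= transfer n f x <= lo' + kappa ^+ j * m.
Proof.
move=> m0 fC.
have [lo' lC] : exists lo', controlled a lo' (kappa ^+ j * m) (transfer (j * N) f).
  elim: j => [|j [lo' IH]].
    exists lo; rewrite expr0 mul1r; apply: eq_controlled fC => x x0.
    rewrite /transfer (sum_word0 (fun w => weight (mxw w) x * f (mxw w *m x))) mul1mx.
    by rewrite /weight mul1mx divff ?mul1r // gt_eqF // h_gt0.
  have [|lo2 H2] := contr _ IH; first by rewrite mulr_ge0 ?exprn_ge0 // ltW.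
  exists lo2; rewrite exprS -mulrA; apply: eq_controlled H2 => x x0.
  by rewrite -transferD // mulSn.
exists lo' => n x jn x0; have [_ lb _] := lC.
by rewrite -(subnK jn) transferD //; apply: transfer_bound.
Qed.

Variable x0 : 'cV[R]_d.
Hypothesis x00 : x0 != 0.

(** The share of the words beginning with [u], in the limit of long words. *)
Definition cyl_weight u := blim (fun n => transfer n (weight (mxw u)) x0).
Local Notation p := cyl_weight.

Let transfer_bnd u : bounded_seq (fun n => transfer n (weight (mxw u)) x0).
Proof.
have [M M0 HM] := weight_controlled aa; have [_ b _] := HM u.
exists (M * nt (mxw u)) => n; have := transfer_bound n b x00.
by rewrite add0r => /andP[q0 q1]; rewrite ger0_norm.
Qed.

Let transfer_weight n B x : x != 0 -> (forall w, B *m (mxw w *m x) = B *m mxw w *m x) ->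
  transfer n (weight B) x = \sum_(w : n.-tuple I) weight (B *m mxw w) x.
Proof.
move=> xn BE; apply: eq_bigr => w _; rewrite /weight BE.
by rewrite mulrC mulrA divfK // gt_eqF // h_gt0 // mul_neq0.
Qed.

Let transfer_weightE n B x : x != 0 -> transfer n (weight B) x = \sum_(w : n.-tuple I) weight (B *m mxw w) x.
Proof. by move=> xn; apply: transfer_weight => // w; rewrite mulmxA. Qed.

Lemma cyl_weight_nil : p [::] = 1.
Proof.
rewrite /cyl_weight -[RHS](blim_cst (1 : R)); congr blim; apply/funext => n.
by rewrite transfer_weightE //; under eq_bigr do rewrite mul1mx; rewrite weight_sum.
Qed.

Lemma cyl_weight_ge0 u : 0 <= p u.
Proof.
rewrite -(blim_cst (0 : R)); apply: (@blim_le _ _ _ 0) => //.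
  exact: bounded_seq_cst.
by move=> n _; apply: sumr_ge0 => w _; rewrite mulr_ge0 ?weight_ge0.
Qed.

Lemma cyl_weight_rcons u : \sum_i p (rcons u i) = p u.
Proof.
rewrite /cyl_weight -blim_sum // -(blim_shift (transfer_bnd u)); congr blim; apply/funext => n.
rewrite transfer_weightE // (sum_word_cons _ (fun w => weight (mxw u *m mxw w) x0)).
apply: eq_bigr => i _; rewrite transfer_weightE //; apply: eq_bigr => w _.
by rewrite mxw_rcons -mulmxA.
Qed.

(** The eigenfunction equation absorbs the first letter. *)
Lemma cyl_weight_cons u : \sum_i p (i :: u) = p u.
Proof.
rewrite /cyl_weight -blim_sum //; congr blim; apply/funext => n.
rewrite transfer_weightE //; under eq_bigr do rewrite transfer_weightE //.
rewrite exchange_big; apply: eq_bigr => w _; rewrite /weight -mulr_suml; congr (_ / _).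
rewrite -(h_word 1) (sum_word1 (fun k => h (mxw k *m (mxw u *m mxw w *m x0)))).
by apply: eq_bigr => i _; rewrite mxw1 /= !mulmxA.
Qed.

Lemma cyl_weight_word : word_measure p.
Proof.
split; [exact: cyl_weight_nil|exact: cyl_weight_ge0|exact: cyl_weight_rcons|].
exact: cyl_weight_cons.
Qed.

Lemma cyl_weight_gibbs :
  (exists N' (c1 : R), 0 < c1 /\ forall n, (N' <= n)%N ->
    forall q r (U : 'M[R]_(q, d)) (X : 'M[R]_(d, r)), c1 * (nt U * nt X) <= sandwich_sum A t n U X) ->
  exists C, 0 < C /\ forall u, C^-1 * p u <= nt (mxw u) <= C * p u.
Proof.
move=> [N' [c1 [c10 H1]]]; have [M M0 HM] := weight_controlled aa.
have nx0 : 0 < nt x0 by exact: nrm_pow_gt0.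
pose c := a1 * c1 * nt x0 / h x0.
have c0 : 0 < c by rewrite divr_gt0 ?h_gt0 ?mulr_gt0.
have low u : c * nt (mxw u) <= p u.
  rewrite -(blim_cst (c * nt (mxw u))); apply: (@blim_le _ _ _ N') => //.
    exact: bounded_seq_cst.
  move=> n /H1/(_ _ _ (mxw u) x0) Hn; rewrite transfer_weightE //.
  rewrite /weight -mulr_suml /c mulrAC ler_wpM2r ?invr_ge0 ?h_ge0 //.
  apply: (@le_trans _ _ (a1 * sandwich_sum A t n (mxw u) x0)).
    by rewrite -!mulrA ler_wpM2l ?(ltW a10) // (mulrC (nt x0)).
  by rewrite /sandwich_sum mulr_sumr; apply: ler_sum => w _; exact: h_ge.
have up u : p u <= M * nt (mxw u).
  rewrite -(blim_cst (M * nt (mxw u))); apply: (@blim_le _ _ _ 0) => //.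
    exact: bounded_seq_cst.
  by move=> n _; have [_ b _] := HM u; have := transfer_bound n b x00; rewrite add0r => /andP[].
exists (M + c^-1); have C0' : 0 < M + c^-1 by rewrite addr_gt0 ?invr_gt0.
split => // u; apply/andP; split.
  rewrite ler_pdivrMl //; apply: le_trans (up u) _.
  by rewrite ler_wpM2r ?nrm_pow_ge0 // lerDl invr_ge0 ltW.
apply: (@le_trans _ _ (c^-1 * p u)); first by rewrite ler_pdivlMl.
by rewrite ler_wpM2r ?cyl_weight_ge0 // lerDr ltW.
Qed.

(** Given the letters after the gap, the mass of [u] is the value of a power of
    the transfer operator on its weight, at the point of projective space where
    these letters lead; this value nearly does not depend on the point. *)
Lemma cyl_weight_mixing C : 0 < C -> (forall u, nt (mxw u) <= C * p u) -> psi_mixing p.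
Proof.
move=> CC gibbs; have [M M0 HM] := weight_controlled aa.
pose gamma := kappa `^ N%:R^-1.
have gamma0 : 0 < gamma by rewrite powR_gt0.
have gN : gamma ^+ N = kappa.
  rewrite /gamma -powR_mulrn ?powR_ge0 // -powRrM mulVf ?powRr1 ?ltW //.
  by rewrite pnatr_eq0 -lt0n.
have gamma1 : gamma < 1.
  rewrite ltNge; apply/negP => g1; have := exprn_ege1 N g1.
  by rewrite gN leNgt; case/andP: kappa01 => _ ->.
have kg n : kappa ^+ (n %/ N) <= gamma ^- N * gamma ^+ n.
  rewrite ler_pdivlMl ?exprn_gt0 // -gN -exprM -exprD.
  apply: ler_wiXn2l; rewrite ?(ltW gamma0) ?(ltW gamma1) //.
  by rewrite {1}(divn_eq n N) [(n %/ N * N)%N]mulnC addnC leq_add2r ltnW // ltn_mod.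
exists (gamma ^- N * M * C), gamma; split.
- by rewrite !mulr_gt0 // invr_gt0 exprn_gt0.
- by rewrite gamma0 gamma1.
move=> n u w; pose m := M * nt (mxw u).
have m0 : 0 <= m by rewrite mulr_ge0 ?nrm_pow_ge0 // ltW.
pose j := (n %/ N)%N; pose e := kappa ^+ j * m.
have [lo' Hlo] := transfer_squeeze j m0 (HM u).
have pu : lo' <= p u <= lo' + e.
  apply/andP; split.
    rewrite -(blim_cst lo'); apply: (@blim_le _ _ _ (j * N)) => //.
      exact: bounded_seq_cst.
    by move=> k jk; have /andP[] := Hlo k x0 jk x00.
  rewrite -(blim_cst (lo' + e)); apply: (@blim_le _ _ _ (j * N)) => //.
    exact: bounded_seq_cst.
  by move=> k jk; have /andP[] := Hlo k x0 jk x00.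
have near x : x != 0 -> `|transfer n (weight (mxw u)) x - p u| <= e.
  move=> xn; have := Hlo n x (leq_trunc_div n N) xn; move: pu.
  rewrite ler_norml -/e; lra.
have e0 : 0 <= e by rewrite mulr_ge0 ?exprn_ge0 // ltW.
apply: (@le_trans _ _ (e * p w)); last first.
  rewrite mulrA ler_wpM2r ?cyl_weight_ge0 //.
  apply: (@le_trans _ _ (gamma ^- N * gamma ^+ n * (M * (C * p u)))).
    apply: ler_pM => //; [by rewrite exprn_ge0 // ltW|exact: kg|].
    by rewrite /m ler_wpM2l ?gibbs // ltW.
  by rewrite le_eqVlt; apply/orP; left; apply/eqP; ring.
rewrite /cyl_weight -blim_sum // -!blimZ //.
apply: (@blim_dist _ _ _ _ 0).
- exact: bounded_seq_sum.
- exact: bounded_seqZ.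
- exact: bounded_seqZ.
move=> i _.
have -> : \sum_(k : n.-tuple I) transfer i (weight (mxw (u ++ k ++ w))) x0 =
    \sum_(v : i.-tuple I) weight (mxw w *m mxw v) x0 * transfer n (weight (mxw u)) (mxw w *m mxw v *m x0).
  under eq_bigr do rewrite transfer_weightE //.
  rewrite exchange_big; apply: eq_bigr => v _.
  have yn : mxw w *m mxw v *m x0 != 0 by rewrite -mxw_cat mul_neq0.
  rewrite transfer_weightE // mulr_sumr; apply: eq_bigr => k _; rewrite /weight.
  rewrite [RHS]mulrC [RHS]mulrA divfK ?gt_eqF ?h_gt0 // !mxw_cat.
  by rewrite !mulmxA.
rewrite transfer_weightE // !mulr_sumr -sumrB; apply: le_trans (ler_norm_sum _ _ _) _.
apply: ler_sum => v _; rewrite [p u * _]mulrC -mulrBr normrM ger0_norm ?weight_ge0 //.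
rewrite [leRHS]mulrC ler_wpM2l ?weight_ge0 //; apply: near.
by rewrite -mxw_cat mul_neq0.
Qed.

End WordMeasure.
End Transfer.

(** * Gibbs word measures *)

Section WordGibbs.
Variables (R : realType) (d' : nat) (I : finType) (i0 : I).
Notation d := d'.+1.
Implicit Type A : I -> 'M[R]_d.

Definition word_gibbs A (t : R) (p : seq I -> R) := exists C P : R, 0 < C /\
  forall w, C^-1 * p w <= expR (- ((size w)%:R * P)) * nrm (mxw A w) `^ t <= C * p w.

Lemma normalized_word_measure A (t C0 : R) : 0 < t -> (forall i, A i \in unitmx) ->
  connecting A -> pinching A -> attracting A -> (forall n, 1 <= word_sum A t n <= C0) ->
  exists p, [/\ word_measure p, psi_mixing p &
    exists C, 0 < C /\ forall w, C^-1 * p w <= nrm_pow t (mxw A w) <= C * p w].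
Proof.
move=> t0 Ainv conn pinch attr Zbd.
(* [2 s <= t] keeps the powers of norms in [ext_sum] nonnegative, and [2 s <= 1]
   is needed for Hoelder continuity. *)
pose s := Num.min t 1 / 2.
have s2 : 2 * s = Num.min t 1 by rewrite /s mulrC divfK.
have s0 : 0 < s by rewrite divr_gt0 // lt_min t0 ltr01.
have s2t : 2 * s <= t by rewrite s2 ge_min lexx.
have s21 : 2 * s <= 1 by rewrite s2 ge_min lexx orbT.
have Z_le n : word_sum A t n <= C0 by have /andP[] := Zbd n.
have [a1 [a2 [a10 a20 hbd]]] := eigenfun_bounds t0 conn Zbd.
have [L L0 hL] := eigenfun_hoelder t0 Zbd s0 s2t s21.
have small := ext_sum_small t0 Ainv conn pinch Zbd s0 s2t.
have hZ' := eigenfunZ t0 Zbd; have hw := eigenfun_word t0 Zbd.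
have [a [kappa [N [aa k01 N0 contr]]]] :=
  contraction t0 Ainv Z_le s0 s2t a10 a20 L0 hbd hZ' hw hL attr small.
have x00 : (const_mx 1 : 'cV[R]_d) != 0.
  by apply/eqP => /matrixP/(_ 0 0)/eqP; rewrite !mxE oner_eq0.
have [C [C00 gibbs]] := cyl_weight_gibbs t0 Ainv a10 a20 L0 hbd hZ' hw hL aa x00 (sandwich_ge t0 conn Zbd).
exists (cyl_weight A (eigenfun A t) (const_mx 1)); split.
- exact: (cyl_weight_word t0 Ainv a10 a20 L0 hbd hZ' hw hL aa x00).
- apply: (cyl_weight_mixing t0 Ainv a10 a20 L0 hbd hZ' hw hL aa k01 N0 contr x00 C00).
  by move=> u; have /andP[] := gibbs u.
- by exists C.
Qed.

(** Multiplying the matrices by [exp (- P / t)] reduces to pressure zero. *)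
Lemma matrix_word_measure A (t : R) : 0 < t -> (forall i, A i \in unitmx) ->
  connecting A -> pinching A -> attracting A ->
  exists p, [/\ word_measure p, psi_mixing p & word_gibbs A t p].
Proof.
move=> t0 Ainv conn pinch attr.
have Z0 n : 0 < word_sum A t n.
  have sn : size (nseq n i0) = n by rewrite size_nseq.
  apply: lt_le_trans (word_le_sum sn (fun w => nrm_pow_ge0 t (mxw A w))).
  by rewrite nrm_pow_gt0 // mxw_neq0.
have [C [P [C0 HP]]] := pressure t0 conn Z0.
pose c := expR (- (P / t)).
have c0 : 0 < c := expR_gt0 _.
pose A' i := c *: A i.
have ntA' w : nrm_pow t (mxw A' w) = expR (- ((size w)%:R * P)) * nrm_pow t (mxw A w).
  rewrite mxwZ nrm_powZ ger0_norm ?exprn_ge0 ?(ltW c0) //; congr (_ * _).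
  rewrite /c -expRM_natl -expRM; congr expR.
  by field; rewrite gt_eqF.
have ZA' n : word_sum A' t n = expR (- (n%:R * P)) * word_sum A t n.
  by rewrite /word_sum mulr_sumr; apply: eq_bigr => w _; rewrite ntA' size_tuple.
have Zbd n : 1 <= word_sum A' t n <= C.
  have /andP[Z1 Z2] := HP n; rewrite ZA' expRN ler_pdivlMl ?expR_gt0 // mulr1 Z1 /=.
  by rewrite ler_pdivrMl ?expR_gt0 // mulrC.
have [||||p [pw pm [D [D0 HD]]]] := @normalized_word_measure A' t C t0 _ _ _ _ Zbd.
- by move=> i; rewrite unitmxZ // unitfE gt_eqF.
- exact: connectingZ.
- exact: pinchingZ.
- exact: attractingZ.
exists p; split => //; exists D, P; split => // w; rewrite -[_ * _ `^ t]ntA'.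
exact: HD.
Qed.

Lemma uniform_word_measure A :
  exists p, [/\ word_measure p, psi_mixing p & word_gibbs A 0 p].
Proof.
have K0 : 0 < #|I|%:R :> R by rewrite ltr0n; apply/card_gt0P; exists i0.
pose p (w : seq I) : R := #|I|%:R ^- size w.
have pS : forall w : seq I, \sum_(i : I) #|I|%:R ^- (size w).+1 = p w.
  by move=> w; rewrite sumr_const -[LHS]mulr_natl exprS invfM mulrA divff ?mul1r // gt_eqF.
have p0 w : 0 < p w by rewrite invr_gt0 exprn_gt0.
have pcat u v : p (u ++ v) = p u * p v by rewrite /p size_cat exprD invfM.
exists p; split.
- split => [|w|w|w]; first by rewrite /p /= expr0 invr1.
  + exact: ltW.
  + by rewrite -pS; apply: eq_bigr => i _; rewrite /p size_rcons.
  + by rewrite -pS; apply: eq_bigr => i _.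
- exists 1, 2^-1; split => //; first by apply/andP; split; lra.
  move=> n u w; have -> : \sum_(k : n.-tuple I) p (u ++ k ++ w) = p u * p w.
    under eq_bigr do rewrite !pcat mulrCA.
    rewrite -mulr_suml; have -> : \sum_(k : n.-tuple I) p k = 1; last by rewrite mul1r.
    elim: n => [|n IH]; first by rewrite (sum_word0 p) /p expr0 invr1.
    rewrite (sum_word_rcons _ p) -[RHS]IH; apply: eq_bigr => k _.
    by rewrite -pS; apply: eq_bigr => i _; rewrite /p size_rcons.
  by rewrite subrr normr0 !mulr_ge0 ?exprn_ge0 ?ltW ?p0.
exists 1, (ln #|I|%:R); split => // w; rewrite powRr0 mulr1 invr1 !mul1r.
suff -> : expR (- ((size w)%:R * ln #|I|%:R)) = p w by rewrite lexx.
by rewrite expRN expRM_natl lnK ?posrE.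
Qed.

End WordGibbs.

(** * Cylinders of the full shift *)

Section Cylinders.
Variable M : nat.
Notation X := (fullshift M).
Notation I := 'I_M.+1.
Implicit Types (x y : X) (a : int) (w : seq I).

Definition block x a n : seq I := [seq x (a + k%:Z) | k <- iota 0 n].

Definition Cyl a w : set X := [set x | block x a (size w) = w].

Lemma size_block x a n : size (block x a n) = n.
Proof. by rewrite size_map size_iota. Qed.

Lemma blockS x a n : block x a n.+1 = x a :: block x (a + 1) n.
Proof.
rewrite /block /= addr0; congr cons; rewrite -[1%N]/(1 + 0)%N iotaDl -map_comp.
by apply: eq_map => k /=; rewrite PoszD addrA.
Qed.

Lemma block_cat x a m n : block x a (m + n) = block x a m ++ block x (a + m%:Z) n.
Proof.
have E : iota m n = map (addn m) (iota 0 n) by rewrite -iotaDl addn0.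
rewrite /block iotaD map_cat add0n; congr cat; rewrite E -map_comp.
by apply: eq_map => k /=; rewrite PoszD addrA.
Qed.

Lemma block_rcons x a n : block x a n.+1 = rcons (block x a n) (x (a + n%:Z)).
Proof. by rewrite -(addn1 n) block_cat cats1 /block /= addr0. Qed.

Lemma nth_block x a n k : (k < n)%N -> nth ord0 (block x a n) k = x (a + k%:Z).
Proof. by move=> kn; rewrite (nth_map 0%N) ?size_iota // nth_iota. Qed.

Lemma block_shift x a n : block (left_shift x) a n = block x (a + 1) n.
Proof. by apply: eq_map => k; rewrite /left_shift addrAC. Qed.

Lemma eq_block x y a n :
  (forall k, (k < n)%N -> x (a + k%:Z) = y (a + k%:Z)) -> block x a n = block y a n.
Proof. by move=> H; apply/eq_in_map => k; rewrite mem_iota => /H. Qed.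

Lemma block_eq x y a n k :
  block x a n = block y a n -> (k < n)%N -> x (a + k%:Z) = y (a + k%:Z).
Proof. by move=> E kn; rewrite -(nth_block x a kn) E nth_block. Qed.

(** Points which agree with [x] on larger and larger windows converge to [x]. *)
Lemma open_block (U : set X) x : open U -> U x ->
  exists n : nat, forall y, (forall i : int, (`|i| < n)%N -> y i = x i) -> U y.
Proof.
move=> oU Ux; apply: contrapT => /forallNP H.
have /choice[y Hy] : forall n, exists y : X,
    (forall i : int, (`|i| < n)%N -> y i = x i) /\ ~ U y.
  move=> n; apply: contrapT => /forallNP H1; apply: (H n) => y yx.
  by apply: contrapT => Uy; apply: (H1 y).
have yx : y @ \oo --> x.
  apply/cvg_sup => i; apply/cvg_image.
    rewrite eqEsubset; split => b // _; exists (fun=> b) => //.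
  move=> /= B /nbhs_singleton Bxi.
  exists [set z : X | B (z i)].
    exists `|i|.+1 => // n /= ni.
    by have [-> //] := Hy n.
  rewrite eqEsubset; split => b; first by move=> [z Bz <-].
  by move=> Bb; exists (fun=> b).
have : nbhs x U by rewrite nbhsE; exists U.
move=> /yx[N _ HN]; have [_] := Hy N; apply; apply: HN; exact: leqnn.
Qed.

Lemma open_coord (i : int) (A : set (alphabet M)) : open [set x : X | A (x i)].
Proof.
apply: (@open_comp X (alphabet M) (fun x : X => x i)).
  by move=> x _; exact: (@proj_continuous int (fun=> alphabet M) i x).
exact: discrete_open.
Qed.

Lemma open_Cyl a w : open (Cyl a w).
Proof.
elim: w a => [|i w IH] a.
  have -> : Cyl a [::] = setT by rewrite eqEsubset; split.
  exact: openT.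
have -> : Cyl a (i :: w) = [set x : X | [set i] (x a)] `&` Cyl (a + 1) w.
  rewrite eqEsubset; split => x; rewrite /Cyl /= blockS.
    by case.
  by move=> [-> ->].
by apply: openI; [exact: open_coord|exact: IH].
Qed.

End Cylinders.

(** * Finite partitions and coding by intervals *)

Section FinitePartition.
Context dT (T : measurableType dT) (R : realType) (mu : probability T R).

Definition pr (B : set T) : R := fine (mu B).

Lemma pr_ge0 (B : set T) : 0 <= pr B.
Proof. by rewrite /pr fine_ge0. Qed.

Lemma pr_setT : pr setT = 1.
Proof. by rewrite /pr probability_setT. Qed.

Lemma pr_partition (J : finType) (g : T -> J) (B : set T) : measurable B ->
  (forall j, measurable (g @^-1` [set j])) ->
  pr B = \sum_j pr (B `&` g @^-1` [set j]).
Proof.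
move=> mB mg.
have mBg j : measurable (B `&` g @^-1` [set j]) by exact: measurableI.
pose U (r : seq J) := B `&` [set x | g x \in r].
have gj j : g @^-1` [set j] = [set x | g x = j] by [].
have mU r : measurable (U r).
  elim: r => [|j r IH].
    by rewrite (_ : U [::] = set0) // eqEsubset; split => x // [].
  rewrite (_ : U (j :: r) = (B `&` g @^-1` [set j]) `|` U r); first exact: measurableU.
  rewrite eqEsubset; split => x; rewrite /U /= in_cons.
    by move=> [Bx /orP[/eqP gx|gx]]; [left|right].
  by move=> [[Bx /= ->]|[Bx gx]]; rewrite ?eqxx // gx orbT.
have key r : uniq r -> pr (U r) = \sum_(j <- r) pr (B `&` g @^-1` [set j]).
  elim: r => [|j r IH].
    by rewrite big_nil (_ : U [::] = set0) ?/pr ?measure0 // eqEsubset; split => x // [].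
  move=> /andP[jr ur]; rewrite big_cons -IH //.
  rewrite (_ : U (j :: r) = (B `&` g @^-1` [set j]) `|` U r).
    rewrite {1}/pr measureU //; last first.
      rewrite eqEsubset; split => x // [[_ /= gx] [_ /=]].
      by rewrite gx (negPf jr).
    by rewrite fineD ?fin_num_measure.
  rewrite eqEsubset; split => x; rewrite /U /= in_cons.
    by move=> [Bx /orP[/eqP gx|gx]]; [left|right].
  by move=> [[Bx /= ->]|[Bx gx]]; rewrite ?eqxx // gx orbT.
rewrite -key ?index_enum_uniq //; congr pr.
rewrite eqEsubset; split => x; last by case.
by move=> Bx; split => //=; rewrite mem_index_enum.
Qed.

End FinitePartition.

Section Coding.
Variables (R : realType) (M : nat).
Notation I := 'I_M.+1.
Variable f : seq I -> R.
Hypotheses (f1 : f [::] = 1) (f0 : forall w, 0 <= f w)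
  (fS : forall w, \sum_i f (rcons w i) = f w).

Let head w (i : nat) := \sum_(j < i) f (rcons w (inord j)).

(** Left end point of the interval of [0, 1[ coded by [w]; the intervals of the
    words of a given length are arranged in lexicographic order. *)
Definition left_end (w : seq I) : R :=
  \sum_(k < size w) head (take k w) (nth ord0 w k).

Definition coded (w : seq I) (r : R) := left_end w <= r < left_end w + f w.

Lemma left_end_rcons w i : left_end (rcons w i) = left_end w + head w i.
Proof.
rewrite /left_end size_rcons big_ord_recr /=; congr (_ + _).
  apply: eq_bigr => k _; rewrite -cats1 take_cat ltn_ord nth_cat ltn_ord.
  by [].
by rewrite -cats1 take_size_cat // nth_cat ltnn subnn.
Qed.

Let headS w i : head w i.+1 = head w i + f (rcons w (inord i)).
Proof. by rewrite /head big_ord_recr. Qed.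

Let head_mono w i j : (i <= j)%N -> head w i <= head w j.
Proof.
move=> /subnK <-; elim: (j - i)%N => [//|k IH].
by rewrite addSn headS; apply: le_trans IH _; rewrite lerDl.
Qed.

Let head_full w : head w M.+1 = f w.
Proof. by rewrite -fS /head; apply: eq_bigr => i _; rewrite inord_val. Qed.

Let headE w (i : I) : head w i.+1 = head w i + f (rcons w i).
Proof. by rewrite headS inord_val. Qed.

Lemma coded_rcons w i r : coded (rcons w i) r -> coded w r.
Proof.
rewrite /coded left_end_rcons -addrA -headE => /andP[r1 r2]; apply/andP; split.
  by apply: le_trans r1; rewrite lerDl sumr_ge0.
by apply: lt_le_trans r2 _; rewrite lerD2l -head_full head_mono.
Qed.

Lemma coded_ex w r : coded w r -> exists i, coded (rcons w i) r.
Proof.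
rewrite /coded => /andP[r1 r2].
have ex : exists i, r < left_end w + head w i by exists M.+1; rewrite head_full.
case: (ex_minnP ex) => m rm mmin.
case: m rm mmin => [|m] rm mmin.
  by move: rm; rewrite /head big_ord0 addr0 ltNge r1.
have mM : (m < M.+1)%N by apply: mmin; rewrite head_full.
exists (Ordinal mM); rewrite left_end_rcons -addrA -(headE w (Ordinal mM)) rm andbT leNgt.
by apply/negP => /mmin; rewrite ltnn.
Qed.

Lemma coded_inj w w' r : size w = size w' -> coded w r -> coded w' r -> w = w'.
Proof.
elim/last_ind: w w' => [|w i IH] w'; first by case: w'.
case/lastP: w' => [|w' i']; rewrite !size_rcons // => -[sw] c c'.
have E := IH _ sw (coded_rcons c) (coded_rcons c'); rewrite -E in c' *.
congr rcons; apply/val_inj/eqP; rewrite eqn_leq.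
move: c c'; rewrite /coded !left_end_rcons -!addrA -!headE => /andP[a1 a2] /andP[b1 b2].
apply/andP; split; rewrite leqNgt; apply/negP => lt; have h1 := head_mono w lt.
  have : r < r by apply: lt_le_trans b2 _; apply: le_trans a1; rewrite lerD2l.
  by rewrite ltxx.
have : r < r by apply: lt_le_trans a2 _; apply: le_trans b1; rewrite lerD2l.
by rewrite ltxx.
Qed.

(** Points outside [0, 1[ receive the default letter at each step. *)
Fixpoint code n (r : R) : seq I := if n is n'.+1 then
  rcons (code n' r) (odflt ord0 [pick i | coded (rcons (code n' r) i) r]) else [::].

Lemma size_code n r : size (code n r) = n.
Proof. by elim: n => //= n IH; rewrite size_rcons IH. Qed.

Lemma coded_code n r : 0 <= r < 1 -> coded (code n r) r.
Proof.
move=> r01; elim: n => [|n IH] /=; first by rewrite /coded /left_end big_ord0 add0r f1.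
case: pickP => [i //|H]; have [i ci] := coded_ex IH.
by rewrite H in ci.
Qed.

Lemma code_eq w r : 0 <= r < 1 -> (code (size w) r = w) <-> coded w r.
Proof.
move=> r01; split => [<-|c]; first exact: coded_code.
by apply: coded_inj (coded_code _ r01) c; rewrite size_code.
Qed.

Lemma coded_01 w r : coded w r -> 0 <= r < 1.
Proof.
elim/last_ind: w => [|w i IH]; last by move=> /coded_rcons.
by rewrite /coded /left_end big_ord0 add0r f1.
Qed.

Lemma code_out n r : ~~ (0 <= r < 1) -> code n r = nseq n ord0.
Proof.
move=> r01; elim: n => [//|n IH] /=; rewrite IH; case: pickP => [i|_] /=.
  by move=> /coded_01; rewrite (negPf r01).
by rewrite -cats1 -(nseqD n 1) addn1.
Qed.

Lemma measurable_code w : measurable [set r : R | code (size w) r = w].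
Proof.
have -> : [set r : R | code (size w) r = w] =
    `[left_end w, left_end w + f w[%classic `|`
    (if w == nseq (size w) ord0 then ~` `[0, 1[%classic else set0).
  rewrite eqEsubset; split => r /=.
    case: (boolP (0 <= r < 1)) => r01; first by move/(code_eq _ r01) => c; left; rewrite in_itv.
    rewrite (code_out _ r01) => E; right; rewrite E eqxx /=.
    by rewrite in_itv /= (negPf r01).
  move=> [c|].
    rewrite in_itv /= in c; by apply/(code_eq w (coded_01 c)).
  case: eqP => // E; rewrite /= in_itv /= => /negP r01.
  by rewrite (code_out _ r01) -E.
by apply: measurableU; [exact: measurable_itv|case: ifP => _; [apply: measurableC; exact: measurable_itv|exact: measurable0]].
Qed.

(** The points of [0, 1[ coded by [w] form an interval of length [f w]. *)
Lemma code_prob w :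
  uniform_prob (@ltr01 R) [set r : R | code (size w) r = w] = (f w)%:E.
Proof.
have le0 : 0 <= left_end w by rewrite /left_end sumr_ge0 // => k _; exact: sumr_ge0.
have le1 : left_end w + f w <= 1.
  elim/last_ind: (w) => [|u i IH]; first by rewrite /left_end big_ord0 add0r f1.
  by apply: le_trans IH; rewrite left_end_rcons -addrA -headE lerD2l -head_full head_mono.
rewrite /uniform_prob integral_uniform_pdf.
set S := [set r : R | code (size w) r = w].
have mS : measurable S := measurable_code w.
have -> : S `&` `[0, 1] = `[left_end w, left_end w + f w[ `|` (S `&` [set 1]).
  rewrite eqEsubset; split => r /=; rewrite in_itv /=.
    move=> [Sr /andP[r0]]; rewrite le_eqVlt => /predU1P[r1|r1]; first by right.
    by left; rewrite in_itv /=; apply/code_eq => //; rewrite r0.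
  move=> [|[Sr rE]]; last by split => //; rewrite rE [_ \in _]in_itv /= ler01 lexx.
  rewrite in_itv /= => c; have r01 := coded_01 c; split.
    by apply/(code_eq _ r01).
  by case/andP: r01 => -> /ltW ->.
rewrite (eq_integral (fun=> 1%E)); last first.
  move=> r; rewrite inE => H; rewrite /uniform_pdf subr0 invr1.
  case: H => [|[_ ->]]; last by rewrite ler01 lexx.
  by rewrite /= in_itv /= => /coded_01/andP[-> /ltW ->].
have mA : measurable `[left_end w, left_end w + f w[%classic by exact: measurable_itv.
have mB : measurable (S `&` [set 1]) by apply: measurableI.
have B0 : lebesgue_measure (S `&` [set 1]) = 0%E.
  apply/eqP; rewrite eq_le measure_ge0 andbT -(lebesgue_measure_set1 (1 : R)).
  by apply: le_measure; rewrite ?inE //; move=> r [].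
have muA : lebesgue_measure `[left_end w, left_end w + f w[%classic = (f w)%:E.
  rewrite lebesgue_measure_itv /= lte_fin ltrDl.
  case: ifP => [_|/negbT]; first by rewrite -EFinB addrC addKr.
  by rewrite -leNgt => fw0; congr EFin; apply/le_anti; rewrite f0 fw0.
rewrite integral_cst //; last exact: measurableU.
rewrite mul1e measureU //; last first.
  rewrite eqEsubset; split => // r [] /=; rewrite in_itv /= => /coded_01/andP[_ r1] [_ rE].
  by rewrite rE ltxx in r1.
rewrite [X in (_ + X)%E](_ : _ = 0%E); last exact: B0.
rewrite adde0; exact: muA.
Qed.

End Coding.

(** * From word measures to two-sided measures *)

Section CylinderMeasure.
Variables (R : realType) (M : nat).
Notation X := (fullshift M).
Notation I := 'I_M.+1.
Variable mu : probability (borel X) R.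

Lemma measurable_open (U : set X) : open U -> measurable (U : set (borel X)).
Proof. by move=> oU; exact: sub_sigma_algebra. Qed.

Lemma measurable_Cyl a (w : seq I) : measurable (Cyl a w : set (borel X)).
Proof. by apply: measurable_open; exact: open_Cyl. Qed.

Lemma pr_Cyl_rcons a (w : seq I) : pr mu (Cyl a w) = \sum_i pr mu (Cyl a (rcons w i)).
Proof.
rewrite (@pr_partition _ _ _ mu I (fun x : X => x (a + (size w)%:Z))); first last.
- by move=> i; apply: measurable_open; exact: (open_coord _ [set i]).
- exact: measurable_Cyl.
apply: eq_bigr => i _; congr pr; rewrite eqEsubset; split => x; rewrite /Cyl /= size_rcons block_rcons.
  by move=> [-> ->].
by move=> /rcons_inj[-> ->].
Qed.

Lemma pr_Cyl_cons a (w : seq I) : pr mu (Cyl (a + 1) w) = \sum_i pr mu (Cyl a (i :: w)).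
Proof.
rewrite (@pr_partition _ _ _ mu I (fun x : X => x a)); first last.
- by move=> i; apply: measurable_open; exact: (open_coord _ [set i]).
- exact: measurable_Cyl.
apply: eq_bigr => i _; congr pr; rewrite eqEsubset; split => x; rewrite /Cyl /= blockS.
  by move=> [-> ->].
by move=> [-> ->].
Qed.

End CylinderMeasure.

Section TwoSided.
Variables (R : realType) (M : nat).
Notation X := (fullshift M).
Notation I := 'I_M.+1.
Variable p : seq I -> R.
Hypothesis wm : word_measure p.

(** Letters are read in the order of the coordinates 0, -1, 1, -2, 2 and so on,
    so that initial segments correspond to blocks. *)
Definition unfold_step (v : seq I) i := if odd (size v) then i :: v else rcons v i.
Definition unfold_word (w : seq I) := foldl unfold_step [::] w.
Definition coord_rank (z : int) : nat := match z with Posz k => k.*2 | Negz k => k.*2.+1 end.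

Lemma unfold_rcons w i : unfold_word (rcons w i) = unfold_step (unfold_word w) i.
Proof. by rewrite /unfold_word foldl_rcons. Qed.

Lemma size_unfold w : size (unfold_word w) = size w.
Proof.
elim/last_ind: w => [//|w i IH]; rewrite unfold_rcons size_rcons /unfold_step.
by case: ifP; rewrite /= ?size_rcons IH.
Qed.

Lemma unfold_inj : injective unfold_word.
Proof.
move=> w w' E; have : size w = size w' by rewrite -size_unfold E size_unfold.
elim/last_ind: w w' E => [|w i IH] w'; first by case: w'.
case/lastP: w' => [|w' i']; first by rewrite size_rcons.
rewrite !unfold_rcons !size_rcons /unfold_step !size_unfold => E [sw]; move: E.
rewrite sw; case: ifP => _; first by move=> [-> /IH ->].
by move=> /rcons_inj[/IH -> // ->].
Qed.

Lemma unfold_surj v : exists w, unfold_word w = v.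
Proof.
have [n sv] : exists n, size v = n by exists (size v).
elim: n v sv => [|n IH] v sv; first by exists [::]; case: v sv.
have [on|en] := boolP (odd n).
  case: v sv => // i v [/[dup] sv /IH[w wE]]; exists (rcons w i).
  by rewrite unfold_rcons wE /unfold_step sv on.
case/lastP: v sv => // v i; rewrite size_rcons => -[/[dup] sv /IH[w wE]].
by exists (rcons w i); rewrite unfold_rcons wE /unfold_step sv (negPf en).
Qed.

Let f w := p (unfold_word w).
Let f1 : f [::] = 1. Proof. by have [? _ _ _] := wm. Qed.
Let f0 w : 0 <= f w. Proof. by have [_ ? _ _] := wm; rewrite /f. Qed.
Let fS w : \sum_i f (rcons w i) = f w.
Proof.
have [_ _ pR pL] := wm; rewrite /f; under eq_bigr do rewrite unfold_rcons /unfold_step.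
by case: (odd (size (unfold_word w))); [exact: pL|exact: pR].
Qed.

Definition point_of (r : R) : X := fun z => nth ord0 (code f (coord_rank z).+1 r) (coord_rank z).

Lemma unfold_code n r : unfold_word (code f n r) = block (point_of r) (- (n./2)%:Z) n.
Proof.
elim: n => [//|n IH].
have [i iE] : exists i, code f n.+1 r = rcons (code f n r) i by eexists.
have iE' : nth ord0 (code f n.+1 r) n = i by rewrite iE nth_rcons size_code ltnn eqxx.
rewrite iE unfold_rcons IH /unfold_step size_block.
have [on|en] := boolP (odd n).
  rewrite blockS; have -> : - (n.+1./2)%:Z = Negz n./2.
    by rewrite NegzE; congr (- _%:Z); rewrite /= uphalf_half on.
  have -> : Negz n./2 + 1 = - (n./2)%:Z by rewrite NegzE; lia.
  congr cons; rewrite /point_of [coord_rank _]/=.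
  by have := odd_double_half n; rewrite on add1n => ->; rewrite iE'.
rewrite block_rcons; have -> : n.+1./2 = n./2 by rewrite /= uphalf_half (negPf en).
congr rcons; have -> : - (n./2)%:Z + n%:Z = (n./2)%:Z.
  by have := odd_double_half n; rewrite (negPf en); lia.
rewrite /point_of [coord_rank _]/=.
by have := odd_double_half n; rewrite (negPf en) add0n => ->; rewrite iE'.
Qed.

Lemma measurable_point_of : measurable_fun [set: measurableTypeR R] (point_of : measurableTypeR R -> borel X).
Proof.
apply: (@measurability _ _ (measurableTypeR R) (borel X) setT point_of (@open X : set (set (borel X)))) => //.
move=> _ [U oU <-]; rewrite setTI.
pose S (w : seq I) := [set r : R | code f (size w) r = w].
pose D := [set w | S w `<=` point_of @^-1` U].
have -> : point_of @^-1` U = \bigcup_(w in D) S w.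
  rewrite eqEsubset; split => [r Ur|r [w Dw Sw]]; last exact: Dw.
  have [n Hn] := open_block oU Ur.
  have sc : size (code f n.*2.+1 r) = n.*2.+1 by rewrite size_code.
  exists (code f n.*2.+1 r); last by rewrite -[S _ r]/(code f (size _) r = _) sc.
  move=> r' E; apply: Hn => i ni.
  have {}E : code f n.*2.+1 r' = code f n.*2.+1 r by rewrite -{1}sc; exact: E.
  have := congr1 unfold_word E; rewrite !unfold_code => /block_eq H.
  have -> : i = - (n.*2.+1./2)%:Z + (absz (i + n%:Z))%:Z.
    by rewrite /= uphalf_double; lia.
  by apply: H; lia.
rewrite (_ : \bigcup_(w in D) S w = \bigcup_w ([set r | D w] `&` S w)); last first.
  rewrite eqEsubset; split => r [w].
    by move=> Dw Sw; exists w.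
  by move=> _ [Dw Sw]; exists w.
apply: countable_bigcupT_measurable; first exact: countableP.
move=> w; apply: measurableI; last exact: (measurable_code f1 f0 fS w).
have [Dw|nDw] := pselect (D w).
  by rewrite (_ : [set r | D w] = setT) // eqEsubset; split.
by rewrite (_ : [set r | D w] = set0) // eqEsubset; split.
Qed.

(** Coding the weights of unfolded words pushes Lebesgue measure to a measure with
    the right mass on centered blocks; the other blocks are unions of these. *)
Lemma exists_two_sided : exists mu : probability (borel X) R,
  forall a w, pr mu (Cyl a w) = p w.
Proof.
pose T : {mfun (measurableTypeR R) >-> borel X} :=
  HB.pack (point_of : measurableTypeR R -> borel X)
  (isMeasurableFun.Build _ _ _ _ (point_of : measurableTypeR R -> borel X) measurable_point_of).
pose mu := distribution (uniform_prob (@ltr01 R)) T.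
exists mu.
have central v : pr mu (Cyl (- ((size v)./2)%:Z) v) = p v.
  have [w wE] := unfold_surj v; rewrite -wE size_unfold.
  have E : T @^-1` Cyl (- (size w)./2%:Z) (unfold_word w) = [set r | code f (size w) r = w].
    rewrite eqEsubset; split => r; rewrite /Cyl /= size_unfold -unfold_code.
      by move=> /unfold_inj.
    by move=> ->.
  have -> : pr mu (Cyl (- (size w)./2%:Z) (unfold_word w)) =
      fine (uniform_prob (@ltr01 R) (T @^-1` Cyl (- (size w)./2%:Z) (unfold_word w))) by [].
  by rewrite E (code_prob f1 f0 fS).
have [_ _ pR pL] := wm.
have inner n r : forall l v, (size v + l + r)%N = n ->
    pr mu (Cyl (- (n./2)%:Z + l%:Z) v) = p v.
  elim: r => [|r IHr] l v sv; last first.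
    rewrite pr_Cyl_rcons -pR; apply: eq_bigr => i _; apply: IHr.
    by rewrite size_rcons -sv; lia.
  elim: l v sv => [|l IHl] v sv.
    by rewrite addr0 -sv !addn0 central.
  have -> : - (n./2)%:Z + l.+1%:Z = - (n./2)%:Z + l%:Z + 1 by rewrite -addrA -PoszD addn1.
  rewrite pr_Cyl_cons -pL; apply: eq_bigr => i _; apply: IHl.
  by rewrite -sv /=; lia.
move=> a w; pose h := (absz a + size w)%N.
pose l := absz (a + h%:Z).
have -> : a = - ((h.*2)./2)%:Z + l%:Z by rewrite doubleK /l /h; lia.
by apply: (inner _ (h.*2 - (size w + l))%N); rewrite /l /h; lia.
Qed.

End TwoSided.

(** * Invariant measures determined by cylinders *)

Section Consequences.
Variables (R : realType) (M : nat).
Notation X := (fullshift M).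
Notation I := 'I_M.+1.
Implicit Type mu : probability (borel X) R.

Definition central_cylinders : set (set X) :=
  [set B | B = set0 \/ exists n w, size w = n.*2 /\ B = Cyl (- n%:Z) w].

Let central_sub n m w v : (n <= m)%N -> size w = n.*2 -> size v = m.*2 ->
  Cyl (M := M) (- n%:Z) w `&` Cyl (- m%:Z) v = set0 \/
  Cyl (M := M) (- n%:Z) w `&` Cyl (- m%:Z) v = Cyl (- m%:Z) v.
Proof.
move=> nm sw sv.
have [[x [xw xv]]|H] := pselect (exists x, (Cyl (M := M) (- n%:Z) w `&` Cyl (- m%:Z) v) x).
  right; rewrite eqEsubset; split => y; first by case.
  move=> yv; split => //; rewrite /Cyl /= -[RHS]xw.
  apply: eq_block => k; rewrite sw => kn.
  have E : block y (- m%:Z) m.*2 = block x (- m%:Z) m.*2 by rewrite -sv xv yv.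
  have -> : - n%:Z + k%:Z = - m%:Z + (m - n + k)%N%:Z by lia.
  by apply: (block_eq E); lia.
by left; rewrite -subset0 => x Hx; apply: H; exists x.
Qed.

Let central_setI : setI_closed central_cylinders.
Proof.
have sub0 (B : set X) : central_cylinders B -> central_cylinders (B `&` B) by rewrite setIid.
move=> B C [->|[n [w [sw ->]]]]; first by move=> _; left; rewrite set0I.
move=> [->|[m [v [sv ->]]]]; first by left; rewrite setI0.
case: (leqP n m) => [nm|/ltnW nm].
  by have [->|->] := central_sub nm sw sv; [left|right; exists m, v].
by rewrite setIC; have [->|->] := central_sub nm sv sw; [left|right; exists n, w].
Qed.

(** An open set is a countable union of central cylinders. *)
Lemma measurable_central (B : set (borel X)) : measurable B -> <<s central_cylinders >> B.
Proof.
apply: smallest_sub; first exact: smallest_sigma_algebra.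
move=> U oU.
pose D := [set w : seq I | Cyl (- ((size w)./2)%:Z) w `<=` U /\ ~~ odd (size w)].
have -> : U = \bigcup_w ([set x : X | D w] `&` Cyl (- ((size w)./2)%:Z) w).
  rewrite eqEsubset; split => [x Ux|x [w _ [[wU _] xw]]]; last exact: wU.
  have [n Hn] := open_block oU Ux.
  have sb : size (block x (- n%:Z) n.*2) = n.*2 by rewrite size_block.
  exists (block x (- n%:Z) n.*2) => //; rewrite /D /= sb doubleK odd_double.
  split; last by rewrite /Cyl /= sb.
  split=> // y; rewrite /Cyl /= sb => E; apply: Hn => i ni.
  have -> : i = - n%:Z + (absz (i + n%:Z))%:Z by lia.
  by apply: (block_eq E); lia.
apply: (@countable_bigcupT_measurable _ (g_sigma_algebraType central_cylinders)).
  exact: countableP.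
move=> w; have [Dw|nDw] := pselect (D w).
  rewrite (_ : _ `&` _ = Cyl (- ((size w)./2)%:Z) w); last first.
    by rewrite eqEsubset; split => x; [case|].
  apply: sub_sigma_algebra; right; exists (size w)./2, w; split => //.
  by case: Dw => _ ew; rewrite even_halfK.
by rewrite (_ : _ `&` _ = set0) // eqEsubset; split => // x [].
Qed.

(** Central cylinders are stable under intersection and generate the Borel sets. *)
Lemma eq_measure_Cyl (m1 m2 : probability (borel X) R) :
  (forall a w, pr m1 (Cyl a w) = pr m2 (Cyl a w)) ->
  forall B : set (borel X), measurable B -> m1 B = m2 B.
Proof.
move=> E B /measurable_central mB.
apply: (@g_sigma_algebra_measure_unique _ R (borel X) central_cylinders _ (fun=> setT)) => //.
- move=> _ [->|[n [w [_ ->]]]]; first exact: measurable0.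
  exact: measurable_Cyl.
- move=> _; right; exists 0%N, [::]; split => //.
  by rewrite eqEsubset; split.
- by rewrite bigcup_const //; exists 0%N.
- move=> _ [->|[n [w [_ ->]]]]; first by rewrite !measure0.
  have mC := @measurable_Cyl M (- n%:Z) w.
  by have := E (- n%:Z) w; rewrite /pr => H; rewrite -[LHS]fineK ?fin_num_measure // H fineK ?fin_num_measure.
- by move=> _; apply: le_lt_trans (probability_le1 m1 _) (ltry 1).
Qed.

Lemma Cyl_shift a w : @left_shift M @^-1` Cyl a w = Cyl (a + 1) w.
Proof. by rewrite eqEsubset; split => x; rewrite /Cyl /= block_shift. Qed.

Lemma measurable_shift : measurable_fun [set: borel X] (@left_shift M : borel X -> borel X).
Proof.
apply: (@measurability _ _ (borel X) (borel X) setT _ central_cylinders).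
  rewrite eqEsubset; split => B; first exact: measurable_central.
  apply: smallest_sub; first exact: sigma_algebra_measurable.
  move=> _ [->|[n [w [_ ->]]]]; first exact: measurable0.
  exact: measurable_Cyl.
move=> _ [_ [->|[n [w [_ ->]]]] <-]; rewrite setTI.
  by rewrite preimage_set0; exact: measurable0.
by rewrite Cyl_shift; exact: measurable_Cyl.
Qed.

Lemma pr_Cyl_shift_invariant mu : shift_invariant mu ->
  forall a w, pr mu (Cyl a w) = pr mu (Cyl 0 w).
Proof.
move=> inv; have step a w : pr mu (Cyl (a + 1) w) = pr mu (Cyl a w).
  by rewrite -Cyl_shift /pr inv //; exact: measurable_Cyl.
have pos n w : pr mu (Cyl n%:Z w) = pr mu (Cyl 0 w).
  by elim: n => [//|n IH]; rewrite -addn1 PoszD step.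
case=> [n|n] w; first exact: pos.
elim: n => [|n IH]; first by rewrite -(step (Negz 0)); congr (pr mu (Cyl _ w)).
by rewrite -IH -(step (Negz n.+1)); congr (pr mu (Cyl _ w)); rewrite !NegzE; lia.
Qed.

Lemma iter_shiftE n (x : X) z : iter n (@left_shift M) x z = x (z + n%:Z).
Proof.
elim: n z => [|n IH] z; first by rewrite addr0.
by rewrite iterS {1}/left_shift IH -addrA -PoszD add1n.
Qed.

Section WithWeights.
Variables (mu : probability (borel X) R) (p : seq I -> R).
Hypothesis muE : forall a w, pr mu (Cyl a w) = p w.

Lemma Cyl_shift_invariant : shift_invariant mu.
Proof.
move=> B mB.
pose T : {mfun borel X >-> borel X} := HB.pack (@left_shift M : borel X -> borel X)
  (isMeasurableFun.Build _ _ _ _ (@left_shift M : borel X -> borel X) measurable_shift).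
apply: (@eq_measure_Cyl (distribution mu T) mu) => // a w.
by rewrite muE -(muE (a + 1)) -Cyl_shift.
Qed.

Definition tblock n (x : X) (a : int) : n.-tuple I := Tuple (introT eqP (size_block x a n)).

Lemma measurable_tblock n a (k : n.-tuple I) :
  measurable ((fun x : borel X => tblock n x a) @^-1` [set k]).
Proof.
rewrite (_ : _ @^-1` _ = Cyl a k); first exact: measurable_Cyl.
rewrite eqEsubset; split => x; rewrite /Cyl /= size_tuple; first by move=> <-.
by move=> E; apply: val_inj.
Qed.

Lemma pr_joint a u n w :
  pr mu (Cyl a u `&` Cyl (a + (size u + n)%:Z) w) = \sum_(k : n.-tuple I) p (u ++ k ++ w).
Proof.
rewrite (@pr_partition _ _ _ mu _ (fun x => tblock n x (a + (size u)%:Z))); first last.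
- by move=> k; exact: measurable_tblock.
- by apply: measurableI; exact: measurable_Cyl.
apply: eq_bigr => k _; rewrite -(muE a); congr pr.
rewrite eqEsubset; split => x; rewrite /Cyl /= !size_cat size_tuple.
  move=> [[xu xw] xk]; rewrite block_cat block_cat xu.
  by rewrite -(congr1 val xk) /= -addrA -PoszD xw.
rewrite block_cat block_cat => /eqP; rewrite eqseq_cat ?size_block // => /andP[/eqP xu].
rewrite eqseq_cat ?size_block ?size_tuple // => /andP[/eqP xk /eqP xw].
by split; [split => //; rewrite PoszD addrA|apply: val_inj].
Qed.

Lemma sum_weights n : \sum_(w : n.-tuple I) p w = 1.
Proof.
rewrite -(pr_setT mu) (@pr_partition _ _ _ mu _ (fun x => tblock n x 0)) //; last exact: measurable_tblock.
apply: eq_bigr => k _; rewrite -(muE 0); congr pr.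
rewrite setTI eqEsubset; split => x; rewrite /Cyl /= size_tuple; last by move=> <-.
by move=> E; apply: val_inj.
Qed.

Hypotheses (p0 : forall w, 0 <= p w) (mix : psi_mixing p).

Let joinE m n (w : {ffun 'I_n -> alphabet M}) :
  join_partition (T := borel X) (@left_shift M) (@standard_partition M) m w = Cyl m%:Z (codom w).
Proof.
rewrite eqEsubset; split => x; rewrite /join_partition /standard_partition /Cyl /= size_codom card_ord => H.
  apply: (@eq_from_nth _ ord0) => [|k]; rewrite size_block ?size_codom ?card_ord //.
  move=> kn; rewrite nth_block // -[k]/(nat_of_ord (Ordinal kn)) codomE.
  rewrite (nth_map (Ordinal kn)) ?size_enum_ord // nth_ord_enum -H iter_shiftE.
  by rewrite add0r PoszD.
move=> k; rewrite iter_shiftE add0r PoszD.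
rewrite -(nth_block _ _ (ltn_ord k)) H codomE (nth_map k) ?size_enum_ord //.
by rewrite nth_ord_enum.
Qed.

(** A relative error is not affected by summation over all pairs of words. *)
Lemma weak_bernoulli_of_mixing : weak_bernoulli mu.
Proof.
have [D [gamma [D0 /andP[g0 g1] HD]]] := mix.
move=> eps eps0; have g01 : 0 <= gamma < 1 by rewrite ltW.
have [N HN] := geometric_small D g01 (divr_gt0 eps0 (ltr0n R 2)).
exists N => r s m sm; rewrite /eps_independent.
have sum1 n a : \sum_(w : {ffun 'I_n -> alphabet M}) pr mu (Cyl a (codom w)) = 1.
  rewrite -(sum_weights n); under eq_bigr do rewrite muE.
  rewrite (reindex (fun w : n.-tuple I => [ffun k => tnth w k])) /=.
    apply: eq_bigr => w _; congr p; apply: (@eq_from_nth _ ord0) => [|k].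
      by rewrite size_codom card_ord size_tuple.
    rewrite size_codom card_ord => kn; rewrite codomE -[k]/(nat_of_ord (Ordinal kn)).
    rewrite (nth_map (Ordinal kn)) ?size_enum_ord // nth_ord_enum ffunE.
    by rewrite (tnth_nth ord0).
  exists (fun w => [tuple w k | k < n]) => w _.
    by apply: eq_from_tnth => k; rewrite tnth_mktuple ffunE.
  by apply/ffunP => k; rewrite ffunE tnth_mktuple.
apply: (@le_lt_trans _ _ (\sum_(u : {ffun 'I_s -> alphabet M}) \sum_(w : {ffun 'I_r -> alphabet M})
   eps / 2 * (pr mu (Cyl 0 (codom u)) * pr mu (Cyl m%:Z (codom w))))).
  apply: ler_sum => u _; apply: ler_sum => w _.
  rewrite !joinE -/(pr mu _) -/(pr mu _) -/(pr mu _).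
  have sm' : (s <= m)%N by apply: leq_trans sm; exact: leq_addr.
  have mE : m%:Z = 0 + (size (codom u) + (m - s))%:Z.
    by rewrite size_codom card_ord add0r subnKC.
  rewrite {1}mE pr_joint !muE; apply: le_trans (HD _ _ _) _.
  rewrite ler_wpM2r ?mulr_ge0 //; apply: HN; lia.
under eq_bigr do rewrite -mulr_sumr -mulr_sumr sum1 mulr1.
by rewrite -mulr_sumr sum1 mulr1; lra.
Qed.

End WithWeights.
End Consequences.

(** * Uniqueness of Gibbs word measures *)

Section Uniqueness.
Variables (R : realType) (I : finType).
Implicit Types p q : seq I -> R.

Lemma word_measure_catl q : word_measure q -> forall n w,
  \sum_(u : n.-tuple I) q (u ++ w) = q w.
Proof.
move=> [_ _ _ qr] n w; elim: n => [|n IH]; first exact: (sum_word0 (fun u => q (u ++ w))).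
rewrite (sum_word_cons _ (fun u => q (u ++ w))) exchange_big -[RHS]IH.
by apply: eq_bigr => u _; exact: qr.
Qed.

Lemma word_measure_catr q : word_measure q -> forall n w,
  \sum_(u : n.-tuple I) q (w ++ u) = q w.
Proof.
move=> [_ _ ql _] n; elim: n => [|n IH] w.
  by rewrite (sum_word0 (fun u => q (w ++ u))) cats0.
rewrite (sum_word_cons _ (fun u => q (w ++ u))) -ql.
apply: eq_bigr => i _; rewrite -IH; apply: eq_bigr => u _.
by rewrite cat_rcons.
Qed.

Lemma word_measure_sum1 q : word_measure q -> forall n, \sum_(u : n.-tuple I) q u = 1.
Proof.
move=> wq n; have := word_measure_catr wq n [::].
by case: wq => -> *.
Qed.

(** Otherwise the values at the multiples of [K] would grow linearly. *)
Lemma small_increment (a : nat -> R) (C e : R) (K : nat) : 0 < e ->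
  (forall n, 0 <= a n <= C) -> exists n, a (n + K)%N - a n <= e.
Proof.
move=> e0 a0; apply: contrapT => /forallNP H.
have grow j : j%:R * e <= a (j * K)%N.
  elim: j => [|j IH]; first by rewrite mul0r mul0n; have /andP[] := a0 0%N.
  have /negP := H (j * K)%N; rewrite -ltNge => h.
  by rewrite mulSnr -natr1 mulrDl mul1r; lra.
have [n nC] : exists n : nat, C / e < n%:R.
  by exists (Num.truncn `|C / e|).+1; apply: le_lt_trans (ler_norm _) _; rewrite truncnS_gt.
have /andP[_ h] := a0 (n * K)%N.
by move: nC; rewrite ltr_pdivrMr // => nC; have := grow n; lra.
Qed.

Section Comparison.
Variables p q : seq I -> R.
Hypotheses (wp : word_measure p) (wq : word_measure q) (mix : psi_mixing p).
Variable C : R.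
Hypotheses (qp : forall w, q w <= C * p w) (p0 : forall w, 0 < p w).

Let q0 w : 0 <= q w. Proof. by case: wq => _ /(_ w). Qed.

Definition density w := q w / p w.

Let densityM w : density w * p w = q w.
Proof. by rewrite /density divfK // gt_eqF. Qed.

(** The second moment of the density on words of length [n]. *)
Definition energy n := \sum_(u : n.-tuple I) density u * q u.

Lemma energy_bounds n : 0 <= energy n <= C.
Proof.
have d0 w : 0 <= density w <= C by rewrite /density divr_ge0 ?(ltW (p0 w)) //= ler_pdivrMr.
apply/andP; split.
  by apply: sumr_ge0 => u _; rewrite mulr_ge0 //; case/andP: (d0 u).
rewrite -[leRHS]mulr1 -(word_measure_sum1 wq n) mulr_sumr; apply: ler_sum => u _.
by rewrite ler_wpM2r //; case/andP: (d0 u).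
Qed.

(** Successive densities form a martingale, so their increments are orthogonal. *)
Lemma energy_increment n k : energy (n + k) - energy n =
  \sum_(u : n.-tuple I) \sum_(v : k.-tuple I)
    (density (u ++ v) - density u) ^+ 2 * p (u ++ v).
Proof.
rewrite /energy (sum_word_cat _ _ (fun w => density w * q w)) -sumrB.
apply: eq_bigr => u _.
have E v : (density (u ++ v) - density u) ^+ 2 * p (u ++ v) =
    density (u ++ v) * q (u ++ v) + (- (2 * density u)) * q (u ++ v) + density u ^+ 2 * p (u ++ v).
  by rewrite -(densityM (u ++ v)); ring.
under [RHS]eq_bigr do rewrite E.
rewrite !big_split /= -!mulr_sumr (word_measure_catr wq) (word_measure_catr wp).
by rewrite -(densityM u); ring.
Qed.

(** If the energy hardly increases past time [n], then [q] gives a word seen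
    after a gap the mass obtained by reweighting the past with the density of
    [q] and drawing the future from [p]; there mixing of [p] takes over. *)
Lemma absolutely_continuous_eq w : q w = p w.
Proof.
have [D [gamma [D0 /andP[g0 g1] HD]]] := mix.
suff key e : 0 < e -> `|q w - p w| <= 2 * e.
  apply/eqP; rewrite -subr_eq0 -normr_le0 leNgt; apply/negP => h.
  have := key _ (divr_gt0 h (ltr0n R 4)).
  by move: h; move: (`|_|) => z; lra.
move=> e0; have g01 : 0 <= gamma < 1 by rewrite ltW.
have [m Hm] := geometric_small (D * p w) g01 e0.
have {Hm} Hm : D * gamma ^+ m * p w <= e by rewrite mulrAC; exact: Hm.
have e20 : 0 < e ^+ 2 by rewrite exprn_gt0.
have [n Hn] := small_increment (m + size w) e20 energy_bounds.
pose mid := \sum_(u : n.-tuple I) \sum_(k : m.-tuple I) density u * p (u ++ k ++ w).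
have near_p : `|mid - p w| <= e.
  have -> : mid - p w = \sum_(u : n.-tuple I) density u * (\sum_(k : m.-tuple I) p (u ++ k ++ w) - p u * p w).
    have E : p w = \sum_(u : n.-tuple I) density u * (p u * p w).
      under eq_bigr do rewrite mulrA densityM.
      by rewrite -mulr_suml (word_measure_sum1 wq) mul1r.
    by rewrite [in LHS]E /mid -sumrB; apply: eq_bigr => u _; rewrite mulrBr mulr_sumr.
  apply: le_trans (ler_norm_sum _ _ _) _; rewrite -[leRHS]mul1r -(word_measure_sum1 wq n) mulr_suml.
  apply: ler_sum => u _.
  have du : 0 <= density u by rewrite divr_ge0 // ltW.
  rewrite normrM (ger0_norm du); apply: le_trans (ler_wpM2l du (HD _ _ _)) _.
  rewrite -(densityM u) -[leRHS]mulrA ler_wpM2l // [leLHS](_ : _ = p u * (D * gamma ^+ m * p w)); last by ring.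
  by rewrite ler_wpM2l // ltW.
have near_q : `|q w - mid| <= e.
  have -> : q w = \sum_(u : n.-tuple I) \sum_(k : m.-tuple I) density (u ++ k ++ w) * p (u ++ k ++ w).
    under eq_bigr do under eq_bigr do rewrite densityM catA.
    rewrite -(sum_word_cat _ _ (fun u => q (u ++ w))).
    by rewrite (word_measure_catl wq).
  rewrite /mid -sumrB; apply: le_trans (ler_norm_sum _ _ _) _.
  (* [2 |z| <= z ^ 2 / e + e], with an increment of the energy below [e ^ 2]. *)
  pose G u v := (density (u ++ v) - density u) ^+ 2 * p (u ++ v) / e + e * p (u ++ v).
  have G0 u v : 0 <= G u v.
    have pw0 := ltW (p0 (u ++ v)); have e0W := ltW e0.
    by apply: addr_ge0; [apply: divr_ge0 => //; apply: mulr_ge0 => //; exact: sqr_ge0|exact: mulr_ge0].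
  apply: (@le_trans _ _ (\sum_(u : n.-tuple I) \sum_(v : (m + size w).-tuple I) G u v / 2)).
    apply: ler_sum => u _; rewrite -sumrB.
    apply: le_trans (ler_norm_sum _ _ _) _.
    rewrite (sum_word_cat _ _ (fun v => G u v / 2)); apply: ler_sum => k _.
    apply: (@le_trans _ _ (G u (k ++ w) / 2)); last first.
      apply: (@word_le_sum _ _ _ (fun v => G u (k ++ v) / 2)) => // v.
      by rewrite divr_ge0.
    rewrite -mulrBl normrM (gtr0_norm (p0 _)) /G.
    set x := density _ - _; have := p0 (u ++ k ++ w); move: (p _) => y y0.
    rewrite [leRHS](_ : _ = (x ^+ 2 / e + e) / 2 * y); last by ring.
    rewrite ler_pM2r // ler_pdivlMr // -(ler_pM2r e0) mulrDl divfK ?gt_eqF //.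
    rewrite -(real_normK (num_real x)); have := sqr_ge0 (`|x| - e).
    by move: (`|x|) => z; nra.
  rewrite /G; under eq_bigr do rewrite -mulr_suml big_split /= -mulr_suml -mulr_sumr (word_measure_catr wp).
  rewrite -mulr_suml big_split /= -mulr_suml -energy_increment -mulr_sumr (word_measure_sum1 wp).
  rewrite mulr1 ler_pdivrMr //.
  have : (energy (n + (m + size w)) - energy n) / e <= e by rewrite ler_pdivrMr // -expr2.
  by lra.
rewrite -(subrKA mid) (le_trans (ler_normD _ _)) // mulr_natl mulr2n lerD //.
Qed.

End Comparison.

(** Summed over all words of a length, the two estimates bound the ratio of the
    two exponential factors, so the pressures need not be compared first. *)
Lemma gibbs_comparable p q (a : seq I -> R) (C P C' P' : R) :
  word_measure p -> word_measure q -> 0 < C -> 0 < C' -> (forall w, 0 <= a w) ->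
  (forall w, C^-1 * p w <= expR (- ((size w)%:R * P)) * a w <= C * p w) ->
  (forall w, C'^-1 * q w <= expR (- ((size w)%:R * P')) * a w <= C' * q w) ->
  forall w, q w <= C' * (C * C') * C * p w.
Proof.
move=> wp wq C0 C'0 a0 Hp Hq w; pose n := size w.
pose Z := \sum_(u : n.-tuple I) a u.
have lo : C^-1 <= expR (- (n%:R * P)) * Z.
  rewrite -[leLHS]mulr1 -[X in _ * X <= _](word_measure_sum1 wp n) !mulr_sumr; apply: ler_sum => u _.
  by have /andP[+ _] := Hp u; rewrite size_tuple.
have hi : expR (- (n%:R * P')) * Z <= C'.
  rewrite -[leRHS]mulr1 -[X in _ <= _ * X](word_measure_sum1 wq n) !mulr_sumr; apply: ler_sum => u _.
  by have /andP[_] := Hq u; rewrite size_tuple.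
have /andP[_ pw] := Hp w; have /andP[qw _] := Hq w.
move: lo hi pw qw; rewrite -/n.
have := expR_gt0 (- (n%:R * P)); have := expR_gt0 (- (n%:R * P')).
move: (expR _) (expR _) (a0 w) => x y aw y0 x0 lo hi pw qw.
have yx : y <= (C * C') * x.
  have Z0 : 0 < Z.
    by rewrite -(pmulr_rgt0 _ x0); apply: lt_le_trans lo; rewrite invr_gt0.
  rewrite -(ler_pM2r Z0); apply: le_trans hi _.
  rewrite [leRHS](_ : _ = C' * (C * (x * Z))); last by ring.
  rewrite ler_peMr ?(ltW C'0) // -(divff (lt0r_neq0 C0)).
  by rewrite ler_pM2l.
rewrite ler_pdivrMl // in qw; apply: le_trans qw _.
rewrite -!mulrA ler_pM2l //; apply: le_trans (ler_wpM2r aw yx) _.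
by rewrite -!mulrA !ler_pM2l // mulrA.
Qed.

End Uniqueness.

(** * Integrals of bounded functions *)

Section BoundedIntegrals.
Context dT (T : measurableType dT) (R : realType) (mu : probability T R).
Implicit Types f g : T -> R.

Definition bounded_measurable f :=
  measurable_fun [set: T] f /\ exists B : R, forall x, `|f x| <= B.

Lemma bounded_measurable_integrable f : bounded_measurable f ->
  mu.-integrable [set: T] (EFin \o f).
Proof.
move=> [mf [B fB]]; apply: measurable_bounded_integrable => //.
  by apply: le_lt_trans (probability_le1 mu _) (ltry 1).
exists B; split; first exact: num_real.
by move=> b Bb x _ /=; apply: le_trans (fB x) (ltW Bb).
Qed.

Lemma bounded_measurableM f g : bounded_measurable f -> bounded_measurable g ->
  bounded_measurable (fun x => f x * g x).
Proof.
move=> [mf [B fB]] [mg [C gC]]; split; first exact: measurable_realfun.measurable_funM.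
by exists (B * C) => x; rewrite normrM ler_pM.
Qed.

Lemma bounded_measurableB f g : bounded_measurable f -> bounded_measurable g ->
  bounded_measurable (fun x => f x - g x).
Proof.
move=> [mf [B fB]] [mg [C gC]]; split; first exact: measurable_realfun.measurable_funB.
by exists (B + C) => x; rewrite (le_trans (ler_normB _ _)) ?lerD.
Qed.

Lemma norm_integral_le f (e : R) : bounded_measurable f -> (forall x, `|f x| <= e) ->
  `|\int[mu]_x f x| <= e.
Proof.
move=> bf fe; have If := bounded_measurable_integrable bf.
apply: le_trans (le_normr_Rintegral _ If) _; first exact: measurableT.
apply: (@le_trans _ _ (\int[mu]_x e)).
  apply: le_Rintegral => //.
    by apply: bounded_measurable_integrable; case: bf => mf [B fB]; split;
      [exact: measurableT_comp|exists B => x; rewrite normr_id].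
  by apply: bounded_measurable_integrable; split; [exact: measurable_cst|exists `|e|].
by rewrite Rintegral_cst // -[fine _]/(pr mu setT) pr_setT mulr1.
Qed.

Lemma dist_integral_le f g (e : R) : bounded_measurable f -> bounded_measurable g ->
  (forall x, `|f x - g x| <= e) -> `|\int[mu]_x f x - \int[mu]_x g x| <= e.
Proof.
move=> bf bg fg; rewrite -RintegralB //; try exact: bounded_measurable_integrable.
by apply: norm_integral_le fg; exact: bounded_measurableB.
Qed.

Section FiniteValued.
Variables (J : finType) (g : T -> J).
Hypothesis mg : forall j, measurable (g @^-1` [set j]).
Variable F : J -> R.

Let sumE x : F (g x) = \sum_j F j * \1_(g @^-1` [set j]) x.
Proof.
rewrite (bigD1 (g x)) //= indicE mem_set // mulr1 big1 ?addr0 // => j jx.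
by rewrite indicE memNset ?mulr0 //= => E; rewrite E eqxx in jx.
Qed.

Let bm_indic j : bounded_measurable (fun x => F j * \1_(g @^-1` [set j]) x).
Proof.
split; first by apply: measurable_realfun.measurable_funM; [exact: measurable_cst|exact: measurable_realfun.measurable_indic].
by exists `|F j| => x; rewrite normrM indicE ler_piMr // normr_nat lern1 leq_b1.
Qed.

Lemma finite_bounded_measurable : bounded_measurable (F \o g).
Proof.
rewrite (_ : F \o g = fun x => \sum_j F j * \1_(g @^-1` [set j]) x); last first.
  by apply/funext => x; exact: sumE.
split; first by apply: measurable_sum => j; case: (bm_indic j).
exists (\sum_j `|F j|) => x; apply: le_trans (ler_norm_sum _ _ _) _.
apply: ler_sum => j _.
by rewrite normrM indicE ler_piMr // normr_nat lern1 leq_b1.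
Qed.

Lemma integral_finite : \int[mu]_x F (g x) = \sum_j F j * pr mu (g @^-1` [set j]).
Proof.
under eq_Rintegral do rewrite sumE.
elim: (index_enum J) => [|j s IH].
  under eq_Rintegral do rewrite big_nil.
  by rewrite big_nil Rintegral_cst // mul0r.
under eq_Rintegral do rewrite big_cons.
rewrite big_cons RintegralD //; first last.
- rewrite (_ : _ \o _ = fun x => (\sum_(j <- s) (F j * \1_(g @^-1` [set j]) x)%:E)%E).
    by apply: integrable_sum => // i _; exact: bounded_measurable_integrable (bm_indic i).
  by apply/funext => x /=; rewrite sumEFin.
- exact: bounded_measurable_integrable.
congr (_ + _); last exact: IH.
rewrite RintegralZl //; last first.
  apply: bounded_measurable_integrable; split; first exact: measurable_realfun.measurable_indic.
  by exists 1 => x; rewrite indicE normr_nat lern1 leq_b1.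
by rewrite /Rintegral integral_indic // setIT.
Qed.

End FiniteValued.
End BoundedIntegrals.

Section ContinuousFunctions.
Variables (R : realType) (M : nat).
Notation X := (fullshift M).
Implicit Types (f : X -> R).

(** The full shift is compact, by Tychonoff's theorem. *)
Lemma continuous_bounded f : continuous f -> exists B : R, forall x, `|f x| <= B.
Proof.
move=> cf.
have cX : compact [set: X].
  have := @tychonoff int (fun=> alphabet M) (fun=> setT) _.
  rewrite (_ : [set _ | _] = setT) ?eqEsubset; last by split.
  apply=> i; apply: finite_compact; exact: finite_finset.
have [B [_ HB]] := compact_bounded (continuous_compact (continuous_subspaceT cf) cX).
by exists (B + 1) => x; apply: (HB (B + 1)); rewrite ?ltrDl //; exists x.
Qed.

Lemma continuous_bounded_measurable f : continuous f -> bounded_measurable (f : borel X -> R).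
Proof.
move=> cf; split; last exact: continuous_bounded.
apply: (measurability _ (measurable_realfun.RGenOpens.measurableE R)) => _ [_ [a [b ->] <-]].
rewrite setTI; apply: measurable_open.
by have /continuousP := cf; apply; exact: interval_open.
Qed.

End ContinuousFunctions.

(** * Decay of correlations for Hoelder functions *)

Section HoelderEstimates.
Variables (R : realType) (M : nat).
Notation X := (fullshift M).
Implicit Types (f g : X -> R) (theta : R).

Lemma le_sup_norm f : continuous f -> forall x, `|f x| <= sup_norm f.
Proof.
move=> /continuous_bounded[B fB] x; apply: ub_le_sup; last by exists x.
by exists B => _ [y _ <-].
Qed.

Lemma hoelder_dist theta f : 0 < theta -> hoelder_fun theta f -> forall n x y,
  (forall i : int, (`|i| < n)%N -> x i = y i) ->
  `|f x - f y| <= hoelder_seminorm theta f * theta ^+ n.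
Proof.
move=> t0 [cf [c0 hc0]] n x y xy.
have [B fB] := continuous_bounded cf.
have var_le : `|f x - f y| <= var_n n f.
  apply: ub_le_sup; last by exists x, y.
  exists (B + B) => _ [x' [y' [_ ->]]].
  by apply: le_trans (ler_normB _ _) _; rewrite lerD.
have tn0 : 0 < theta ^+ n by rewrite exprn_gt0.
apply: le_trans var_le _; rewrite -ler_pdivrMr //.
apply: lb_le_inf; first by exists c0.
by move=> c [_ /(_ n)]; rewrite -ler_pdivrMr.
Qed.

Lemma hoelder_seminorm_ge0 theta f : hoelder_fun theta f -> 0 <= hoelder_seminorm theta f.
Proof.
move=> [_ [c0 hc0]]; apply: lb_le_inf; first by exists c0.
by move=> c [/ltW].
Qed.

Lemma sup_norm_ge0 f : continuous f -> 0 <= sup_norm f.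
Proof. by move=> cf; apply: le_trans (le_sup_norm cf (fun=> ord0)). Qed.

(** A point with block [w] in the window of coordinates from [- m] on; it serves
    to turn a function of points into a function of words. *)
Definition fill (m : nat) (w : seq 'I_M.+1) : X := fun i => nth ord0 w (absz (i + m%:Z)).

Lemma fill_block m (x : X) (i : int) : (`|i| < m)%N ->
  fill m (block x (- m%:Z) m.*2) i = x i.
Proof.
move=> im; rewrite /fill nth_block; last by lia.
by congr x; lia.
Qed.

Lemma block_iter_shift n (x : X) a l :
  block (iter n (@left_shift M) x) a l = block x (a + n%:Z) l.
Proof. by apply: eq_map => k; rewrite iter_shiftE addrAC. Qed.

Lemma measurable_iter_shift n :
  measurable_fun [set: borel X] (iter n (@left_shift M) : borel X -> borel X).
Proof.
elim: n => [|n IH]; first exact: measurable_id.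
exact: (measurableT_comp (@measurable_shift M)).
Qed.

End HoelderEstimates.

Section Decay.
Variables (R : realType) (M : nat).
Notation X := (fullshift M).
Notation I := 'I_M.+1.
Variables (mu : probability (borel X) R) (p : seq I -> R).
Hypothesis muE : forall a w, pr mu (Cyl a w) = p w.

Let fiber n a (u : n.-tuple I) : (fun x : borel X => tblock n x a) @^-1` [set u] = Cyl a u.
Proof.
rewrite eqEsubset; split => x; rewrite /Cyl /= size_tuple; first by move=> <-.
by move=> E; apply: val_inj.
Qed.

Let bm_block n a (F : n.-tuple I -> R) : bounded_measurable (fun x : borel X => F (tblock n x a)).
Proof. by apply: finite_bounded_measurable => j; exact: measurable_tblock. Qed.

Let integral_block n a (F : n.-tuple I -> R) :
  \int[mu]_x F (tblock n x a) = \sum_u F u * p u.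
Proof.
rewrite (integral_finite mu (g := fun x => tblock n x a)); last by move=> j; exact: measurable_tblock.
by apply: eq_bigr => u _; rewrite fiber muE.
Qed.

Let integral_block2 m n l a (F : m.-tuple I -> R) (G : n.-tuple I -> R) :
  \int[mu]_x (F (tblock m x a) * G (tblock n x (a + (m + l)%:Z))) =
  \sum_u \sum_w F u * G w * \sum_(k : l.-tuple I) p (u ++ k ++ w).
Proof.
pose g (x : borel X) := (tblock m x a, tblock n x (a + (m + l)%:Z)).
have gE j : g @^-1` [set j] = Cyl a j.1 `&` Cyl (a + (m + l)%:Z) j.2.
  rewrite -!fiber eqEsubset; split => x; first by move=> /= <-.
  by move=> [/= E1 E2]; case: j E1 E2 => j1 j2 /= <- <-.
have mg j : measurable (g @^-1` [set j]).
  by rewrite gE; apply: measurableI; exact: measurable_Cyl.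
rewrite (integral_finite mu mg (fun j => F j.1 * G j.2)) pair_big /=.
apply: eq_bigr => -[u w] _ /=; congr (_ * _).
by rewrite gE /= -(pr_joint muE a u) size_tuple.
Qed.

Let sum1 n : \sum_(u : n.-tuple I) p u = 1.
Proof. exact: (sum_weights muE). Qed.

(** Integrals of functions of blocks are finite sums over words, to which the
    relative mixing estimate applies term by term. *)
Lemma block_decay (c BF BG : R) m n l a (F : m.-tuple I -> R) (G : n.-tuple I -> R) :
  (forall u w, `|\sum_(k : l.-tuple I) p (u ++ k ++ w) - p u * p w| <= c * (p u * p w)) ->
  (forall u, `|F u| <= BF) -> (forall w, `|G w| <= BG) -> forall b, 
  `|\int[mu]_x (F (tblock m x a) * G (tblock n x (a + (m + l)%:Z))) -
    (\int[mu]_x F (tblock m x a)) * (\int[mu]_x G (tblock n x b))| <= c * BF * BG.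
Proof.
move=> Hc HF HG b; rewrite integral_block2 !integral_block mulr_suml -sumrB.
have -> : c * BF * BG = \sum_(u : m.-tuple I) \sum_(w : n.-tuple I) (c * BF * BG) * (p u * p w).
  under eq_bigr do rewrite -mulr_sumr -mulr_sumr sum1 mulr1.
  by rewrite -mulr_sumr sum1 mulr1.
apply: le_trans (ler_norm_sum _ _ _) _; apply: ler_sum => u _.
rewrite mulr_sumr -sumrB; apply: le_trans (ler_norm_sum _ _ _) _; apply: ler_sum => w _.
rewrite [X in `|X|](_ : _ = (F u * G w) * (\sum_(k : l.-tuple I) p (u ++ k ++ w) - p u * p w)); last by ring.
rewrite normrM normrM [leRHS](_ : _ = (BF * BG) * (c * (p u * p w))); last by ring.
by apply: ler_pM; rewrite ?mulr_ge0 // ler_pM.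
Qed.

Lemma dist_mul_le (a b a' b' Na Nb e : R) : `|a - a'| <= Na * e -> `|b - b'| <= Nb * e ->
  `|a'| <= Na -> `|b| <= Nb -> 0 <= e -> `|a * b - a' * b'| <= 2 * Na * Nb * e.
Proof.
move=> ha hb a1 b1 e0; rewrite (_ : a * b - a' * b' = (a - a') * b + a' * (b - b')); last by ring.
apply: le_trans (ler_normD _ _) _; rewrite !normrM.
rewrite [leRHS](_ : _ = Na * e * Nb + Na * (Nb * e)); last by ring.
by apply: lerD; apply: ler_pM.
Qed.

Section Approximation.
Variables (theta : R) (t0 : 0 < theta) (f g : X -> R).
Hypotheses (hf : hoelder_fun theta f) (hg : hoelder_fun theta g).
Notation Nf := (hoelder_norm theta f).
Notation Ng := (hoelder_norm theta g).

Let sup_le (h : X -> R) x : hoelder_fun theta h -> `|h x| <= hoelder_norm theta h.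
Proof.
move=> hh; have [ch _] := hh; apply: le_trans (le_sup_norm ch x) _.
by rewrite lerDl hoelder_seminorm_ge0.
Qed.

Let approx_le (h : X -> R) m (x : X) : hoelder_fun theta h ->
  `|h x - h (fill m (tblock m.*2 x (- m%:Z)))| <= hoelder_norm theta h * theta ^+ m.
Proof.
move=> hh; have [ch _] := hh.
apply: le_trans (hoelder_dist t0 hh (n := m) _) _ => [i im|].
  by rewrite fill_block.
by rewrite ler_wpM2r ?lerDr ?sup_norm_ge0 // exprn_ge0 // ltW.
Qed.

(** Both functions are replaced by functions of the coordinates in a window of
    length [2 m]; a gap of length [l] is left between the two windows. *)
Lemma hoelder_correlation (c : R) m l :
  (forall u w, `|\sum_(k : l.-tuple I) p (u ++ k ++ w) - p u * p w| <= c * (p u * p w)) ->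
  `|\int[mu]_x (f x * g (iter (m.*2 + l) (@left_shift M) x)) - (\int[mu]_x f x) * (\int[mu]_x g x)|
  <= (4 * theta ^+ m + c) * Nf * Ng.
Proof.
move=> Hc; have [cf _] := hf; have [cg _] := hg.
have tm0 : 0 <= theta ^+ m by rewrite exprn_ge0 // ltW.
pose F (u : m.*2.-tuple I) := f (fill m u); pose G (u : m.*2.-tuple I) := g (fill m u).
have bf : bounded_measurable (f : borel X -> R) by exact: continuous_bounded_measurable.
have bg : bounded_measurable (g : borel X -> R) by exact: continuous_bounded_measurable.
pose S := iter (m.*2 + l) (@left_shift M) : borel X -> borel X.
have bgS : bounded_measurable (fun x : borel X => g (S x)).
  case: bg => mg [B gB]; split; last by exists B.
  exact: (measurableT_comp mg (@measurable_iter_shift M _)).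
have tS x : tblock m.*2 (S x) (- m%:Z) = tblock m.*2 x (- m%:Z + (m.*2 + l)%:Z).
  by apply: val_inj => /=; rewrite block_iter_shift.
have e1 : `|\int[mu]_x (f x * g (S x)) -
    \int[mu]_x (F (tblock m.*2 x (- m%:Z)) * G (tblock m.*2 x (- m%:Z + (m.*2 + l)%:Z)))|
    <= 2 * Nf * Ng * theta ^+ m.
  apply: dist_integral_le => [||x]; try exact: bounded_measurableM.
  apply: dist_mul_le => //; rewrite -?tS; try exact: approx_le; exact: sup_le.
have e2 : `|(\int[mu]_x F (tblock m.*2 x (- m%:Z))) * (\int[mu]_x G (tblock m.*2 x (- m%:Z))) -
    (\int[mu]_x f x) * (\int[mu]_x g x)| <= 2 * Nf * Ng * theta ^+ m.
  rewrite distrC; apply: dist_mul_le => //.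
  - by apply: dist_integral_le => // x; exact: approx_le.
  - by apply: dist_integral_le => // x; exact: approx_le.
  - by apply: norm_integral_le => // x; exact: sup_le.
  - by apply: norm_integral_le => // x; exact: sup_le.
have e3 := block_decay (F := F) (G := G) (- m%:Z) Hc (fun u => sup_le (fill m u) hf)
  (fun u => sup_le (fill m u) hg) (- m%:Z).
have -> : (4 * theta ^+ m + c) * Nf * Ng =
    2 * Nf * Ng * theta ^+ m + (c * Nf * Ng + 2 * Nf * Ng * theta ^+ m) by ring.
apply: le_trans (ler_distD _ _ _) _; apply: lerD; first exact: e1.
by apply: le_trans (ler_distD _ _ _) _; apply: lerD; [exact: e3|exact: e2].
Qed.

End Approximation.
Lemma exponential_decay_of_mixing : psi_mixing p -> exponential_decay mu.
Proof.
move=> [D [gamma [D0 /andP[g0 g1] HD]]] theta /andP[t0 t1].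
(* The window has half-length [n / 4], up to rounding; this is why the rate is a
   fourth root, and the constant absorbs the rounding. *)
pose rho := Num.max theta gamma; pose kappa := Num.sqrt (Num.sqrt rho).
have rho0 : 0 < rho by rewrite lt_max t0.
have rho1 : rho < 1 by rewrite gt_max t1.
have k0 : 0 < kappa by rewrite !sqrtr_gt0.
have k1 : kappa < 1 by rewrite -(expr_lt1 (n := 4)) ?(ltW k0) // (exprM _ 2 2) !sqr_sqrtr ?sqrtr_ge0 ?(ltW rho0).
have kE : kappa ^+ 4 = rho by rewrite (exprM _ 2 2) !sqr_sqrtr ?sqrtr_ge0 ?(ltW rho0).
exists ((4 + D) / kappa ^+ 3), kappa; rewrite k0 k1; split => // f g hf hg n.
(* Both windows fit, with a gap [l] at least as long as [m]. *)
pose m := (n %/ 4)%N; pose l := (n - m.*2)%N.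
have nE : n = (m.*2 + l)%N by rewrite /l /m; lia.
have ml : (m <= l)%N by rewrite /l /m; lia.
have n4 : (n <= 4 * m + 3)%N by rewrite /m; lia.
have Hl u w : `|\sum_(k : l.-tuple I) p (u ++ k ++ w) - p u * p w| <= D * gamma ^+ l * (p u * p w).
  exact: HD.
have := hoelder_correlation t0 hf hg m Hl; rewrite -nE => /le_trans; apply.
have norm_ge0 h : hoelder_fun theta h -> 0 <= hoelder_norm theta (h : X -> R).
  by move=> hh; rewrite addr_ge0 ?hoelder_seminorm_ge0 // sup_norm_ge0 //; case: hh.
have Nf0 := norm_ge0 f hf; have Ng0 := norm_ge0 g hg.
rewrite -!mulrA [leRHS](_ : _ = ((4 + D) / kappa ^+ 3 * kappa ^+ n) * (hoelder_norm theta f * hoelder_norm theta g)); last by ring.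
rewrite ler_wpM2r ?mulr_ge0 //.
have rm : rho ^+ m <= kappa ^+ n / kappa ^+ 3.
  rewrite ler_pdivlMr ?exprn_gt0 // -kE -exprM -exprD.
  by rewrite ler_wiXn2l ?(ltW k0) ?(ltW k1).
apply: (@le_trans _ _ ((4 + D) * rho ^+ m)); last first.
  by rewrite -mulrA ler_wpM2l ?addr_ge0 ?(ltW D0) // mulrC.
rewrite [leRHS]mulrDl; apply: lerD; (rewrite ler_wpM2l ?(ltW D0) //).
  by rewrite lerXn2r ?nnegrE ?(ltW t0) ?(ltW rho0) // le_max lexx.
apply: (@le_trans _ _ (rho ^+ l)).
  by rewrite lerXn2r ?nnegrE ?(ltW g0) ?(ltW rho0) // le_max lexx orbT.
by rewrite ler_wiXn2l ?(ltW rho0) ?(ltW rho1).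
Qed.

End Decay.

(** * Gibbs states *)

Section OperatorNorm.
Variables (R : realType) (d : nat).
Implicit Types (B : 'M[R]_d) (v : 'cV[R]_d).

Lemma enorm_le_sum v : enorm v <= \sum_i `|v i 0|.
Proof.
have s0 : 0 <= \sum_i `|v i 0| by exact: sumr_ge0.
rewrite /enorm -[leRHS]ger0_norm // -sqrtr_sqr ler_wsqrtr //.
rewrite expr2 mulr_suml; apply: ler_sum => i _.
rewrite -real_normK ?num_real // expr2 ler_wpM2l //.
by rewrite (bigD1 i) //= lerDl sumr_ge0.
Qed.

Lemma le_enorm v i : `|v i 0| <= enorm v.
Proof.
rewrite -sqrtr_sqr /enorm ler_wsqrtr // (bigD1 i) //= lerDl sumr_ge0 // => j _.
exact: sqr_ge0.
Qed.

Let enorm_mul_le B v : enorm v <= 1 -> enorm (B *m v) <= nrm B.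
Proof.
move=> v1; apply: le_trans (enorm_le_sum _) _; rewrite /nrm; apply: ler_sum => i _.
rewrite mxE; apply: le_trans (ler_norm_sum _ _ _) _; apply: ler_sum => j _.
by rewrite normrM ler_piMr // (le_trans (le_enorm v j)).
Qed.

Lemma enorm_mul_opnorm B v : enorm v <= 1 -> enorm (B *m v) <= opnorm B.
Proof.
move=> v1; apply: ub_le_sup; last by exists v.
by exists (nrm B) => _ [u u1 <-]; exact: enorm_mul_le.
Qed.

Lemma opnorm_ge0 B : 0 <= opnorm B.
Proof.
apply: le_trans (enorm_mul_opnorm B (v := 0) _); first exact: sqrtr_ge0.
by rewrite /enorm big1 ?sqrtr0 ?ler01 // => i _; rewrite mxE expr0n.
Qed.

Lemma opnorm_le_nrm B : opnorm B <= nrm B.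
Proof.
apply: ge_sup => [|_ [u u1 <-]]; last exact: enorm_mul_le.
exists (enorm (B *m 0)), 0 => //=.
by rewrite /enorm big1 ?sqrtr0 ?ler01 // => i _; rewrite mxE expr0n.
Qed.

Lemma nrm_le_opnorm B : nrm B <= (d * d)%:R * opnorm B.
Proof.
have Bij i j : `|B i j| <= opnorm B.
  have e1 : enorm (delta_mx j 0 : 'cV[R]_d) <= 1.
    rewrite /enorm (bigD1 j) //= mxE !eqxx expr1n big1 ?addr0 ?sqrtr1 // => k kj.
    by rewrite mxE (negPf kj) expr0n.
  apply: le_trans (enorm_mul_opnorm B e1).
  by rewrite -colE; apply: le_trans (le_enorm _ i); rewrite mxE.
rewrite /nrm; apply: (@le_trans _ _ (\sum_(i < d) \sum_(j < d) opnorm B)).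
  by apply: ler_sum => i _; apply: ler_sum.
by rewrite !sumr_const !card_ord -mulrnA mulr_natl.
Qed.

End OperatorNorm.

Section GibbsStates.
Variables (R : realType) (M d' : nat).
Notation d := d'.+1.
Notation X := (fullshift M).
Notation I := 'I_M.+1.
Variables (A : I -> 'M[R]_d) (t : R).
Hypotheses (Ainv : forall i, A i \in unitmx) (t_ge0 : 0 <= t).

(** The loss when the entry sum norm is replaced by the operator norm. *)
Let K : R := (d * d)%:R `^ t.

Let K_ge1 : 1 <= K.
Proof.
by have := @powR_le R t 1 (d * d)%:R t_ge0 ler01; rewrite powR1 => -> //; rewrite ler1n.
Qed.

Let op_le B : opnorm B `^ t <= nrm (B : 'M[R]_d) `^ t.
Proof. by rewrite powR_le ?opnorm_ge0 ?opnorm_le_nrm. Qed.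

Let nrm_le B : nrm (B : 'M[R]_d) `^ t <= K * opnorm B `^ t.
Proof. by rewrite /K -powRM ?opnorm_ge0 // powR_le ?nrm_ge0 ?nrm_le_opnorm. Qed.

Let cylinderE (x : X) n : cylinder x n = Cyl 0 (block x 0 n).
Proof.
rewrite eqEsubset; split => y; rewrite /cylinder /Cyl /= size_block => H.
  by apply: eq_block => k kn; rewrite add0r H.
by move=> k kn; have := block_eq H kn; rewrite add0r.
Qed.

Let mxwordE (x : X) n : mxword A n (fun i => x i%:Z) = mxw A (block x 0 n).
Proof. by rewrite mxword_mxw /block; under [in RHS]eq_map do rewrite add0r. Qed.

Let blockP (w : seq I) : exists x : X, block x 0 (size w) = w.
Proof.
exists (fun i : int => nth ord0 w (absz i)).
apply: (@eq_from_nth _ ord0); rewrite size_block // => k kw.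
by rewrite nth_block // add0r.
Qed.

Lemma gibbs_state_of_weights (mu : probability (borel X) R) p :
  (forall a w, pr mu (Cyl a w) = p w) -> word_gibbs A t p -> gibbs_state A t mu.
Proof.
move=> muE [C [P [C0 HC]]]; split; first exact: Cyl_shift_invariant muE.
have K0 : 0 < K by apply: lt_le_trans K_ge1.
exists (C * K), P; split; first exact: mulr_gt0.
move=> x n _ /=; rewrite -/(pr mu _) cylinderE muE mxwordE.
have := HC (block x 0 n); rewrite size_block.
set w := block x 0 n; have pw : 0 <= p w by rewrite -(muE 0) pr_ge0.
have := op_le (mxw A w); have := nrm_le (mxw A w).
move: (_ `^ t) (_ `^ t) (expR_gt0 (- (n%:R * P))) => b a.
move: (expR _) => e e0 ba ab /andP[h1 h2]; apply/andP; split.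
  rewrite invfM mulrAC ler_pdivrMr // (le_trans h1) // -mulrA ler_pM2l //.
  by rewrite mulrC.
apply: (@le_trans _ _ (C * p w)); last by rewrite mulrAC ler_peMr // mulr_ge0 // ltW.
by apply: le_trans h2; rewrite ler_pM2l.
Qed.

Lemma weights_of_gibbs_state (nu : probability (borel X) R) : gibbs_state A t nu ->
  word_measure (fun w => pr nu (Cyl 0 w)) /\ word_gibbs A t (fun w => pr nu (Cyl 0 w)).
Proof.
move=> [inv [C [P [C0 HC]]]]; split.
  split => [|w|w|w]; last 2 first.
  - by rewrite [RHS]pr_Cyl_rcons.
  - by rewrite -pr_Cyl_cons pr_Cyl_shift_invariant.
  - rewrite (_ : Cyl 0 [::] = setT) ?pr_setT // eqEsubset; split => //.
  - exact: pr_ge0.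
have K0 : 0 < K by apply: lt_le_trans K_ge1.
pose a := nrm (mxw A [::]) `^ t; have a0 : 0 < a.
  by rewrite powR_gt0 // nrm_gt0 mxw_neq0.
have a'0 : 0 < a^-1 by rewrite invr_gt0.
(* The last two terms account for the empty word. *)
pose C' := K * C + a + a^-1.
have KC0 : 0 < K * C by rewrite mulr_gt0.
have C'0 : 0 < C' by rewrite /C' !addr_gt0.
exists C', P; split => // -[|i w].
  rewrite /= mul0r oppr0 expR0 mul1r -/a (_ : Cyl 0 [::] = setT); last first.
    by rewrite eqEsubset; split.
  rewrite pr_setT !mulr1; apply/andP; split.
    by rewrite -[leRHS]invrK lef_pV2 ?posrE // lerDr addr_ge0 // ltW.
  by rewrite /C' -addrA addrCA lerDl addr_ge0 // ltW.
move: (i :: w) (isT : (0 < size (i :: w))%N) => v v0.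
have [x xv] := blockP v; have := HC x (size v) v0.
rewrite /= -/(pr nu _) cylinderE mxwordE xv.
have qv := pr_ge0 nu (Cyl 0 v); move: (pr nu _) qv => q q0.
have := op_le (mxw A v); have := nrm_le (mxw A v).
move: (_ `^ t) (_ `^ t) (expR_gt0 (- ((size v)%:R * P))) => c b.
move: (expR _) => e e0 cb bc /andP[h1 h2]; apply/andP; split.
  apply: (@le_trans _ _ (C^-1 * q)).
    rewrite ler_wpM2r // lef_pV2 ?posrE // /C' -addrA (@le_trans _ _ (K * C)) //.
      by rewrite ler_peMl // ltW.
    by rewrite lerDl addr_ge0 // ltW.
  by apply: le_trans h1 _; rewrite ler_pM2l.
apply: (@le_trans _ _ (K * C * q)); last first.
  by rewrite ler_wpM2r // /C' -addrA lerDl addr_ge0 // ltW.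
apply: (@le_trans _ _ (K * (e * c))); first by rewrite [leRHS]mulrCA ler_pM2l.
by rewrite -mulrA ler_pM2l.
Qed.

(** Both states have comparable weights, and [p] is mixing. *)
Lemma gibbs_state_unique (mu nu : probability (borel X) R) p :
  (forall a w, pr mu (Cyl a w) = p w) -> word_measure p -> psi_mixing p ->
  word_gibbs A t p -> gibbs_state A t nu ->
  forall B : set (borel X), measurable B -> nu B = mu B.
Proof.
move=> muE wp mix [C [P [C0 HC]]] gnu.
have [wq [C' [P' [C'0 HC']]]] := weights_of_gibbs_state gnu.
have [inv _] := gnu.
have p0 w : 0 < p w.
  rewrite -(pmulr_rgt0 _ C0); have /andP[_] := HC w; apply: lt_le_trans.
  by rewrite mulr_gt0 ?expR_gt0 // powR_gt0 // nrm_gt0 mxw_neq0.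
apply: eq_measure_Cyl => a w; rewrite pr_Cyl_shift_invariant // muE.
have a0 v : 0 <= nrm (mxw A v) `^ t by exact: powR_ge0.
have qp := gibbs_comparable wp wq C0 C'0 a0 HC HC'.
exact: (absolutely_continuous_eq wp wq mix qp p0 w).
Qed.

End GibbsStates.

Lemma proximal_dim_gt0 (R : realType) (I : Type) (d : nat) (A : I -> 'M[R]_d) :
  proximal A -> (0 < d)%N.
Proof.
case: d A => // A [n [w [l [/eigenvalueP[v _]]]]].
by rewrite thinmx0 eqxx.
Qed.

(* Uniqueness is agreement on Borel sets: a library measure is a function on all
   sets, whose values outside the sigma-algebra are unconstrained. *)
Theorem theorem3p3 (R : realType) (M d : nat) (A : 'I_M.+1 -> 'M[R]_d)
    (Ainv : forall i, A i \in unitmx)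
    (Aprox : proximal A) (Airr : strongly_irreducible A)
    (t : R) (t_ge0 : 0 <= t) :
  exists mu : probability (borel (fullshift M)) R,
    [/\ gibbs_state A t mu,
        forall nu : probability (borel (fullshift M)) R, gibbs_state A t nu ->
          forall B : set (borel (fullshift M)), measurable B -> nu B = mu B,
        weak_bernoulli mu &
        exponential_decay mu].
Proof.
case: d A Ainv Aprox Airr => [|d] A Ainv Aprox Airr.
  by have := proximal_dim_gt0 Aprox.
have [p [wp mix gp]] : exists p, [/\ word_measure p, psi_mixing p & word_gibbs A t p].
  move: t_ge0; rewrite le_eqVlt => /predU1P[<-|t0].
    exact: (uniform_word_measure ord0).
  have [conn pinch attr] := proximal_irreducible_words Ainv Aprox Airr.
  exact: (matrix_word_measure ord0 t0 Ainv conn pinch attr).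
have [mu muE] := exists_two_sided wp.
have p0 w : 0 <= p w by case: wp => _ /(_ w).
exists mu; split.
- exact: gibbs_state_of_weights muE gp.
- by move=> nu gnu; exact: gibbs_state_unique muE wp mix gp gnu.
- exact: weak_bernoulli_of_mixing muE p0 mix.
- exact: exponential_decay_of_mixing muE mix.
Qed.
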